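(* Let $q\geq 0$ and let $\mathsf{A}_{4.9}=\langle e_1,e_2,e_3,e_4\rangle$ be the real Lie algebra with $[e_1,e_2]=[e_1,e_3]=0$, $[e_2,e_3]=e_1$, $[e_1,e_4]=2qe_1$, $[e_2,e_4]=qe_2-e_3$, $[e_3,e_4]=e_2+qe_3$. Then, up to equivalence, the only non-linearizing realization of $\mathsf{A}_{4.9}$ is $$\Big\langle \partial_x,\ \partial_u,\ u\partial_x+t\partial_u,\ -(1+t^2)\partial_t+\Big(2qx-\frac{u^2}{2}\Big)\partial_x+(q-t)u\,\partial_u\Big\rangle .$$ That is, this is a non-linearizing realization and every non-linearizing realization is equivalent to it.
   Context: Consider third-order evolution equations $u_t=F(t,x,u,u_1,u_2)u_3+G(t,x,u,u_1,u_2)$, $F\neq 0$, where $u_k=\partial^k u/\partial x^k$. Everything is real, smooth and local, near points in general position (domains may be shrunk so that functions not identically zero do not vanish). Vector fields are of the form $Q=a(t)\partial_t+b(t,x,u)\partial_x+c(t,x,u)\partial_u$; $Q$ is a symmetry of the equation if its local flow maps solutions to solutions. An equivalence transformation is an invertible local change of variables $t'=T(t)$, $x'=X(t,x,u)$, $u'=U(t,x,u)$. An equation is linearizable if some equivalence transformation maps it to an equation linear in $u$ and its $x$-derivatives. A realization of a Lie algebra is a tuple of linearly independent (over $\mathbb{R}$) vector fields of the form $a(t)\partial_t+b(t,x,u)\partial_x+c(t,x,u)\partial_u$ satisfying the commutation relations of the basis of that algebra. It is admissible if all its elements are symmetries of some equation of the form $u_t=F(t,x,u,u_1,u_2)u_3+G(t,x,u,u_1,u_2)$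 (with $F\ne0$); it is non-linearizing if they are symmetries of some equation of the form $u_t=F(t,x,u,u_1,u_2)u_3+G(t,x,u,u_1,u_2)$ (with $F\ne0$) that is not linearizable. Here two realizations are equivalent if some equivalence transformation maps the Lie algebra (linear span) of one onto that of the other. *)

(* Defs.v *)
From HB Require Import structures.
From mathcomp Require Import all_boot all_order all_algebra.
From mathcomp Require Import all_classical all_reals all_analysis.

Set Implicit Arguments.
Unset Strict Implicit.
Unset Printing Implicit Defensive.

Import Order.TTheory GRing.Theory Num.Theory.
Import numFieldNormedType.Exports.
Local Open Scope classical_set_scope.
Local Open Scope ring_scope.

(* Everything is local: functions are total, but only their values on an
   explicitly given open set matter.  Coordinates:
     (t, x)              : R * R
     (t, x, u)           : R * R * R
     (t, x, u, u1, u2)   : R * R * R * R * R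
   As products associate to the left, if z : R * R then (z, f z) is the point
   of the graph of f above z.  "After shrinking the domains" is rendered as
   "on some nonempty open subset". *)

Section Smooth.
Context {R : realType} {V W : normedModType R}.

(* All directional derivatives are used instead of the partial ones; for
   finite-dimensional V this is the usual notion of a C^k function on A. *)
Fixpoint Ck (k : nat) (A : set V) (f : V -> W) : Prop :=
  (forall p, A p -> {for p, continuous f}) /\
  if k is k'.+1 then
    forall v, (forall p, A p -> derivable f p v) /\ Ck k' A (fun p => 'D_v f p)
  else True.

Definition smooth (A : set V) (f : V -> W) : Prop := forall k, Ck k A f.

End Smooth.

Section Equations.
Context {R : realType}.

Definition Dt (f : R * R -> R) (z : R * R) : R := 'D_((1, 0) : R * R) f z.
Definition Dx (f : R * R -> R) (z : R * R) : R := 'D_((0, 1) : R * R) f z.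

Definition jet2 (f : R * R -> R) (z : R * R) : R * R * R * R * R :=
  (z, f z, Dx f z, Dx (Dx f) z).

(* u_t = F(t,x,u,u1,u2) u3 + G(t,x,u,u1,u2) on a nonempty open set of
   2-jets. *)
Record evolution_eq := EvolutionEq {
  edom : set (R * R * R * R * R);
  eF : R * R * R * R * R -> R;
  eG : R * R * R * R * R -> R;
  edom_open : open edom;
  edom_neq0 : edom !=set0;
  eF_smooth : smooth edom eF;
  eG_smooth : smooth edom eG;
  eF_neq0 : forall j, edom j -> eF j != 0
}.

Definition base_dom (E : evolution_eq) : set (R * R * R) :=
  [set p | exists u1 u2 : R, edom E (p, u1, u2)].

Definition satisfies (E : evolution_eq) (f : R * R -> R) (z : R * R) : Prop :=
  Dt f z = eF E (jet2 f z) * Dx (Dx (Dx f)) z + eG E (jet2 f z).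

Definition solution (E : evolution_eq) (U : set (R * R)) (f : R * R -> R) :=
  [/\ open U, smooth U f &
      forall z, U z -> edom E (jet2 f z) /\ satisfies E f z].

(* The graph of g over U' is part of the image under Phi of the graph of f
   over U. *)
Definition carries (Phi : R * R * R -> R * R * R)
    (U : set (R * R)) (f : R * R -> R) (U' : set (R * R)) (g : R * R -> R) :=
  forall w, U' w -> exists2 z, U z & Phi (z, f z) = (w, g w).

Definition linear_eq (E : evolution_eq) : Prop :=
  exists a3 a2 a1 a0 b : R * R -> R,
  forall (z : R * R) (u u1 u2 : R), edom E (z, u, u1, u2) ->
    eF E (z, u, u1, u2) = a3 z /\
    eG E (z, u, u1, u2) = a2 z * u2 + a1 z * u1 + a0 z * u + b z.

(* t' = T(t), x' = X(t,x,u), u' = U(t,x,u), smooth on the open set A with a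
   smooth inverse on the open image. *)
Definition equivalence_transformation
    (A : set (R * R * R)) (phi : R * R * R -> R * R * R) : Prop :=
  [/\ open A, smooth A phi,
      exists T : R -> R, forall t x u, A (t, x, u) -> (phi (t, x, u)).1.1 = T t &
      exists psi, [/\ open (phi @` A), smooth (phi @` A) psi &
                      forall p, A p -> psi (phi p) = p]].

(* The change of variables phi turns E, restricted to the 2-jets in J, into
   E': whatever the smooth function f and its transform g, f satisfies E at a
   point iff g satisfies E' at the corresponding point. *)
Definition maps_equation (A : set (R * R * R)) (phi : R * R * R -> R * R * R)
    (J : set (R * R * R * R * R)) (E E' : evolution_eq) : Prop :=
  forall (U U' : set (R * R)) (f g : R * R -> R),
    open U -> smooth U f -> (forall z, U z -> A (z, f z)) ->
    open U' -> smooth U' g -> carries phi U f U' g ->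
  forall z w, U z -> U' w -> phi (z, f z) = (w, g w) -> J (jet2 f z) ->
    edom E' (jet2 g w) /\ (satisfies E f z <-> satisfies E' g w).

(* Some restriction of E to a nonempty open set of 2-jets is mapped to a linear
   (possibly inhomogeneous) equation. *)
Definition linearizable (E : evolution_eq) : Prop :=
  exists (J : set (R * R * R * R * R)) (A : set (R * R * R)) phi E',
    [/\ open J, J !=set0, J `<=` edom E &
        forall p u1 u2, J (p, u1, u2) -> A p] /\
    [/\ equivalence_transformation A phi, maps_equation A phi J E E' &
        linear_eq E'].

End Equations.

Section VectorFields.
Context {R : realType}.

(* (a, b, c) stands for a d/dt + b d/dx + c d/du. *)
Definition vfield := R * R * R -> R * R * R.

Definition projectable (D : set (R * R * R)) (Q : vfield) : Prop :=
  smooth D Q /\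
  exists a : R -> R, forall t x u, D (t, x, u) -> (Q (t, x, u)).1.1 = a t.

Definition bracket (P Q : vfield) : vfield :=
  fun p => 'D_(P p) Q p - 'D_(Q p) P p.

(* phi (s, p) is the point reached from p after time s. *)
Definition local_flow (D : set (R * R * R)) (Q : vfield) (d : R)
    (A : set (R * R * R)) (phi : R * (R * R * R) -> R * R * R) : Prop :=
  [/\ 0 < d, open A, smooth [set y | `|y.1| < d /\ A y.2] phi,
      forall p, A p -> phi (0, p) = p &
      forall p s, A p -> `|s| < d ->
        D (phi (s, p)) /\
        is_derive s (1 : R) (fun r : R => phi (r, p)) (Q (phi (s, p)))].

(* A small piece of a solution through any point is carried by the flow, for
   small times, to solutions (whenever the image is the graph of a function). *)
Definition symmetry (E : evolution_eq) (Q : vfield) : Prop :=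
  forall p0, base_dom E p0 -> exists d A phi,
    [/\ local_flow (base_dom E) Q d A phi, A p0 &
    forall U f z0, solution E U f -> U z0 -> A (z0, f z0) ->
      exists U0 : set (R * R), [/\ open U0, U0 z0, U0 `<=` U &
        \forall s \near (0 : R), forall (U' : set (R * R)) g,
          open U' -> smooth U' g ->
          carries (fun p => phi (s, p)) U0 f U' g -> solution E U' g]].

Definition linearly_independent n (D : set (R * R * R)) (e : 'I_n -> vfield) :=
  forall k : 'I_n -> R,
    (forall p, D p -> \sum_i k i *: e i p = 0) -> forall i, k i = 0.

(* phi maps the restriction to A of the span of e onto the restriction to
   phi(A) of the span of e'. *)
Definition maps_span n (A : set (R * R * R)) (phi : R * R * R -> R * R * R)
    (e e' : 'I_n -> vfield) : Prop :=
  let related (k k' : 'I_n -> R) := forall p, A p ->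
    'D_(\sum_i k i *: e i p) phi p = \sum_i k' i *: e' i (phi p) in
  (forall k, exists k', related k k') /\ (forall k', exists k, related k k').

(* Equivalence on some nonempty open part of D.  Open restrictions of a
   non-linearizing family are non-linearizing, so a statement about all
   domains D yields equivalence near a dense set of points. *)
Definition equivalent n (D : set (R * R * R)) (e : 'I_n -> vfield)
    (D' : set (R * R * R)) (e' : 'I_n -> vfield) : Prop :=
  exists A phi,
    [/\ A !=set0, A `<=` D, equivalence_transformation A phi,
        phi @` A `<=` D' & maps_span A phi e e'].

(* The basis e_1, ..., e_4 is indexed by 0, ..., 3. *)
Definition A49_relations (q : R) (D : set (R * R * R)) (e : 'I_4 -> vfield) :=
  let e1 := e 0 in let e2 := e 1 in let e3 := e 2%:R in let e4 := e 3%:R in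
  forall p, D p ->
  [/\ bracket e1 e2 p = 0, bracket e1 e3 p = 0 & bracket e2 e3 p = e1 p] /\
  [/\ bracket e1 e4 p = (2 * q) *: e1 p,
      bracket e2 e4 p = q *: e2 p - e3 p &
      bracket e3 e4 p = e2 p + q *: e3 p].

Definition A49_realization (q : R) (D : set (R * R * R))
    (e : 'I_4 -> vfield) : Prop :=
  [/\ open D, forall i, projectable D (e i), linearly_independent D e &
      A49_relations q D e].

Definition non_linearizing n (D : set (R * R * R)) (e : 'I_n -> vfield) :=
  exists E : evolution_eq,
    [/\ base_dom E = D, forall i, symmetry E (e i) & ~ linearizable E].

Definition A49_normal_form (q : R) (i : 'I_4) : vfield :=
  fun '(t, x, u) =>
  match val i with
  | 0%N => (0, 1, 0)
  | 1%N => (0, 0, 1)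
  | 2%N => (0, u, t)
  | _ => (- (1 + t ^+ 2), 2 * q * x - u ^+ 2 / 2, (q - t) * u)
  end.

End VectorFields.

(* Main.v *)
(** Write Q_i for the vector field realizing e_i.  The relations force the
    t-components of Q1, Q2, Q3 to vanish, Q1 and Q2 to be independent at some
    point, and Q4 to have a nonzero t-component there.  Near that point one
    flows along Q4 (with the parameter t chosen so that dt/ds = -(1 + t^2)),
    then along Q2, then along Q1.  In these coordinates Q1 is d/dx, Q2 is d/du,
    and the expressions expected for Q3 and Q4 hold because their defects solve
    linear transport equations with zero initial values (Gronwall).  The inverse
    function theorem and a translation depending on t give the normal form.

    Conversely the equation with
      F = m w / u1^6,  G = 1 / (2 u1) - 3 m w u2^2 / u1^7,
      w = (1 + t^2) u2 + t u1^3,  m = (1 + t^2)^(1/2) exp (- 3 q atan t)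
    is invariant under the normal form.  An equivalence transformation
    multiplies F by a factor depending only on t, x, u, u1, and the F of a linear
    equation depends on t, x alone; so F does not depend on u2 if the equation is
    linearizable, but here F is affine in u2 with nonzero slope. *)
From HB Require Import structures.
From mathcomp Require Import all_boot all_order all_algebra.
From mathcomp Require Import all_classical all_reals all_analysis.
From mathcomp Require Import ring lra.
Require Import Defs.

Set Implicit Arguments.
Unset Strict Implicit.
Unset Printing Implicit Defensive.

Import Order.TTheory GRing.Theory Num.Theory.
Import numFieldNormedType.Exports.
Local Open Scope classical_set_scope.
Local Open Scope ring_scope.


(** * Directional derivatives and C^k maps in finite dimension *)

(** Bracketing with Q4 rotates Q2 and Q3, and this rotation has no real eigenvector: both the
    vanishing of the time components and the transversality of Q4 come down to a sum of two real
    squares that cannot be zero. The new time is intrinsic. Since Q1 and Q2 span the vertical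
    directions, Q3 = a Q1 + b Q2, and the brackets with Q4 give b' = - (1 + b^2) and a' = (q - b) a
    along its flow. The coordinate t is the coefficient b, which explains the speed - (1 + t^2); the
    initial values of a and b are read off Q3 at the base point. The flows are furnished by the
    definition of [symmetry]. What remains is uniqueness for differential equations, and only for
    linear ones, because each desired identity is expressed by a defect that depends linearly on
    itself along the coordinate lines. The invariant equation is best understood after exchanging
    the roles of x and u: Q3 then acts as a Galilean boost on x = v(t, u), and the term 1 / (2 u1)
    of G is the image of the familiar - v_u^2 / 2. *)

Lemma nbhs_open {T : topologicalType} (A : set T) p : open A -> A p -> nbhs p A.
Proof. by move=> oA Ap; apply: open_nbhs_nbhs. Qed.

Section Directional.
Context {R : realType}.
Implicit Types V W : normedModType R.

Lemma is_derive_cvg V W (f : V -> W) p v d :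
  (fun h : R => h^-1 *: ((f \o shift p) (h *: v) - f p)) @ 0^' --> d -> is_derive p v f d.
Proof.
move=> H; apply: DeriveDef; first by apply/cvg_ex; exists d.
exact: cvg_lim H.
Qed.

Lemma is_derive_segment V W (f : V -> W) p v (s : R) d :
  is_derive (p + s *: v) v f d -> is_derive s (1 : R) (fun r => f (p + r *: v)) d.
Proof.
move=> [df <-]; apply: is_derive_cvg.
rewrite [X in X @ _](_ : _ = (fun r : R =>
   r^-1 *: ((f \o shift (p + s *: v)) (r *: v) - f (p + s *: v)))) //.
apply/funext => r /=; congr (_ *: (f _ - _)).
by rewrite [_%:A]mulr1 scalerDl addrCA addrA.
Qed.

Lemma near_line V (p v : V) (A : set V) :
  nbhs p A -> \forall h \near (0 : R), A (h *: v + p).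
Proof.
move=> nA; have cl : (fun h : R => h *: v + p) @ 0 --> p.
  rewrite -[X in _ --> X]add0r -[X in _ --> X + _](scale0r v).
  by apply: cvgD; [apply: cvgZr_tmp; exact: cvg_id | exact: cvg_cst].
exact: cl.
Qed.

(** The derivative of [h] is assumed along [v] only. Restricting everything to the curve
    [r => h (r *: v + p)], where derivability and differentiability agree, reduces the claim to the
    chain rule for ['d]. *)
Lemma is_derive_comp V W (X : normedModType R) (h : V -> W) (f : W -> X) p v dh :
  is_derive p v h dh -> differentiable f (h p) ->
  is_derive p v (f \o h) ('D_dh f (h p)).
Proof.
move=> [dhp <-] df.
have c0 : (0 : R) *: v + p = p by rewrite scale0r add0r.
have dg : differentiable (fun r : R => h (r *: v + p)) 0.
  by apply/derivable1_diffP; move/derivable1P: dhp.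
have df' : differentiable f (h ((0 : R) *: v + p)) by rewrite c0.
have D : differentiable (fun r : R => f (h (r *: v + p))) 0.
  exact: (@differentiable_comp _ _ _ _ (fun r : R => h (r *: v + p)) f 0 dg df').
have dfh : derivable (f \o h) p v.
  by apply/derivable1P/derivable1_diffP.
apply: DeriveDef => //.
have aux (Z : normedModType R) (k : V -> Z) :
    derivable (fun r : R => k (r *: v + p)) 0 1 ->
    'D_v k p = 'd (fun r : R => k (r *: v + p)) 0 1.
  move=> dk; rewrite -deriveE; last exact/derivable1_diffP.
  rewrite /derive; set g1 := fun r => r^-1 *: _; set g2 := fun r => r^-1 *: _.
  suff -> : g1 = g2 by [].
  apply/funext => r; rewrite /g1 /g2 /=.
  by rewrite addr0 scale0r add0r [_%:A]mulr1.
rewrite aux; last exact/derivable1_diffP.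
transitivity ('d (f \o (fun r : R => h (r *: v + p))) 0 1); first by [].
by rewrite diff_comp // deriveE //= c0 aux //; exact/derivable1_diffP.
Qed.

Lemma is_derive_pair V W (X : normedModType R) (f : V -> W) (g : V -> X) p v df dg :
  is_derive p v f df -> is_derive p v g dg ->
  is_derive p v (fun z => (f z, g z)) (df, dg).
Proof.
move=> [/[dup] cf /cvg_ex[lf]] + df' [/[dup] cg /cvg_ex[lg]] + dg'.
rewrite -df' -dg' => {lf lg} _ _.
have := cvg_pair cf cg => H.
have H2 : (fun h : R => h^-1 *: (((fun z => (f z, g z)) \o shift p) (h *: v) - (f p, g p)))
   @ 0^' --> ('D_v f p, 'D_v g p) by exact: H.
exact: is_derive_cvg H2.
Qed.

Lemma is_diff_fst V W (p : V * W) : is_diff p fst fst.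
Proof.
have c : continuous (fst : V * W -> V) by move=> ?; exact: cvg_fst.
by apply: DiffDef; [exact: linear_differentiable | rewrite diff_lin].
Qed.

Lemma is_diff_snd V W (p : V * W) : is_diff p snd snd.
Proof.
have c : continuous (snd : V * W -> W) by move=> ?; exact: cvg_snd.
by apply: DiffDef; [exact: linear_differentiable | rewrite diff_lin].
Qed.

Lemma is_derive_fst V W (X : normedModType R) (f : V -> W * X) p v df :
  is_derive p v f df -> is_derive p v (fun z => (f z).1) df.1.
Proof.
move=> H; have [d e] := is_diff_fst (f p).
apply: is_derive_eq; first exact: (is_derive_comp H d).
by rewrite deriveE // e.
Qed.

Lemma is_derive_snd V W (X : normedModType R) (f : V -> W * X) p v df :
  is_derive p v f df -> is_derive p v (fun z => (f z).2) df.2.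
Proof.
move=> H; have [d e] := is_diff_snd (f p).
apply: is_derive_eq; first exact: (is_derive_comp H d).
by rewrite deriveE // e.
Qed.

Lemma is_derive_scale V W (a : V -> R) (F : V -> W) p v da dF :
  is_derive p v a da -> is_derive p v F dF ->
  is_derive p v (fun z => a z *: F z) (da *: F p + a p *: dF).
Proof.
move=> [ca <-] [cF <-].
(* Derivability along [v] gives continuity of [F] along that line, which is what the product rule
   uses. *)
have Fc : (fun h : R => F (h *: v + p)) @ 0^' --> F p.
  have /differentiable_continuous : differentiable (fun r : R => F (r *: v + p)) 0.
    by apply/derivable1_diffP; move/derivable1P: cF.
  by move/continuous_withinNx; rewrite scale0r add0r.
have H : (fun h : R => h^-1 *: (((fun z => a z *: F z) \o shift p) (h *: v) - a p *: F p))
   @ 0^' --> 'D_v a p *: F p + a p *: 'D_v F p.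
  rewrite [X in X @ _](_ : _ = (fun h : R =>
     (h^-1 *: (a (h *: v + p) - a p)) *: F (h *: v + p) +
     a p *: (h^-1 *: (F (h *: v + p) - F p)))); last first.
    apply/funext => h /=; rewrite -[h^-1 *: (a _ - _)]/(h^-1 * _) -scalerA.
    rewrite [X in _ = _ + X]scalerA [X in _ = _ + X *: _]mulrC -[X in _ = _ + X]scalerA.
    by rewrite -scalerDr; congr (_ *: _); rewrite scalerBl scalerBr addrA subrK.
  by apply: cvgD; [exact: cvgZ | exact: cvgZl_tmp].
exact: is_derive_cvg H.
Qed.

Lemma MVT_dir V (f : V -> R) (p v : V) :
  (forall s : R, 0 <= s <= 1 -> derivable f (p + s *: v) v) ->
  exists2 c : R, 0 < c < 1 & f (p + v) - f p = 'D_v f (p + c *: v).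
Proof.
move=> H.
pose g (r : R) := f (p + r *: v).
have dg (s : R) : 0 <= s <= 1 -> is_derive s (1 : R) g ('D_v f (p + s *: v)).
  by move=> /H h; exact: is_derive_segment (derivableP h).
have [||c cI e] := @MVT R g (fun s => 'D_v f (p + s *: v)) 0 1 ltr01.
- by move=> x /[1!in_itv] /= /andP[a b]; apply: dg; rewrite !ltW.
- apply: derivable_within_continuous => x /[1!in_itv] /= h.
  by case: (dg _ h).
exists c; first by move: cI; rewrite in_itv.
by rewrite /g scale1r scale0r addr0 subr0 mulr1 in e.
Qed.

Lemma is_derive_linear V (f : V -> R) p v : is_diff p f f -> is_derive p v f (f v).
Proof.
move=> [d e]; apply: DeriveDef; first exact: diff_derivable.
by rewrite deriveE // e.
Qed.

End Directional.

(* The two features of finite dimension that are needed: continuous linear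
   coordinates and compact neighbourhoods. *)
Class findim {R : realType} (V : normedModType R) := Findim {
  fI : finType;
  fb : fI -> V;
  fc : fI -> V -> R;
  fc_diff : forall i p, is_diff p (fc i) (fc i);
  fb_sum : forall v, \sum_i fc i v *: fb i = v;
  fcompact : forall (x : V) (O : set V), nbhs x O ->
     exists K, [/\ compact K, nbhs x K & K `<=` O]
}.


(** Reparametrising the line by [r => r * c] gives homogeneity in the direction from derivability
    along a single line; the case [c = 0] needs no separate treatment. *)
Lemma is_derive_dirZ {R : realType} {V W : normedModType R} (f : V -> W) x v d (c : R) :
  is_derive x v f d -> is_derive x (c *: v) f (c *: d).
Proof.
move=> [fx <-].
pose g (r : R) := f (r *: v + x).
have dg : differentiable g 0 by apply/derivable1_diffP; move/derivable1P: fx.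
have Dk : is_derive (0 : R) (1 : R) (fun r : R => r * c) c.
  apply: (is_derive_eq (is_deriveM (is_derive_id _ _) (is_derive_cst c _ _))).
  by rewrite scaler0 add0r [LHS]mulr1.
have dg0 : differentiable g ((0 : R) * c) by rewrite mul0r.
have := is_derive_comp Dk dg0; rewrite mul0r => H.
have D1 (k : R -> W) (w : V) : (forall r, k r = f (r *: w + x)) ->
    derivable k 0 1 -> derivable f x w /\ 'D_w f x = 'D_1 k 0.
  move=> kE; rewrite /derivable /derive.
  set g1 := fun r => r^-1 *: _; set g2 := fun r => r^-1 *: _.
  suff -> : g1 = g2 by [].
  by apply/funext => r; rewrite /g1 /g2 /= !kE addr0 scale0r add0r [_%:A]mulr1.
have [||dx Dx] := D1 (g \o (fun r => r * c)) (c *: v).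
- by move=> r; rewrite /g /= scalerA.
- by case: H.
apply: DeriveDef => //; rewrite Dx; have [_ ->] := H; rewrite deriveE //.
have -> : 'D_v f x = 'd g 0 1.
  rewrite -deriveE //.
  by have [] := D1 g v (fun=> erefl) (proj2 (derivable1_diffP _ _) dg).
by rewrite -{1}[c]mulr1 linearZ.
Qed.

Lemma cvg_sumr {R : realType} {W : normedModType R} (J T : Type) (F : set_system T)
    {FF : Filter F} (s : seq J) (f : J -> T -> W) (l : J -> W) :
  (forall j, f j x @[x --> F] --> l j) ->
  \sum_(j <- s) f j x @[x --> F] --> \sum_(j <- s) l j.
Proof.
move=> H; elim: s => [|j s IH].
  by rewrite big_nil; under eq_fun do rewrite big_nil; exact: cvg_cst.
rewrite big_cons; under eq_fun do rewrite big_cons.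
by apply: cvgD.
Qed.

Section Findim.
Context {R : realType} {V : normedModType R} {fV : findim V}.
Local Notation I := (@fI R V fV).

Lemma fcE (i : I) v : fc i v = 'd (fc i) 0 v.
Proof. by have [_ ->] := fc_diff i 0. Qed.

Lemma fcD (i : I) u v : fc i (u + v) = fc i u + fc i v.
Proof. by rewrite !fcE linearD. Qed.

Lemma fcB (i : I) u v : fc i (u - v) = fc i u - fc i v.
Proof. by rewrite !fcE linearB. Qed.

Lemma fcZ (i : I) (a : R) v : fc i (a *: v) = a * fc i v.
Proof. by rewrite !fcE linearZ. Qed.

Lemma fc0 (i : I) : fc i 0 = 0.
Proof. by rewrite fcE linear0. Qed.

Lemma fc_lip (i : I) : exists2 k, 0 < k & forall v, `|fc i v| <= k * `|v|.
Proof.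
have [d _] := fc_diff i 0.
have [|k k0 H] := @linear_lipschitz R V R ('d (fc i) 0).
  exact: diff_continuous.
by exists k => // v; rewrite fcE.
Qed.

Lemma fc_sum_lip : exists2 M, 0 < M & forall v, \sum_(i : I) `|fc i v| <= M * `|v|.
Proof.
elim: (index_enum I) => [|i s [M M0 IH]]; first by exists 1 => // v; rewrite big_nil mul1r.
have [k k0 kP] := fc_lip i; exists (k + M) => [|v]; first exact: addr_gt0.
by rewrite big_cons mulrDl lerD.
Qed.

Lemma fb_lip (s : seq I) : exists2 M, 0 < M &
  forall h, `|\sum_(i <- s) fc i h *: fb i| <= M * `|h|.
Proof.
elim: s => [|j s [M M0 IH]].
  by exists 1 => // h; rewrite big_nil normr0 mul1r.
have [k k0 kP] := fc_lip j.
exists (k * `|fb j| + M) => [|h]; first by rewrite ltr_wpDl // mulr_ge0 // ltW.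
rewrite big_cons (le_trans (ler_normD _ _)) // mulrDl lerD //.
by rewrite normrZ mulrAC ler_wpM2r.
Qed.

Lemma derive_findim (W : normedModType R) (f : V -> W) p v : differentiable f p ->
  'D_v f p = \sum_(i : I) fc i v *: 'D_(fb i) f p.
Proof.
move=> df; rewrite deriveE // -{1}(fb_sum v) linear_sum.
by apply: eq_bigr => i _; rewrite linearZ deriveE.
Qed.

(** The displacement is built up one coordinate at a time. Each stage is a mean value estimate along
    a basis vector, and continuity of the partial derivatives replaces the intermediate point by
    [p]. *)
Lemma partials_differentiable (f : V -> R) p :
  (\forall x \near p, forall i : I, derivable f x (fb i)) ->
  (forall i : I, {for p, continuous (fun x => 'D_(fb i) f x)}) ->
  differentiable f p.
Proof.
move=> df cf.
(* Induction on the coordinates already moved; the accuracy [e] is quantified inside so that it can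
   be halved at each stage. *)
have main (s : seq I) : forall e : R, 0 < e -> \forall h \near (0 : V),
    `|f (\sum_(i <- s) fc i h *: fb i + p) - f p
       - \sum_(i <- s) fc i h * 'D_(fb i) f p| <= e * `|h|.
  elim: s => [|j s IH] e e0.
    by apply: nearW => h; rewrite !big_nil add0r subrr subrr normr0 mulr_ge0 // ltW.
  have [k k0 kP] := fc_lip j.
  have [M M0 MP] := fb_lip s.
  have e2 : 0 < e / 2 by rewrite divr_gt0.
  have ek : 0 < e / 2 / k by rewrite divr_gt0.
  have /nbhs_ballP[r /= r0 rP] : \forall x \near p, (forall i : I, derivable f x (fb i)) /\
     `|'D_(fb j) f p - 'D_(fb j) f x| < e / 2 / k.
    apply: filterI => //; move/cvgrPdist_lt: (cf j); exact.
  have N0 : 0 < M + k * `|fb j| by rewrite ltr_pwDl // mulr_ge0 // ltW.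
  near=> h.
  have IHh : `|f (\sum_(i <- s) fc i h *: fb i + p) - f p
     - \sum_(i <- s) fc i h * 'D_(fb i) f p| <= e / 2 * `|h|.
    by near: h; exact: IH.
  move: IHh; set q := \sum_(i <- s) fc i h *: fb i + p => IHh.
  have inb (t : R) : 0 <= t <= 1 -> ball p r (q + t *: (fc j h *: fb j)).
    move=> /andP[t0 t1]; rewrite -ball_normE /= distrC /q addrAC addrK.
    rewrite (@le_lt_trans _ _ ((M + k * `|fb j|) * `|h|)) //; last first.
      rewrite mulrC -ltr_pdivlMr //; near: h; apply: nbhs0_lt; exact: divr_gt0.
    rewrite (le_trans (ler_normD _ _)) // mulrDl lerD //.
    rewrite !normrZ mulrA (ger0_norm t0) [k * _ * _]mulrAC ler_wpM2r //.
    by rewrite (le_trans _ (kP h)) // ler_piMl.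
  have [t tI|c c01 cE] := @MVT_dir R V f q (fc j h *: fb j).
    have [d _] := rP _ (inb _ tI).
    by have [] := is_derive_dirZ (fc j h) (derivableP (d j)).
  have cI : 0 <= c <= 1 by case/andP: c01 => *; rewrite !ltW.
  have [d dj] := rP _ (inb c cI).
  rewrite !big_cons (_ : _ + _ + p = q + fc j h *: fb j); last by rewrite -addrA addrC.
  have [_ DE] := is_derive_dirZ (fc j h) (derivableP (d j)).
  have -> : f (q + fc j h *: fb j) = f q + fc j h * 'D_(fb j) f (q + c *: (fc j h *: fb j)).
    by rewrite -[LHS](subrK (f q)) cE DE addrC.
  set D := 'D_(fb j) f (_ + _).
  rewrite (_ : _ - _ - _ = (f q - f p - \sum_(i <- s) fc i h * 'D_(fb i) f p) +
     fc j h * (D - 'D_(fb j) f p)); last by ring.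
  rewrite (le_trans (ler_normD _ _)) // [e]splitr mulrDl lerD //.
  rewrite normrM [X in _ * X]distrC.
  apply: (@le_trans _ _ (k * `|h| * (e / 2 / k))).
    by apply: ler_pM => //; exact: ltW.
  by rewrite (_ : k * _ * _ = e / 2 * `|h|) //; field; rewrite gt_eqF.
have linL : linear (fun v => \sum_(i : I) fc i v * 'D_(fb i) f p : R).
  move=> a u v; rewrite scaler_sumr -big_split /=; apply: eq_bigr => i _.
  by rewrite fcD fcZ mulrDl -mulrA.
pose LM := GRing.isLinear.Build _ _ _ _ _ linL.
pose L : {linear V -> R} := HB.pack (fun v => \sum_(i : I) fc i v * 'D_(fb i) f p : R) LM.
have cL : continuous L.
  move=> x; apply: cvg_sumr => i /=; apply: cvgMr_tmp.
  have [d _] := fc_diff i x; exact: (differentiable_continuous d).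
have ex : f \o shift p = cst (f p) + L +o_ 0 id.
  apply/eqaddoP => _/posnumP[e].
  have M := main (index_enum I) e%:num (gt0 _).
  near=> h.
  have : `|f (\sum_(i : I) fc i h *: fb i + p) - f p
       - \sum_(i : I) fc i h * 'D_(fb i) f p| <= e%:num * `|h| by near: h; exact: M.
  rewrite fb_sum => H.
  by rewrite [X in `|X|](_ : _ = f (h + p) - f p - \sum_i fc i h * 'D_(fb i) f p) // opprD addrA.
have dE : 'd f p = L :> (V -> R) by exact: diff_unique.
by apply/diff_locallyP; rewrite dE.
Unshelve. all: by end_near.
Qed.

End Findim.


Lemma is_derive_inv {R : realType} {V : normedModType R} (f : V -> R) p v d :
  f p != 0 -> is_derive p v f d ->
  is_derive p v (fun y => (f y)^-1) (- (f p) ^- 2 * d).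
Proof.
move=> f0 [df <-]; apply: DeriveDef; first exact: derivableV.
by rewrite deriveV.
Qed.

Section Ck_theory.
Context {R : realType}.
Implicit Types V W X : normedModType R.

Lemma Ck_cont V W k (A : set V) (f : V -> W) p : Ck k A f -> A p -> {for p, continuous f}.
Proof. by case: k => [|k] [H _]; exact: H. Qed.

Lemma Ck_derivable V W k (A : set V) (f : V -> W) p v :
  Ck k.+1 A f -> A p -> derivable f p v.
Proof. by move=> [_ /(_ v)[H _]]; exact: H. Qed.
Arguments Ck_derivable {V W k A f p} v _ _.

Lemma Ck_derive V W k (A : set V) (f : V -> W) v :
  Ck k.+1 A f -> Ck k A (fun p => 'D_v f p).
Proof. by move=> [_ /(_ v)[_ H]]. Qed.

Lemma Ck_pred V W k (A : set V) (f : V -> W) : Ck k.+1 A f -> Ck k A f.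
Proof.
elim: k f => [|k IH] f [cf H]; first by split.
split=> // v; split=> [p Ap|]; first by have [/(_ p Ap)] := H v.
by apply: IH; have [_] := H v.
Qed.

Lemma Ck_sub V W k (A B : set V) (f : V -> W) : B `<=` A -> Ck k A f -> Ck k B f.
Proof.
move=> BA; elim: k f => [|k IH] f [cf H].
  by split=> // p /BA; exact: cf.
split=> [p /BA|v]; first exact: cf.
have [Hd Hk] := H v; split=> [p /BA|]; [exact: Hd | exact: IH].
Qed.

Lemma Ck_ext V W k (A : set V) (f g : V -> W) : open A ->
  (forall p, A p -> f p = g p) -> Ck k A f -> Ck k A g.
Proof.
move=> oA; elim: k f g => [|k IH] f g fg [cf H].
  split=> // p Ap; apply: cvg_trans (cvg_trans (cf p Ap) _).
    by apply: near_eq_cvg; apply: filterS (nbhs_open oA Ap) => x /fg.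
  by rewrite fg.
have nfg p : A p -> \near p, f p = g p.
  by move=> Ap; apply: filterS (nbhs_open oA Ap) => x /fg.
split=> [p Ap|v].
  apply: cvg_trans (cvg_trans (cf p Ap) _).
    by apply: near_eq_cvg; exact: nfg.
  by rewrite fg.
have [Hd Hk] := H v; split=> [p Ap|].
  by apply: near_eq_derivable (Hd p Ap); exact: nfg.
by apply: IH Hk => p Ap; apply: near_eq_derive; exact: nfg.
Qed.

Lemma Ck_linear_comp V W k (A : set V) (f : V -> W) (l : W -> R) :
  open A -> (forall p, is_diff p l l) -> Ck k A f -> Ck k A (fun p => l (f p)).
Proof.
move=> oA dl; elim: k f => [|k IH] f [cf H]; split=> //.
- move=> p Ap; apply: continuous_comp; first exact: cf.
  by have [d _] := dl (f p); exact: differentiable_continuous.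
- move=> p Ap; apply: continuous_comp; first exact: cf.
  by have [d _] := dl (f p); exact: differentiable_continuous.
move=> v; have [Hd Hk] := H v.
have D p : A p -> is_derive p v (l \o f) (l ('D_v f p)).
  move=> Ap; have [d e] := dl (f p).
  apply: is_derive_eq; first exact: (is_derive_comp (derivableP (Hd p Ap)) d).
  by rewrite deriveE // e.
split=> [p Ap|]; first by have [] := D p Ap.
by apply: Ck_ext (IH _ Hk) => // p Ap; have [_ <-] := D p Ap.
Qed.

Lemma differentiable_sumr V W (J : Type) (s : seq J) (f : J -> V -> W) p :
  (forall j, differentiable (f j) p) -> differentiable (fun x => \sum_(j <- s) f j x) p.
Proof.
move=> H; elim: s => [|j s IH].
  by under eq_fun do rewrite big_nil; exact: differentiable_cst.
by under eq_fun do rewrite big_cons; exact: differentiableD.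
Qed.

Lemma Ck_differentiable V {fV : findim V} W {fW : findim W} k (A : set V) (f : V -> W) p :
  open A -> Ck k.+1 A f -> A p -> differentiable f p.
Proof.
move=> oA cf Ap.
rewrite (_ : f = (fun x => \sum_(i : @fI R W fW) fc i (f x) *: fb i)); last first.
  by apply/funext => x; rewrite fb_sum.
apply: differentiable_sumr => i; apply: differentiableZl.
have cif : Ck k.+1 A (fun x => fc i (f x)).
  by apply: Ck_linear_comp cf => // q; exact: fc_diff.
apply: partials_differentiable.
  apply: filterS (nbhs_open oA Ap) => x Ax j.
  exact: (Ck_derivable _ cif Ax).
by move=> j; exact: (Ck_cont (Ck_derive _ cif) Ap).
Qed.

(** The inductive proofs below go through this rule, because [Ck] speaks of ['D_v f] itself while
    calculus yields a formula for it on the open set [A]. *)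
Lemma Ck_is_derive V W k (A : set V) (f : V -> W) (df : V -> V -> W) : open A ->
  (forall p, A p -> {for p, continuous f}) ->
  (forall v p, A p -> is_derive p v f (df v p)) -> (forall v, Ck k A (df v)) ->
  Ck k.+1 A f.
Proof.
move=> oA cf H Hd; split=> // v; split=> [p Ap|]; first by have [] := H v p Ap.
by apply: Ck_ext (Hd v) => // p Ap; have [_ ->] := H v p Ap.
Qed.

Lemma Ck_cst V W k (A : set V) (w : W) : Ck k A (fun=> w).
Proof.
elim: k w => [|k IH] w; first by split=> // p _; exact: cst_continuous.
split=> [p _|v]; first exact: cst_continuous.
split=> [p _|]; first exact: derivable_cst.
by under eq_fun do rewrite derive_cst; exact: IH.
Qed.

Lemma Ck_add V W k (A : set V) (f g : V -> W) : open A ->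
  Ck k A f -> Ck k A g -> Ck k A (fun p => f p + g p).
Proof.
move=> oA; elim: k f g => [|k IH] f g cf cg.
  by split=> // p Ap; apply: cvgD; [exact: (Ck_cont cf Ap) | exact: (Ck_cont cg Ap)].
apply: (@Ck_is_derive _ _ _ _ _ (fun v p => 'D_v f p + 'D_v g p)) => //.
- by move=> p Ap; apply: cvgD; [exact: (Ck_cont cf Ap) | exact: (Ck_cont cg Ap)].
- move=> v p Ap; apply: is_deriveD; apply: derivableP.
    exact: (Ck_derivable _ cf Ap).
  exact: (Ck_derivable _ cg Ap).
by move=> v; apply: IH; exact: Ck_derive.
Qed.

Lemma Ck_scale V W k (A : set V) (a : V -> R) (f : V -> W) : open A ->
  Ck k A a -> Ck k A f -> Ck k A (fun p => a p *: f p).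
Proof.
move=> oA; elim: k a f => [|k IH] a f ca cf.
  by split=> // p Ap; apply: cvgZ; [exact: (Ck_cont ca Ap) | exact: (Ck_cont cf Ap)].
apply: (@Ck_is_derive _ _ _ _ _ (fun v p => 'D_v a p *: f p + a p *: 'D_v f p)) => //.
- by move=> p Ap; apply: cvgZ; [exact: (Ck_cont ca Ap) | exact: (Ck_cont cf Ap)].
- move=> v p Ap; apply: is_derive_scale; apply: derivableP.
    exact: (Ck_derivable _ ca Ap).
  exact: (Ck_derivable _ cf Ap).
move=> v; apply: Ck_add => //; apply: IH => //; try exact: Ck_pred; exact: Ck_derive.
Qed.

Lemma Ck_sum V W k (A : set V) (J : Type) (s : seq J) (f : J -> V -> W) : open A ->
  (forall j, Ck k A (f j)) -> Ck k A (fun p => \sum_(j <- s) f j p).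
Proof.
move=> oA H; elim: s => [|j s IH].
  by under eq_fun do rewrite big_nil; exact: Ck_cst.
by under eq_fun do rewrite big_cons; exact: Ck_add.
Qed.

Lemma Ck_pair V W X k (A : set V) (f : V -> W) (g : V -> X) : open A ->
  Ck k A f -> Ck k A g -> Ck k A (fun p => (f p, g p)).
Proof.
move=> oA; elim: k f g => [|k IH] f g cf cg.
  by split=> // p Ap; apply: cvg_pair; [exact: (Ck_cont cf Ap) | exact: (Ck_cont cg Ap)].
apply: (@Ck_is_derive _ _ _ _ _ (fun v p => ('D_v f p, 'D_v g p))) => //.
- by move=> p Ap; apply: cvg_pair; [exact: (Ck_cont cf Ap) | exact: (Ck_cont cg Ap)].
- move=> v p Ap; apply: is_derive_pair; apply: derivableP.
    exact: (Ck_derivable _ cf Ap).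
  exact: (Ck_derivable _ cg Ap).
by move=> v; apply: IH; exact: Ck_derive.
Qed.

Lemma Ck_fst V W X k (A : set V) (f : V -> W * X) : open A ->
  Ck k A f -> Ck k A (fun p => (f p).1).
Proof.
move=> oA; elim: k f => [|k IH] f cf.
  split=> // p Ap; apply: (@cvg_comp _ _ _ f fst); first exact: (Ck_cont cf Ap).
  exact: cvg_fst.
apply: (@Ck_is_derive _ _ _ _ _ (fun v p => ('D_v f p).1)) => //.
- move=> p Ap; apply: (@cvg_comp _ _ _ f fst); first exact: (Ck_cont cf Ap).
  exact: cvg_fst.
- move=> v p Ap; apply: is_derive_fst; apply: derivableP.
  exact: (Ck_derivable _ cf Ap).
by move=> v; apply: IH; exact: Ck_derive.
Qed.

Lemma Ck_snd V W X k (A : set V) (f : V -> W * X) : open A ->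
  Ck k A f -> Ck k A (fun p => (f p).2).
Proof.
move=> oA; elim: k f => [|k IH] f cf.
  split=> // p Ap; apply: (@cvg_comp _ _ _ f snd); first exact: (Ck_cont cf Ap).
  exact: cvg_snd.
apply: (@Ck_is_derive _ _ _ _ _ (fun v p => ('D_v f p).2)) => //.
- move=> p Ap; apply: (@cvg_comp _ _ _ f snd); first exact: (Ck_cont cf Ap).
  exact: cvg_snd.
- move=> v p Ap; apply: is_derive_snd; apply: derivableP.
  exact: (Ck_derivable _ cf Ap).
by move=> v; apply: IH; exact: Ck_derive.
Qed.

Lemma Ck_id V k (A : set V) : Ck k A id.
Proof.
case: k => [|k]; first by split=> // p _; exact: cvg_id.
split=> [p _|v]; first exact: cvg_id.
split=> [p _|]; first exact: derivable_id.
by under eq_fun do rewrite derive_id; exact: Ck_cst.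
Qed.

(** The derivative of the inverse is again a product of inverses with ['D_v f], so order [k] of the
    inverse yields order [k.+1]. *)
Lemma Ck_inv V k (A : set V) (f : V -> R) : open A -> (forall p, A p -> f p != 0) ->
  Ck k A f -> Ck k A (fun p => (f p)^-1).
Proof.
move=> oA f0; elim: k f f0 => [|k IH] f f0 cf.
  by split=> // p Ap; apply: cvgV; [exact: f0 | exact: (Ck_cont cf Ap)].
apply: (@Ck_is_derive _ _ _ _ _
  (fun v p => (-1) *: (((f p)^-1 *: (f p)^-1) *: 'D_v f p))) => //.
- by move=> p Ap; apply: cvgV; [exact: f0 | exact: (Ck_cont cf Ap)].
- move=> v p Ap; apply: is_derive_eq.
    apply: is_derive_inv; first exact: f0.
    by apply: derivableP; exact: (Ck_derivable _ cf Ap).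
  by rewrite scaleN1r mulNr -exprVn expr2.
move=> v; have cfi : Ck k A (fun p => (f p)^-1) by apply: IH => //; exact: Ck_pred.
apply: Ck_scale => //; first exact: Ck_cst.
by apply: Ck_scale => //; [exact: Ck_scale | exact: Ck_derive].
Qed.

(** The chain rule differentiates [f] in a direction that varies with the point. Expanding this
    direction in the basis of [W] leaves the fixed directions [fb i], to which the induction
    hypothesis applies. *)
Lemma Ck_comp V {fV : findim V} W {fW : findim W} X {fX : findim X} k
    (A : set V) (B : set W) (h : V -> W) (f : W -> X) :
  open A -> open B -> (forall p, A p -> B (h p)) ->
  Ck k A h -> Ck k B f -> Ck k A (fun p => f (h p)).
Proof.
move=> oA oB AB; elim: k f => [|k IH] f ch cf.
  split=> // p Ap; apply: continuous_comp; first exact: (Ck_cont ch Ap).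
  exact: (Ck_cont cf (AB _ Ap)).
apply: (@Ck_is_derive _ _ _ _ _ (fun v p =>
   \sum_(i : @fI R W fW) fc i ('D_v h p) *: 'D_(fb i) f (h p))) => //.
- move=> p Ap; apply: continuous_comp; first exact: (Ck_cont ch Ap).
  exact: (Ck_cont cf (AB _ Ap)).
- move=> v p Ap; have df : differentiable f (h p) by exact: (Ck_differentiable oB cf (AB _ Ap)).
  rewrite -derive_findim //.
  exact: (is_derive_comp (derivableP (Ck_derivable v ch Ap)) df).
move=> v; apply: Ck_sum => // i; apply: Ck_scale => //.
  apply: Ck_linear_comp => //; first by move=> p; exact: fc_diff.
  exact: Ck_derive.
by apply: (IH (fun q => 'D_(fb i) f q)); [exact: Ck_pred | exact: Ck_derive].
Qed.

End Ck_theory.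
Arguments Ck_derivable {R V W k A f p} v _ _.


Section Instances.
Context {R : realType}.

Lemma R_fb_sum (v : R) : \sum_(i : unit) id v *: (1 : R) = v.
Proof. by rewrite (bigD1 tt) //= big1 ?addr0 ?[_ *: _]mulr1 // => -[]. Qed.

Lemma R_fcompact (x : R) (O : set R) : nbhs x O ->
  exists K, [/\ compact K, nbhs x K & K `<=` O].
Proof.
move=> /nbhs_ballP[e /= e0 eO]; exists `[x - e / 2, x + e / 2]%classic; split.
- exact: segment_compact.
- apply: filterS (nbhsx_ballx x (e / 2) _); last by rewrite divr_gt0.
  move=> y; rewrite -ball_normE /= ltr_norml in_itv /= => /andP[a b].
  by apply/andP; split; lra.
move=> y /=; rewrite in_itv /= => /andP[a b]; apply: eO.
by rewrite -ball_normE /= ltr_norml; apply/andP; split; lra.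
Qed.

#[global] Instance findim_R : findim R :=
  @Findim R R unit (fun=> 1) (fun=> id) (fun _ p => is_diff_id p) R_fb_sum R_fcompact.

Context {V W : normedModType R} {fV : findim V} {fW : findim W}.

Definition prod_fb (i : fI (V := V) + fI (V := W)) : V * W :=
  match i with inl i => (fb i, 0) | inr i => (0, fb i) end.

Definition prod_fc (i : fI (V := V) + fI (V := W)) (v : V * W) : R :=
  match i with inl i => fc i v.1 | inr i => fc i v.2 end.

Lemma prod_fc_diff i p : is_diff p (prod_fc i) (prod_fc i).
Proof.
case: i => i /=.
  exact: (is_diff_comp (is_diff_fst p) (fc_diff i p.1)).
exact: (is_diff_comp (is_diff_snd p) (fc_diff i p.2)).
Qed.

Lemma prod_fb_sum v : \sum_i prod_fc i v *: prod_fb i = v.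
Proof.
case: v => v w; rewrite [LHS]surjective_pairing; congr pair.
  rewrite raddf_sum big_sumType /= [X in _ + X]big1 ?addr0 ?fb_sum // => i _.
  exact: scaler0.
rewrite raddf_sum big_sumType /= [X in X + _]big1 ?add0r ?fb_sum // => i _.
exact: scaler0.
Qed.

Lemma prod_fcompact (x : V * W) (O : set (V * W)) : nbhs x O ->
  exists K, [/\ compact K, nbhs x K & K `<=` O].
Proof.
move=> [[P Q] /= [nP nQ] PQ].
have [K1 [c1 n1 s1]] := fcompact nP; have [K2 [c2 n2 s2]] := fcompact nQ.
exists (K1 `*` K2); split; first exact: compact_setX.
  by exists (K1, K2).
by move=> [a b] /= [/s1 Pa /s2 Qb]; exact: PQ.
Qed.

#[global] Instance findim_prod : findim (V * W)%type :=
  @Findim R (V * W)%type _ prod_fb prod_fc prod_fc_diff prod_fb_sum prod_fcompact.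

End Instances.

(** * Symmetry of second derivatives *)

Section Schwarz.
Context {R : realType} {V : normedModType R} {fV : findim V}.

Lemma is_derive_translate (W : normedModType R) (f : V -> W) (c p u : V) :
  differentiable f (p + c) -> is_derive p u (fun x => f (x + c)) ('D_u f (p + c)).
Proof.
move=> df; have H : is_derive p u (fun x => x + c) u.
  by apply: (is_derive_eq (is_deriveD (is_derive_id _ _) (is_derive_cst c _ _))); rewrite addr0.
exact: (is_derive_comp H df).
Qed.

(** The mean value theorem is applied twice, to [phi] along [h *: v] and then to ['D_v f] along
    [h *: w]. This turns the second difference into [h ^+ 2] times the mixed derivative at a point
    near [p]. *)
Lemma second_difference (A : set V) (f : V -> R) p v w (e : R) :
  open A -> Ck 2 A f -> A p -> 0 < e ->
  \forall h \near 0^'+, `|f (p + h *: v + h *: w) - f (p + h *: v) - f (p + h *: w) + f p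
     - h ^+ 2 * 'D_w (fun x => 'D_v f x) p| <= e * h ^+ 2.
Proof.
move=> oA cf Ap e0; set g := fun x => 'D_w (fun x => 'D_v f x) x.
have cg : {for p, continuous g}.
  by apply: Ck_cont Ap; exact: (Ck_derive w (Ck_derive v cf)).
have /nbhs_ballP[r /= r0 rP] : \forall x \near p, A x /\ `|g p - g x| < e.
  by apply: filterI; [exact: open_nbhs_nbhs | move/cvgrPdist_lt: cg; exact].
have N0 : 0 < `|v| + `|w| + 1 by rewrite ltr_wpDl // addr_ge0.
near=> h.
have h0 : 0 < h by near: h; exact: nbhs_right_gt.
have hr : h * (`|v| + `|w| + 1) < r.
  by rewrite -ltr_pdivlMr //; near: h; apply: nbhs_right_lt; exact: divr_gt0.
have inb (s t : R) : 0 <= s <= 1 -> 0 <= t <= 1 ->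
    ball p r (p + s *: (h *: v) + t *: (h *: w)).
  move=> /andP[s0 s1] /andP[t0 t1]; rewrite -ball_normE /= distrC -[X in `|X - _|]addrA [X in `|X - _|]addrC addrK.
  apply: le_lt_trans hr; rewrite (le_trans (ler_normD _ _)) // !normrZ.
  rewrite !(ger0_norm s0, ger0_norm t0, gtr0_norm h0) !mulrDr mulr1.
  rewrite -[X in X <= _]addr0 !lerD // ?(ltW h0) // ler_piMl // mulr_ge0 // ltW //.
have dA x : A x -> differentiable f x by move=> Ax; exact: (Ck_differentiable oA cf Ax).
have I0 : 0 <= (0 : R) <= 1 by rewrite lexx /=; exact: ler01.
have I1 : 0 <= (1 : R) <= 1 by rewrite lexx andbT; exact: ler01.
pose phi x := f (x + h *: w) - f x.
have dphi (s : R) u : 0 <= s <= 1 -> is_derive (p + s *: (h *: v)) u phi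
    ('D_u f (p + s *: (h *: v) + h *: w) - 'D_u f (p + s *: (h *: v))).
  move=> sI; apply: is_deriveB; last first.
    apply/derivableP/diff_derivable/dA.
    by have [+ _] := rP _ (inb _ _ sI I0); rewrite scale0r addr0.
  apply/is_derive_translate/dA.
  by have [+ _] := rP _ (inb _ _ sI I1); rewrite scale1r.
have [s sI|c c01 cE] := @MVT_dir R V phi p (h *: v).
  by have [] := dphi s (h *: v) sI.
have cI : 0 <= c <= 1 by case/andP: c01 => *; rewrite !ltW.
have [_ DE] := dphi c v cI.
have cE' : phi (p + h *: v) - phi p = h *
    ('D_v f (p + c *: (h *: v) + h *: w) - 'D_v f (p + c *: (h *: v))).
  by rewrite cE; have [_ ->] := is_derive_dirZ h (dphi c v cI).
set q := p + c *: (h *: v) in cE'.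
have cDv := Ck_derive v cf.
have [t tI|d d01 dE] := @MVT_dir R V (fun x => 'D_v f x) q (h *: w).
  by have [At _] := rP _ (inb _ _ cI tI); have := Ck_derivable (h *: w) cDv At; exact.
have dI : 0 <= d <= 1 by case/andP: d01 => *; rewrite !ltW.
have [Ad gd] := rP _ (inb _ _ cI dI).
have [_ dE'] := is_derive_dirZ h (derivableP (Ck_derivable w cDv Ad)).
rewrite /phi in cE'; rewrite /= in dE.
have -> : f (p + h *: v + h *: w) - f (p + h *: v) - f (p + h *: w) + f p =
    h * (h * g (q + d *: (h *: w))).
  have -> : h * g (q + d *: (h *: w)) = 'D_v f (q + h *: w) - 'D_v f q by rewrite dE dE'.
  by rewrite -cE'; ring.
rewrite -/(g p) in gd *; set g1 := g (q + _) in gd *; move: gd; set g0 := g p => gd.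
have -> : h * (h * g1) - h ^+ 2 * g0 = h ^+ 2 * (g1 - g0) by ring.
rewrite normrM (ger0_norm (sqr_ge0 h)) mulrC.
by apply: ler_wpM2r; [exact: sqr_ge0 | rewrite distrC; exact: ltW].
Unshelve. all: by end_near.
Qed.

(** Exchanging [v] and [w] leaves the second difference unchanged, so both mixed derivatives
    approximate the same quotient with an arbitrarily small error. *)
Lemma schwarz_scalar (A : set V) (f : V -> R) p v w : open A -> Ck 2 A f -> A p ->
  'D_w (fun x => 'D_v f x) p = 'D_v (fun x => 'D_w f x) p.
Proof.
move=> oA cf Ap; apply/eqP; rewrite -subr_eq0 -normr_le0; apply/ler_addgt0Pl => e e0.
rewrite addr0; have e2 : 0 < e / 2 by rewrite divr_gt0.
have [h [h0 [H1 H2]]] : exists h : R, 0 < h /\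
   (`|f (p + h *: v + h *: w) - f (p + h *: v) - f (p + h *: w) + f p
     - h ^+ 2 * 'D_w (fun x => 'D_v f x) p| <= e / 2 * h ^+ 2 /\
    `|f (p + h *: w + h *: v) - f (p + h *: w) - f (p + h *: v) + f p
     - h ^+ 2 * 'D_v (fun x => 'D_w f x) p| <= e / 2 * h ^+ 2).
  have H : \forall h \near (0 : R)^'+, 0 < h by exact: nbhs_right_gt.
  have H1 := second_difference v w oA cf Ap e2.
  have H2 := second_difference w v oA cf Ap e2.
  exact: filter_ex (filterI H (filterI H1 H2)).
have h2 : 0 < h ^+ 2 by rewrite exprn_gt0.
rewrite -(ler_pM2l h2) -[X in X * _ <= _](ger0_norm (ltW h2)) -normrM.
move: H1 H2; rewrite [p + h *: w + _]addrAC.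
set a := f (_ + _ + _); set b := f (_ + _); set c := f (_ + _).
set D1 := 'D_w _ p; set D2 := 'D_v _ p => H1 H2.
have -> : h ^+ 2 * (D1 - D2) = (a - c - b + f p - h ^+ 2 * D2) - (a - b - c + f p - h ^+ 2 * D1).
  by ring.
rewrite (le_trans (ler_normB _ _)) // (le_trans (lerD H2 H1)) // -mulrDl -splitr mulrC.
by [].
Qed.

Lemma schwarz {W : normedModType R} {fW : findim W} (A : set V) (f : V -> W) p v w :
  open A -> Ck 2 A f -> A p ->
  'D_w (fun x => 'D_v f x) p = 'D_v (fun x => 'D_w f x) p.
Proof.
move=> oA cf Ap.
have fcD (i : fI (V := W)) (g : V -> W) x u : derivable g x u ->
    fc i ('D_u g x) = 'D_u (fun y => fc i (g y)) x.
  move=> dg; have [d e] := fc_diff i (g x).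
  have [_ H] := is_derive_comp (derivableP dg) d.
  transitivity ('D_('D_u g x) (fc i) (g x)); [|exact/esym/H].
  by have [_ ->] := @is_derive_linear _ _ _ (g x) ('D_u g x) (fc_diff i _).
have nA : nbhs p A by exact: open_nbhs_nbhs.
have fcD2 (i : fI (V := W)) (u u' : V) :
    fc i ('D_u' (fun x => 'D_u f x) p) = 'D_u' (fun x => 'D_u (fun y => fc i (f y)) x) p.
  rewrite fcD; last exact: (Ck_derivable _ (Ck_derive u cf) Ap).
  apply: near_eq_derive; apply: filterS nA => x Ax.
  by rewrite fcD //; exact: (Ck_derivable _ cf Ax).
have E (i : fI (V := W)) :
    fc i ('D_w (fun x => 'D_v f x) p) = fc i ('D_v (fun x => 'D_w f x) p).
  rewrite !fcD2; apply: (@schwarz_scalar A) => //.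
  by apply: Ck_linear_comp => // q; exact: fc_diff.
by rewrite -[LHS]fb_sum -[RHS]fb_sum; apply: eq_bigr => i _; rewrite E.
Qed.

End Schwarz.


(** * Inverse function theorem and Gronwall's lemma *)

Section InverseFunction.
Context {R : realType}.

Lemma findim_lip {V : normedModType R} {fV : findim V} {W : normedModType R} (L : V -> W) :
  linear L -> exists2 K, 0 < K & forall v, `|L v| <= K * `|v|.
Proof.
move=> linL; have L0 : L 0 = 0 by have := linL (-1) 0 0; rewrite !scaler0 add0r scaleN1r addNr.
have Lsum (s : seq (fI (V := V))) : exists2 K, 0 < K & forall v,
    `|L (\sum_(i <- s) fc i v *: fb i)| <= K * `|v|.
  elim: s => [|i s [K K0 KP]].
    by exists 1 => // v; rewrite big_nil L0 normr0 mul1r.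
  have [k k0 kP] := fc_lip i.
  exists (k * `|L (fb i)| + K) => [|v]; first by rewrite ltr_wpDl // mulr_ge0 // ltW.
  rewrite big_cons linL (le_trans (ler_normD _ _)) // mulrDl lerD //.
  by rewrite normrZ mulrAC ler_wpM2r.
have [K K0 KP] := Lsum (index_enum _).
by exists K => // v; rewrite -{1}(fb_sum v).
Qed.

Lemma ball_segment (V : normedModType R) (c x y : V) (r s : R) :
  ball c r x -> ball c r y -> 0 <= s <= 1 -> ball c r (y + s *: (x - y)).
Proof.
rewrite -!ball_normE /= => xr yr /andP[s0 s1].
have -> : c - (y + s *: (x - y)) = s *: (c - x) + (1 - s) *: (c - y).
  have -> : x - y = (c - y) - (c - x) by rewrite opprB [RHS]addrC addrA subrK.
  by rewrite opprD addrA scalerBr opprB scalerBl scale1r addrCA.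
rewrite (le_lt_trans (ler_normD _ _)) // !normrZ (ger0_norm s0) ger0_norm ?subr_ge0 //.
have [->|sn0] := eqVneq s 0; first by rewrite mul0r add0r subr0 mul1r.
have sp : 0 < s by rewrite lt_neqAle eq_sym sn0.
have -> : r = s * r + (1 - s) * r by ring.
by rewrite ltr_leD ?ltr_pM2l // ler_wpM2l ?subr_ge0 // ltW.
Qed.

(** Two free points near [x0] are compared, which plain differentiability at [x0] does not allow.
    The mean value theorem on the segment between them and the continuity of the partial derivatives
    give the uniform bound. *)
Lemma strict_derivative_scalar {V : normedModType R} {fV : findim V} (O : set V) (f : V -> R) x0 (e : R) :
  open O -> Ck 1 O f -> O x0 -> 0 < e ->
  exists r : R, [/\ 0 < r, ball x0 r `<=` O & forall x y, ball x0 r x -> ball x0 r y ->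
    `|f x - f y - 'D_(x - y) f x0| <= e * `|x - y|].
Proof.
move=> oO cf Ox0 e0.
have [M M0 MP] := @fc_sum_lip _ V _.
have eM : 0 < e / M by exact: divr_gt0.
have /nbhs_ballP[r /= r0 rP] : \forall x \near x0, O x /\
    forall i : fI (V := V), `|'D_(fb i) f x0 - 'D_(fb i) f x| <= e / M.
  apply: filterI; first exact: open_nbhs_nbhs.
  apply: filter_forall => i.
  by move/cvgrPdist_le: (Ck_cont (Ck_derive (fb i) cf) Ox0); exact.
exists r; split => // [x /rP[]//|x y xr yr].
have seg (s : R) : 0 <= s <= 1 -> ball x0 r (y + s *: (x - y)).
  by move=> sI; exact: ball_segment.
have [s sI|c c01 cE] := @MVT_dir R V f y (x - y).
  by have [Os _] := rP _ (seg _ sI); exact: (Ck_derivable _ cf Os).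
rewrite [y + (x - y)]addrC subrK in cE.
have cI : 0 <= c <= 1 by case/andP: c01 => *; rewrite !ltW.
have [Oc Dc] := rP _ (seg _ cI).
have df z : O z -> differentiable f z by move=> Oz; exact: (Ck_differentiable oO cf Oz).
rewrite cE !derive_findim; [|exact: df|exact: df].
rewrite -sumrB (le_trans (ler_norm_sum _ _ _)) //.
apply: (@le_trans _ _ (\sum_(i : fI (V := V)) `|fc i (x - y)| * (e / M))).
  by apply: ler_sum => i _; rewrite -scalerBr normrZ ler_wpM2l // distrC.
rewrite -mulr_suml; apply: (le_trans (ler_wpM2r (ltW eM) (MP _))).
have -> : M * `|x - y| * (e / M) = e * `|x - y| by field; rewrite gt_eqF.
exact: lexx.
Qed.

(** The scalar case is applied to each coordinate; as there are finitely many, the radii have a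
    positive minimum. *)
Lemma strict_derivative {V W : normedModType R} {fV : findim V} {fW : findim W}
    (O : set V) (f : V -> W) x0 (e : R) :
  open O -> Ck 1 O f -> O x0 -> 0 < e ->
  exists r : R, [/\ 0 < r, ball x0 r `<=` O & forall x y, ball x0 r x -> ball x0 r y ->
    `|f x - f y - 'D_(x - y) f x0| <= e * `|x - y|].
Proof.
move=> oO cf Ox0 e0.
pose N : R := \sum_(i : @fI R W fW) `|fb i| + 1.
have N0 : 0 < N by rewrite ltr_wpDl // sumr_ge0.
have eN : 0 < e / N by exact: divr_gt0.
have /nbhs_ballP[r /= r0 rP] : \forall x \near x0, O x by exact: open_nbhs_nbhs.
have H (i : fI (V := W)) : exists r : R, 0 < r /\ forall x y, ball x0 r x -> ball x0 r y ->
   `|fc i (f x - f y - 'D_(x - y) f x0)| <= e / N * `|x - y|.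
  have cfi : Ck 1 O (fun x => fc i (f x)).
    by apply: Ck_linear_comp cf => // q; exact: fc_diff.
  have [ri [ri0 _ riP]] := strict_derivative_scalar oO cfi Ox0 eN.
  exists ri; split=> // x y xr yr; have := riP x y xr yr.
  rewrite !fcB; have [d e'] := fc_diff i (f x0).
  have [_ H] := is_derive_comp (derivableP (Ck_derivable (x - y) cf Ox0)) d.
  have -> : fc i ('D_(x - y) f x0) = 'D_(x - y) (fun z => fc i (f z)) x0.
    transitivity ('D_('D_(x - y) f x0) (fc i) (f x0)); [|exact/esym/H].
    by have [_ ->] := @is_derive_linear _ _ _ (f x0) ('D_(x - y) f x0) (fc_diff i _).
  by [].
have {H}[ri riP] := choice H.
have rm : exists r' : R, [/\ 0 < r', r' <= r & forall i, r' <= ri i].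
  have : forall s : seq (fI (V := W)), exists r' : R, [/\ 0 < r', r' <= r & forall i, i \in s -> r' <= ri i].
    elim=> [|i s [r' [r'0 r'r H]]]; first by exists r.
    exists (Num.min r' (ri i)); split.
    - by rewrite lt_min r'0; have [] := riP i.
    - by rewrite ge_min r'r.
    - move=> j; rewrite inE => /orP[/eqP->|/H jr]; first by rewrite ge_min lexx orbT.
      by rewrite ge_min jr.
  move=> /(_ (enum (fI (V := W))))[r' [a b c]]; exists r'; split=> // i.
  by apply: c; rewrite mem_enum.
have [r' [r'0 r'r r'i]] := rm.
exists r'; split=> // [x xr|x y xr yr].
  by apply: rP; exact: (le_ball r'r).
rewrite -[X in `|X|]fb_sum (le_trans (ler_norm_sum _ _ _)) //.
apply: (@le_trans _ _ (\sum_(i : fI (V := W)) (e / N * `|x - y|) * `|fb i|)).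
  apply: ler_sum => i _; rewrite normrZ ler_wpM2r //.
  by have [_] := riP i; apply; apply: le_ball (r'i i) _ _.
rewrite -mulr_sumr; set S := \sum_i _.
have SN : S <= N by rewrite /N lerDl ler01.
have exy : 0 <= e / N * `|x - y| by rewrite mulr_ge0 // ltW.
apply: (le_trans (ler_wpM2l exy SN)).
by have -> : e / N * `|x - y| * N = e * `|x - y| by field; rewrite gt_eqF.
Qed.

(** The inverse [S x] of the derivative is an argument, smooth in [x]: in both applications the
    derivative is block triangular and [S] is an explicit formula. *)
Theorem inverse_function {V : normedModType R} {fV : findim V} (O : set V) (f : V -> V) x0
    (S : V -> V -> V) :
  open O -> smooth O f -> O x0 -> (forall v, smooth O (fun x => S x v)) ->
  (forall x v, O x -> 'D_(S x v) f x = v) -> (forall x v, O x -> S x ('D_v f x) = v) ->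
  exists A g, [/\ open A, A x0, A `<=` O, open (f @` A) &
     smooth (f @` A) g /\ forall x, A x -> g (f x) = x].
Proof.
move=> oO cf Ox0 cS DS SD.
have df x : O x -> differentiable f x.
  by move=> Ox; exact: (Ck_differentiable oO (cf 1) Ox).
have linS x : O x -> linear (S x).
  move=> Ox a u v; rewrite -[RHS](SD x) //; congr (S x _).
  by rewrite deriveE ?linearP -?deriveE ?DS //; exact: df.
have Slip x : O x -> exists2 K, 0 < K & forall v, `|S x v| <= K * `|v|.
  by move=> Ox; apply: findim_lip; exact: linS.
have SB x u v : O x -> S x (u - v) = S x u - S x v.
  by move=> Ox; rewrite addrC -scaleN1r linS // scaleN1r addrC.
have SA x u v : O x -> S x (u + v) = S x u + S x v.
  by move=> Ox; rewrite -{1}[u]scale1r linS // scale1r.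
have S0 x : O x -> S x 0 = 0 by move=> Ox; rewrite -(subrr (0 : V)) SB // !subrr.
have SZ x a u : O x -> S x (a *: u) = a *: S x u.
  by move=> Ox; rewrite -[a *: u]addr0 linS // S0 // addr0.
have [K K0 KP] := Slip x0 Ox0.
(* With this accuracy [x => x - S x0 (f x)] is a contraction with factor [2^-1] on the ball, which
   is [est] below. *)
have e0 : 0 < 2^-1 / K by rewrite divr_gt0 // invr_gt0.
have [r [r0 rO strict]] := strict_derivative oO (cf 1) Ox0 e0.
pose B := ball x0 r.
have est x y : B x -> B y -> `|x - y - S x0 (f x - f y)| <= 2^-1 * `|x - y|.
  move=> Bx By; rewrite -[X in `|X - _|](SD x0) // -SB // (le_trans (KP _)) //.
  rewrite distrC mulrC -ler_pdivlMr // (le_trans (strict _ _ Bx By)) //.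
  by rewrite mulrAC.
have inv_lip x y : B x -> B y -> `|x - y| <= 2 * `|S x0 (f x - f y)|.
  move=> Bx By; have H := est x y Bx By.
  have := ler_normD (x - y - S x0 (f x - f y)) (S x0 (f x - f y)); rewrite subrK; lra.
have inv_lip2 x y : B x -> B y -> `|x - y| <= 2 * K * `|f x - f y|.
  by move=> Bx By; rewrite (le_trans (inv_lip _ _ Bx By)) // -mulrA ler_pM2l.
have inj x y : B x -> B y -> f x = f y -> x = y.
  move=> Bx By e; apply/eqP; rewrite -subr_eq0 -normr_le0.
  by rewrite (le_trans (inv_lip _ _ Bx By)) // e subrr S0 // normr0 mulr0.
have Sx0_inj v : S x0 v = 0 -> v = 0 by move=> e; rewrite -(DS x0 v) // e derive0.
have oB : open B by exact: ball_open.
(* Openness of the image by minimisation instead of iteration: on a compact neighbourhood of [x] the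
   norm of [S x0 (f z - y)] has a minimum in [z]. For [y] near [f x] the minimiser is interior, and
   a nonzero minimum could be lowered by moving in the direction [- d]. *)
have open_im O' : open O' -> O' `<=` B -> open (f @` O').
  move=> oO' O'B; rewrite openE => _ [x O'x <-].
  have [C [cC nC CO']] := fcompact (open_nbhs_nbhs (conj oO' O'x)).
  have /nbhs_ballP[rho /= rho0 rhoC] := nC.
  have rK : 0 < rho / 4 / K by rewrite !divr_gt0.
  apply/nbhs_ballP; exists (rho / 4 / K) => //= y; rewrite -ball_normE /= => fxy.
  have yE : `|S x0 (f x - y)| < rho / 4.
    by rewrite (le_lt_trans (KP _)) // mulrC -ltr_pdivlMr.
  have cont : {within C, continuous (fun z => `|S x0 (f z - y)|)}.
    apply: continuous_in_subspaceT => z /set_mem Cz.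
    have Oz : O z by apply/rO/O'B/CO'.
    apply/cvgrPdist_lt => eps eps0.
    have epsK : 0 < eps / K by exact: divr_gt0.
    have /cvgrPdist_lt/(_ _ epsK) := differentiable_continuous (df z Oz).
    apply: filterS => w fzw; rewrite (le_lt_trans (ler_dist_dist _ _)) // -SB //.
    by rewrite opprB addrA subrK (le_lt_trans (KP _)) // mulrC -ltr_pdivlMr.
  have C0 : C !=set0 by exists x; exact: nbhs_singleton nC.
  have [z /set_mem Cz zmin] := compact_EVT_min C0 cC cont.
  have Bz : B z by apply/O'B/CO'.
  have zx : `|S x0 (f z - y)| < rho / 4.
    by apply: le_lt_trans yE; apply: zmin; apply/mem_set; exact: nbhs_singleton nC.
  have zball : ball x rho z.
    rewrite -ball_normE /= (le_lt_trans (inv_lip _ _ (O'B _ O'x) Bz)) //.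
    have -> : f x - f z = (f x - y) - (f z - y) by rewrite opprB addrA subrK.
    rewrite SB //; have := ler_normB (S x0 (f x - y)) (S x0 (f z - y)); lra.
  exists z; first exact: CO'.
  apply/eqP; rewrite -subr_eq0; apply/eqP/Sx0_inj/eqP; rewrite -normr_eq0; apply/negPn/negP => N0.
  set d := S x0 (f z - y) in zmin N0 *.
  have d0 : 0 < `|d| by rewrite lt_neqAle eq_sym N0 normr_ge0.
  (* This step length is below 1 and moves [z] by less than [del], so the new point stays in the
     ball. *)
  have [s [s0 s1 sball]] : exists s : R, [/\ 0 < s, s < 1 & ball x rho (z - s *: d)].
    have /nbhs_ballP[del /= del0 delP] : nbhs z (ball x rho).
      by apply: open_nbhs_nbhs; split => //; exact: ball_open.
    have q0 : 0 < 2 * (`|d| + del) by rewrite mulr_gt0 // addr_gt0.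
    exists (del / (2 * (`|d| + del))); split; first exact: divr_gt0.
      by rewrite ltr_pdivrMr // mul1r; lra.
    apply: delP; rewrite -ball_normE /= opprB addrC subrK normrZ gtr0_norm ?divr_gt0 //.
    by rewrite mulrAC ltr_pdivrMr // ltr_pM2l //; lra.
  have Cs : C (z - s *: d) by exact: rhoC.
  have Bs : B (z - s *: d) by apply/O'B/CO'.
  have /zmin : z - s *: d \in C by exact/mem_set.
  apply/negP; rewrite -ltNge.
  have zE : z - s *: d - z = - (s *: d) by rewrite addrAC subrr add0r.
  have := est _ _ Bs Bz; rewrite zE => H.
  have -> : S x0 (f (z - s *: d) - y) =
     (1 - s) *: d - (- (s *: d) - S x0 (f (z - s *: d) - f z)).
    rewrite opprB opprK scalerBl scale1r [S x0 _ + s *: d]addrC addrA subrK addrC -SA //.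
    by rewrite addrA subrK.
  rewrite (le_lt_trans (ler_normB _ _)) // (le_lt_trans (lerD (lexx _) H)) //.
  rewrite normrN !normrZ (gtr0_norm s0) gtr0_norm ?subr_gt0 //.
  have -> : (1 - s) * `|d| + 2^-1 * (s * `|d|) = `|d| - 2^-1 * (s * `|d|) by field.
  by rewrite ltrBlDr ltrDl mulr_gt0 ?invr_gt0 // mulr_gt0.
(* Outside the image the default [x0] is taken; no claim concerns those values. *)
pose g y := xget x0 [set x | B x /\ f x = y].
have gK x : B x -> g (f x) = x.
  move=> Bx; rewrite /g; case: xgetP => [z _ [Bz /inj->]//|/(_ x)[]//].
have oim : open (f @` B) by exact: open_im.
exists B, g; split => //; first exact: ballxx.
split => //.
have gi y : (f @` B) y -> B (g y) /\ f (g y) = y.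
  by move=> [x Bx <-]; rewrite gK.
have gO y : (f @` B) y -> O (g y) by move=> /gi[/rO].
have g_lip y y' : (f @` B) y -> (f @` B) y' -> `|g y - g y'| <= 2 * K * `|y - y'|.
  move=> /gi[By ey] /gi[By' ey']; rewrite -{2}ey -{2}ey'; exact: inv_lip2.
have K2 : 0 < 2 * K by rewrite mulr_gt0.
have gc y : (f @` B) y -> {for y, continuous g}.
  move=> By; apply/cvgrPdist_lt => eps eps0.
  have epsK : 0 < eps / (2 * K) by exact: divr_gt0.
  have n1 : \forall y' \near y, (f @` B) y' by exact: open_nbhs_nbhs.
  apply: filterS2 n1 (nbhsx_ballx y _ epsK) => y' By'; rewrite -ball_normE /= => yy'.
  by rewrite (le_lt_trans (g_lip _ _ By By')) // mulrC -ltr_pdivlMr.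
have gd v y : (f @` B) y -> is_derive y v g (S (g y) v).
  move=> By; have [Bx ey] := gi y By; set x := g y in Bx ey *.
  have Ox : O x by exact: rO.
  have [Kx Kx0 KxP] := Slip x Ox.
  have H : (fun h : R => h^-1 *: ((g \o shift y) (h *: v) - g y)) @ 0^' --> S x v.
    apply/cvgrPdist_le => eps eps0.
    (* [N] collects the bound of [S x], the Lipschitz constant [2 * K] of [g] and the length of [v],
       raised by 1 to stay positive when [v = 0]. *)
    pose N := Kx * (2 * K) * (`|v| + 1).
    have N0 : 0 < N by rewrite !mulr_gt0 // ltr_wpDl.
    have eN : 0 < eps / N by exact: divr_gt0.
    have [rx [rx0 rxO stx]] := strict_derivative oO (cf 1) Ox eN.
    have near1 : \forall h \near 0^', (f @` B) (h *: v + y).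
      by apply: cvg_within; apply: near_line; exact: open_nbhs_nbhs.
    have near2 : \forall h \near 0^', ball x rx (g (h *: v + y)).
      apply: cvg_within.
      exact: (@near_line _ _ y v [set z | ball x rx (g z)] (gc _ By _ (nbhsx_ballx _ _ rx0))).
    near=> h.
    have h0 : h != 0 by near: h; exact: nbhs_dnbhs_neq.
    have Bh : (f @` B) (h *: v + y) by near: h; exact: near1.
    have bh : ball x rx (g (h *: v + y)) by near: h; exact: near2.
    have [Bxh eh] := gi _ Bh; set xh := g (h *: v + y) in bh Bxh eh *.
    have E1 := stx _ _ bh (ballxx x rx0).
    have E2 : `|h *: S x v - (xh - x)| <= eps * `|h|.
      rewrite -SZ // -[xh - x](SD x) // -SB //.
      rewrite (_ : h *: v = f xh - f x); last by rewrite eh ey addrK.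
      rewrite (le_trans (KxP _)) //.
      apply: (@le_trans _ _ (Kx * (eps / N * (2 * K * (`|h| * (`|v| + 1)))))).
        rewrite ler_pM2l // (le_trans E1) // ler_pM2l // (le_trans (g_lip _ _ Bh By)) //.
        by rewrite addrK ler_pM2l // normrZ ler_wpM2l // lerDl.
      rewrite /N; have -> // : Kx * (eps / (Kx * (2 * K) * (`|v| + 1)) *
         (2 * K * (`|h| * (`|v| + 1)))) = eps * `|h|.
      by field; rewrite !gt_eqF // ltr_wpDl.
    rewrite /= -/xh -[S x v](scalerK h0) -scalerBr normrZ normfV mulrC ler_pdivrMr //.
    by rewrite normr_gt0.
  exact: is_derive_cvg H.
(* The derivative of [g] is [S (g y) v], an expression in [g] itself, so smoothness bootstraps from
   continuity. *)
elim=> [|k IH]; first by split.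
apply: (@Ck_is_derive _ _ _ _ _ _ (fun v y => S (g y) v)) => //.
by move=> v; apply: (Ck_comp (B := O) (h := g) (f := fun x => S x v)) => //; exact: cS.
Unshelve. all: by end_near.
Qed.

End InverseFunction.


Section Gronwall.
Context {R : realType}.

(** The product [N r * expR (- C * r)] has a nonpositive derivative, so it cannot rise above its
    initial value 0. *)
Lemma gronwall (N dN : R -> R) (C : R) :
  (forall r : R, 0 <= r <= 1 -> is_derive r (1 : R) N (dN r) /\ `|dN r| <= C * N r) ->
  (forall r, 0 <= N r) -> N 0 = 0 -> N 1 = 0.
Proof.
move=> H N0 N00; apply/eqP; rewrite eq_le N0 andbT.
pose g (r : R) := N r * expR (- C * r).
have dg (r : R) : 0 <= r <= 1 -> is_derive r (1 : R) g ((dN r - C * N r) * expR (- C * r)).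
  move=> /H[dNr _].
  have dl : is_derive r (1 : R) (fun r : R => - C * r) (- C).
    apply: (is_derive_eq (is_deriveM (is_derive_cst (- C) _ _) (is_derive_id _ _))).
    by rewrite scaler0 addr0 [LHS]mulr1.
  have de := is_derive1_comp (is_derive_expR (- C * r)) dl.
  apply: (is_derive_eq (is_deriveM dNr de)).
  by rewrite /GRing.scale /=; ring.
have [||c cI] := @MVT R g (fun r => (dN r - C * N r) * expR (- C * r)) 0 1 ltr01.
- by move=> x /[1!in_itv] /= /andP[a b]; apply: dg; rewrite !ltW.
- apply: derivable_within_continuous => x /[1!in_itv] /= h.
  by case: (dg _ h).
rewrite /g N00 mul0r !subr0 !mulr1 => e.
have /H[_ Hc] : 0 <= c <= 1 by move: cI; rewrite in_itv /= => /andP[a b]; rewrite !ltW.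
have : N 1 * expR (- C) <= 0.
  rewrite e; apply: mulr_le0_ge0; last exact: expR_ge0.
  by rewrite subr_le0 (le_trans _ Hc) // ler_norm.
by rewrite pmulr_lle0 // expR_gt0.
Qed.

Lemma sqr_sum_le (J : finType) (a : J -> R) :
  (\sum_j a j) ^+ 2 <= #|J|%:R * \sum_j a j ^+ 2.
Proof.
rewrite expr2 mulr_suml.
apply: (@le_trans _ _ (\sum_(i : J) \sum_(j : J) (a i ^+ 2 + a j ^+ 2) / 2)).
  apply: ler_sum => i _; rewrite mulr_sumr; apply: ler_sum => j _.
  have := sqr_ge0 (a i - a j); nra.
set S := \sum_j a j ^+ 2.
have E : \sum_(i : J) \sum_(j : J) (a i ^+ 2 + a j ^+ 2) / 2 =
    \sum_(i : J) (#|J|%:R * a i ^+ 2 + S) / 2.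
  apply: eq_bigr => i _; rewrite -mulr_suml big_split /= sumr_const mulr_natl.
  by [].
rewrite E -mulr_suml big_split /= -mulr_sumr sumr_const -mulr_natl -/S.
by rewrite le_eqVlt; apply/orP; left; apply/eqP; field.
Qed.

(** A norm need not be differentiable, so [gronwall] is applied to the sum of the squares of the
    coordinates, which is comparable with the square of the norm; this costs only a larger
    constant. *)
Lemma gronwall_segment (V W : normedModType R) {fW : findim W} (Y : V -> W)
    (y w : V) (C : R) : 0 <= C ->
  (forall r : R, 0 <= r <= 1 -> exists2 d, is_derive (y + r *: w) w Y d &
     `|d| <= C * `|Y (y + r *: w)|) ->
  Y y = 0 -> Y (y + w) = 0.
Proof.
move=> C0 H Yy.
have {H}/choice[d dP] : forall r : R, exists d, 0 <= r <= 1 -> is_derive (y + r *: w) w Y d /\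
     `|d| <= C * `|Y (y + r *: w)|.
  move=> r; have [/H[d d1 d2]|] := boolP (0 <= r <= 1); first by exists d.
  by exists 0.
pose Z (r : R) := Y (y + r *: w).
have dZ (r : R) : 0 <= r <= 1 -> is_derive r (1 : R) Z (d r).
  move=> /dP[H _].
  exact: is_derive_segment H.
pose z (i : @fI R W fW) (r : R) := fc i (Z r).
have dz i (r : R) : 0 <= r <= 1 -> is_derive r (1 : R) (z i) (fc i (d r)).
  move=> rI; have [df _] := fc_diff i (Z r).
  apply: (is_derive_eq (is_derive_comp (dZ r rI) df)).
  by have [_ ->] := @is_derive_linear _ _ _ (Z r) (d r) (fc_diff i _).
have [k k0 sP] := @fc_sum_lip _ W _.
have kP (i : @fI R W fW) v : `|fc i v| <= k * `|v|.
  by rewrite (le_trans _ (sP v)) // (bigD1 i) //= lerDl sumr_ge0.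
pose b : R := \sum_(i : @fI R W fW) `|fb i|.
have b0 : 0 <= b by exact: sumr_ge0.
have bP v : `|v| <= b * \sum_(i : @fI R W fW) `|fc i v|.
  rewrite -{1}(fb_sum v) (le_trans (ler_norm_sum _ _ _)) // mulr_sumr.
  apply: ler_sum => i _; rewrite normrZ mulrC ler_wpM2r //.
  by rewrite /b (bigD1 i) //= lerDl sumr_ge0.
pose N (r : R) := \sum_(i : @fI R W fW) z i r ^+ 2.
have N0 r : 0 <= N r by apply: sumr_ge0 => i _; exact: sqr_ge0.
have dN (r : R) : 0 <= r <= 1 ->
    is_derive r (1 : R) N (\sum_(i : @fI R W fW) 2 * (z i r * fc i (d r))).
  move=> rI; rewrite /N.
  have aux (s : seq (@fI R W fW)) : is_derive r (1 : R) (fun r => \sum_(i <- s) z i r ^+ 2)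
     (\sum_(i <- s) 2 * (z i r * fc i (d r))).
    elim: s => [|i s IH].
      by rewrite big_nil; under eq_fun do rewrite big_nil; exact: is_derive_cst.
    rewrite big_cons; under eq_fun do rewrite big_cons.
    apply: is_deriveD => //.
    have H := is_deriveM (dz i r rI) (dz i r rI).
    rewrite (_ : (fun x => z i x ^+ 2) = z i * z i); last first.
      by apply/funext => x; rewrite expr2.
    by apply: (is_derive_eq H); rewrite /GRing.scale /=; ring.
  exact: aux.
have bd (r : R) : 0 <= r <= 1 -> `|\sum_(i : @fI R W fW) 2 * (z i r * fc i (d r))| <=
    2 * k * C * b * #|@fI R W fW|%:R * N r.
  move=> rI; have [_ dr] := dP r rI.
  rewrite (le_trans (ler_norm_sum _ _ _)) //.
  pose S := \sum_(i : @fI R W fW) `|z i r|.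
  apply: (@le_trans _ _ (\sum_(i : @fI R W fW) (2 * (k * (C * (b * S)))) * `|z i r|)).
    apply: ler_sum => i _; rewrite !normrM (ger0_norm (_ : 0 <= 2)) // -[leRHS]mulrA.
    rewrite ler_pM2l // mulrC ler_wpM2r // (le_trans (kP _ _)) // ler_pM2l //.
    by rewrite (le_trans dr) // ler_wpM2l //; exact: bP.
  rewrite -mulr_sumr -/S.
  have -> : 2 * (k * (C * (b * S))) * S = 2 * k * C * b * (S ^+ 2) by ring.
  rewrite -[leRHS]mulrA ler_wpM2l //; first by rewrite !mulr_ge0 // ltW.
  rewrite (le_trans (sqr_sum_le _)) // ler_wpM2l ?ler0n //.
  by apply: ler_sum => i _; rewrite real_normK // num_real.
have z0 i : z i 0 = 0 by rewrite /z /Z scale0r addr0 Yy fc0.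
have N1 : N 1 = 0.
  apply: (gronwall (fun r rI => conj (dN r rI) (bd r rI)) N0).
  by rewrite /N big1 // => i _; rewrite z0 expr0n.
have z1 i : z i 1 = 0.
  apply/eqP; rewrite -sqrf_eq0; have /eqP := N1.
  rewrite psumr_eq0; last by move=> j _; exact: sqr_ge0.
  by move=> /allP/(_ i (mem_index_enum _)).
rewrite -[LHS]fb_sum big1 // => i _; have := z1 i.
by rewrite /z /Z scale1r => ->; rewrite scale0r.
Qed.

End Gronwall.

Section DirectionalLinear.
Context {R : realType} {V W : normedModType R}.

Lemma derive_dirD (f : V -> W) p u v : differentiable f p ->
  'D_(u + v) f p = 'D_u f p + 'D_v f p.
Proof. by move=> df; rewrite !deriveE // linearD. Qed.

Lemma derive_dirB (f : V -> W) p u v : differentiable f p ->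
  'D_(u - v) f p = 'D_u f p - 'D_v f p.
Proof. by move=> df; rewrite !deriveE // linearB. Qed.

Lemma derive_dirZ (f : V -> W) p (a : R) v : differentiable f p ->
  'D_(a *: v) f p = a *: 'D_v f p.
Proof. by move=> df; rewrite !deriveE // linearZ. Qed.

Lemma is_derive_comp1 (g : V -> R) (c : R -> W) p v dg dc : is_derive p v g dg ->
  is_derive (g p) (1 : R) c dc -> is_derive p v (fun z => c (g z)) (dg *: dc).
Proof.
move=> Dg [dc1 <-]; have df : differentiable c (g p) by exact/derivable1_diffP.
apply: (is_derive_eq (is_derive_comp Dg df)).
by rewrite -[X in 'D_X _ _]mulr1 !deriveE // -linearZ.
Qed.

Lemma differentiable_is_derive (f : V -> W) p v : differentiable f p ->
  is_derive p v f ('D_v f p).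
Proof. by move=> df; apply: derivableP; exact: diff_derivable. Qed.

(** Used to read the time derivative of a flow as a directional derivative of a map that follows the
    flow along a line; [s] is the flow time at [y]. *)
Lemma is_derive_line (F : V -> W) (k : R -> W) y v (s : R) d :
  (\forall h \near 0, F (h *: v + y) = k (h + s)) ->
  is_derive s (1 : R) k d -> is_derive y v F d.
Proof.
move=> Fk [dk <-].
have e0 : F y = k s by have := nbhs_singleton Fk; rewrite scale0r !add0r.
have H : (fun h : R => h^-1 *: ((F \o shift y) (h *: v) - F y)) @ 0^' --> 'D_1 k s.
  apply: cvg_trans dk; apply: near_eq_cvg; apply: cvg_within.
  by apply: filterS Fk => h /= ->; rewrite e0 [_%:A]mulr1.
exact: is_derive_cvg H.
Qed.

End DirectionalLinear.


(** * Straightening a realization *)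

Section VectorAlgebra.
Context {R : realType}.
Local Notation P := (R * R * R)%type.

Lemma triple_eq (v w : P) : v.1.1 = w.1.1 -> v.1.2 = w.1.2 -> v.2 = w.2 -> v = w.
Proof. by case: v w => [[? ?] ?] [[? ?] ?] /= -> -> ->. Qed.

Definition det2 (v w : P) : R := v.1.2 * w.2 - v.2 * w.1.2.

Lemma det2_parallel (v w : P) : v.1.1 = 0 -> w.1.1 = 0 -> v != 0 -> det2 v w = 0 ->
  exists m : R, w = m *: v.
Proof.
case: v w => [[t x] u] [[t' x'] u'] /= -> -> v0; rewrite /det2 /= => d.
have [x0|x0] := eqVneq x 0.
  have u0 : u != 0 by apply: contraNneq v0 => ->; rewrite x0; exact/eqP.
  exists (u' / u); apply: triple_eq; rewrite /= /GRing.scale /=; first by rewrite mulr0.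
    rewrite x0 mulr0; apply/eqP; move: d; rewrite x0 mul0r sub0r => /eqP.
    by rewrite oppr_eq0 mulf_eq0 (negbTE u0).
  by rewrite divfK.
exists (x' / x); apply: triple_eq; rewrite /= /GRing.scale /=; first by rewrite mulr0.
  by rewrite divfK.
apply: (mulfI x0); have -> : x * u' = u * x' by apply/eqP; rewrite -subr_eq0 d.
by field.
Qed.

Lemma det2_basis (v w z : P) : v.1.1 = 0 -> w.1.1 = 0 -> z.1.1 = 0 -> det2 v w != 0 ->
  z = (det2 z w / det2 v w) *: v + (det2 v z / det2 v w) *: w.
Proof.
case: v w z => [[t x] u] [[t' x'] u'] [[t2 x2] u2] /= -> -> ->; rewrite /det2 /= => d.
by apply: triple_eq; rewrite /= /GRing.scale /=; field.
Qed.

Lemma is_derive_det2 (V : normedModType R) (f g : V -> P) p v df dg :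
  is_derive p v f df -> is_derive p v g dg ->
  is_derive p v (fun z => det2 (f z) (g z)) (det2 df (g p) + det2 (f p) dg).
Proof.
move=> D1 D2.
have H1 := is_deriveM (is_derive_snd (is_derive_fst D1)) (is_derive_snd D2).
have H2 := is_deriveM (is_derive_snd D1) (is_derive_snd (is_derive_fst D2)).
apply: (is_derive_eq (is_deriveB H1 H2)).
by rewrite /det2 /GRing.scale /=; ring.
Qed.

Lemma is_derive_near_dir (V W : normedModType R) (f : V -> W) p v v' d :
  (\forall h \near 0, f (h *: v + p) = f (h *: v' + p)) ->
  is_derive p v' f d -> is_derive p v f d.
Proof.
move=> E [df' <-].
have H : (fun h : R => h^-1 *: ((f \o shift p) (h *: v) - f p)) @ 0^' --> 'D_v' f p.
  apply: cvg_trans df'; apply: near_eq_cvg; apply: cvg_within.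
  by apply: filterS E => h /= ->.
exact: is_derive_cvg H.
Qed.

(** The time component depends on t alone, so it sees only the time part of the direction. Hence the
    time components of a bracket relation involve nothing but the coefficients of d/dt and their
    t-derivatives. *)
Lemma projectable_derive (D : set P) (Q : vfield) p (v : P) : open D ->
  projectable D Q -> D p ->
  ('D_v Q p).1.1 = v.1.1 * ('D_((1, 0, 0) : P) Q p).1.1.
Proof.
move=> oD [sQ [a aP]] Dp.
have dQ w : is_derive p w (fun z => (Q z).1.1) ('D_w Q p).1.1.
  do 2 apply: is_derive_fst; apply: derivableP; exact: (Ck_derivable _ (sQ 1) Dp).
have H : is_derive p (v.1.1 *: ((1, 0, 0) : P)) (fun z => (Q z).1.1)
    (v.1.1 *: ('D_((1, 0, 0) : P) Q p).1.1) by exact: is_derive_dirZ.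
have [_ E] := dQ v; apply: (etrans (esym E)) => {E}.
suff H2 : is_derive p v (fun z => (Q z).1.1) (v.1.1 *: ('D_((1, 0, 0) : P) Q p).1.1).
  by have [_ ->] := H2.
apply: is_derive_near_dir H.
have nD := nbhs_open oD Dp.
apply: filterS2 (near_line v nD) (near_line (v.1.1 *: ((1, 0, 0) : P)) nD) => h.
case: p {Dp dQ nD} => [[pt px] pu]; case: v => [[vt vx] vu] /=.
move=> /aP -> /aP ->; congr a.
by rewrite -[RHS]/(h * (vt * 1) + pt) mulr1.
Qed.

End VectorAlgebra.

(** Here [a1], ..., [a4] are the time components at a point and [b1], ..., [b4] their t-derivatives.
    Proportionality gives [a1 ^+ 2 = 0]; then the rotation of e2 and e3 by e4 gives
    [a2 ^+ 2 + a3 ^+ 2 = 0], which over the reals leaves only zero. *)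
Lemma A49_wronskian {R : realType} (q a1 a2 a3 a4 b1 b2 b3 b4 : R) :
  a1 * b2 = a2 * b1 -> a1 * b3 = a3 * b1 -> a2 * b3 = a3 * b2 + a1 ->
  a2 * b4 = a4 * b2 + (q * a2 - a3) -> a3 * b4 = a4 * b3 + (a2 + q * a3) ->
  [/\ a1 = 0, a2 = 0 & a3 = 0].
Proof.
move=> t12 t13 t23 t24 t34.
have a1E : a1 = a2 * b3 - a3 * b2 by rewrite t23; ring.
have a10 : a1 = 0.
  apply/eqP; rewrite -sqrf_eq0 expr2 {2}a1E.
  have -> : a1 * (a2 * b3 - a3 * b2) = a2 * (a1 * b3) - a3 * (a1 * b2) by ring.
  by rewrite t12 t13; apply/eqP; ring.
have e23 : a2 * b3 = a3 * b2 by rewrite t23 a10 addr0.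
have s : a2 ^+ 2 + a3 ^+ 2 = 0.
  have h1 : a2 + q * a3 = a3 * b4 - a4 * b3 by rewrite t34; ring.
  have h2 : q * a2 - a3 = a2 * b4 - a4 * b2 by rewrite t24; ring.
  have -> : a2 ^+ 2 + a3 ^+ 2 = a2 * (a2 + q * a3) - a3 * (q * a2 - a3) by ring.
  rewrite h1 h2; have -> : a2 * (a3 * b4 - a4 * b3) - a3 * (a2 * b4 - a4 * b2) =
    - a4 * (a2 * b3 - a3 * b2) by ring.
  by rewrite e23 subrr mulr0.
have /eqP := s; rewrite paddr_eq0 ?sqr_ge0 // !sqrf_eq0 => /andP[/eqP a20 /eqP a30].
by [].
Qed.

Section Realization.
Context {R : realType} (q : R).
Local Notation P := (R * R * R)%type.
Context (D : set P) (e1 e2 e3 e4 : @vfield R).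
Context (oD : open D) (pr1 : projectable D e1) (pr2 : projectable D e2)
  (pr3 : projectable D e3) (pr4 : projectable D e4).
Context (rel12 : forall p, D p -> 'D_(e1 p) e2 p = 'D_(e2 p) e1 p).
Context (rel13 : forall p, D p -> 'D_(e1 p) e3 p = 'D_(e3 p) e1 p).
Context (rel23 : forall p, D p -> 'D_(e2 p) e3 p = 'D_(e3 p) e2 p + e1 p).
Context (rel14 : forall p, D p -> 'D_(e1 p) e4 p = 'D_(e4 p) e1 p + (2 * q) *: e1 p).
Context (rel24 : forall p, D p -> 'D_(e2 p) e4 p = 'D_(e4 p) e2 p + (q *: e2 p - e3 p)).
Context (rel34 : forall p, D p -> 'D_(e3 p) e4 p = 'D_(e4 p) e3 p + (e2 p + q *: e3 p)).

Lemma realization_vertical p : D p ->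
  [/\ (e1 p).1.1 = 0, (e2 p).1.1 = 0 & (e3 p).1.1 = 0].
Proof.
move=> Dp.
have key (Q S : vfield) (v w z : P) : projectable D Q -> projectable D S ->
    'D_v Q p = 'D_w S p + z ->
    v.1.1 * ('D_((1, 0, 0) : P) Q p).1.1 = w.1.1 * ('D_((1, 0, 0) : P) S p).1.1 + z.1.1.
  move=> pQ pS h; apply: (etrans (esym (projectable_derive v oD pQ Dp))).
  apply: (etrans (congr1 (fun r : P => r.1.1) h)).
  exact: (congr1 (fun r => r + z.1.1) (projectable_derive w oD pS Dp)).
have t12 := key _ _ _ _ 0 pr2 pr1 (etrans (rel12 Dp) (esym (addr0 _))).
have t13 := key _ _ _ _ 0 pr3 pr1 (etrans (rel13 Dp) (esym (addr0 _))).
have t23 := key _ _ _ _ _ pr3 pr2 (rel23 Dp).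
have t14 := key _ _ _ _ _ pr4 pr1 (rel14 Dp).
have t24 := key _ _ _ _ _ pr4 pr2 (rel24 Dp).
have t34 := key _ _ _ _ _ pr4 pr3 (rel34 Dp).
have {}t12 := etrans t12 (addr0 _).
have {}t13 := etrans t13 (addr0 _).
exact: (A49_wronskian t12 t13 t23 t24 t34).
Qed.

Lemma realization_differentiable p : D p -> [/\ differentiable e1 p, differentiable e2 p,
  differentiable e3 p & differentiable e4 p].
Proof.
move=> Dp; split.
- exact: (Ck_differentiable oD (pr1.1 1) Dp).
- exact: (Ck_differentiable oD (pr2.1 1) Dp).
- exact: (Ck_differentiable oD (pr3.1 1) Dp).
- exact: (Ck_differentiable oD (pr4.1 1) Dp).
Qed.

(** If e1 and e2 were parallel throughout, differentiating their vanishing determinant along e4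
    would make e3 parallel to e1 as well at [p], and then [e2, e3] = e1 would force [e1 p = 0]. *)
Lemma realization_rank2 : (exists2 p, D p & e1 p != 0) ->
  exists2 p, D p & det2 (e1 p) (e2 p) != 0.
Proof.
move=> [p Dp e1p]; apply: contrapT => H.
have det0 z : D z -> det2 (e1 z) (e2 z) = 0.
  by move=> Dz; apply: contrapT => /eqP h; apply: H; exists z.
have [v1 v2 v3] := realization_vertical Dp.
have [d1 d2 d3 d4] := realization_differentiable Dp.
have [m e2E] := det2_parallel v1 v2 e1p (det0 p Dp).
have dd (v : P) : is_derive p v (fun z => det2 (e1 z) (e2 z))
   (det2 ('D_v e1 p) (e2 p) + det2 (e1 p) ('D_v e2 p)).
  exact: is_derive_det2 (differentiable_is_derive v d1) (differentiable_is_derive v d2).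
have de4 : det2 ('D_(e4 p) e1 p) (e2 p) + det2 (e1 p) ('D_(e4 p) e2 p) = 0.
  have [_ E] := dd (e4 p); apply: (etrans (esym E)).
  apply: (etrans _ (derive_cst (0 : R) p (e4 p))).
  apply: near_eq_derive; apply: filterS (nbhs_open oD Dp) => z Dz.
  exact: det0.
have det13 : det2 (e1 p) (e3 p) = 0.
  have r14 := rel14 Dp; have r24 := rel24 Dp.
  rewrite e2E derive_dirZ // r14 -e2E in r24.
  have E1 : 'D_(e4 p) e2 p = m *: ('D_(e4 p) e1 p + (2 * q) *: e1 p) - (q *: e2 p - e3 p).
    by rewrite r24 addrK.
  move: de4; rewrite E1 e2E /det2 /= /GRing.scale /= => h.
  by rewrite -[RHS]h; ring.
have [n e3E] := det2_parallel v1 v3 e1p det13.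
have := rel23 Dp; rewrite {1}e2E {1}e3E !derive_dirZ // rel12 // rel13 //.
rewrite e2E e3E !derive_dirZ // !scalerA [n * m]mulrC -[LHS]addr0 => /addrI h.
by move: e1p; rewrite -h eqxx.
Qed.

(** If e4 were vertical at [p], then e3 and e4 would be combinations of e1 and e2 there, and the
    e2-component of [e3, e4] would read [1 + ga ^+ 2 = 0]. The coefficients are constants taken at
    [p]: linearity of the derivative in its direction lets the other relations express [e3, e4]
    without differentiating them. *)
Lemma realization_transversal p : D p -> det2 (e1 p) (e2 p) != 0 -> (e4 p).1.1 != 0.
Proof.
move=> Dp dn0; apply/eqP => v4.
have [v1 v2 v3] := realization_vertical Dp.
have [d1 d2 d3 d4] := realization_differentiable Dp.
have [al [ga e3E]] : exists al ga : R, e3 p = al *: e1 p + ga *: e2 p.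
  by do 2 eexists; exact: det2_basis v1 v2 v3 dn0.
have [la [rh e4E]] : exists la rh : R, e4 p = la *: e1 p + rh *: e2 p.
  by do 2 eexists; exact: det2_basis v1 v2 v4 dn0.
have lin (f : P -> P) : differentiable f p -> forall (a b : R),
    'D_(a *: e1 p + b *: e2 p) f p = a *: 'D_(e1 p) f p + b *: 'D_(e2 p) f p.
  by move=> df a b; rewrite derive_dirD // !derive_dirZ.
have A3 (f : P -> P) : differentiable f p ->
    'D_(e3 p) f p = al *: 'D_(e1 p) f p + ga *: 'D_(e2 p) f p by move=> df; rewrite e3E; exact: lin.
have A4 (f : P -> P) : differentiable f p ->
    'D_(e4 p) f p = la *: 'D_(e1 p) f p + rh *: 'D_(e2 p) f p by move=> df; rewrite e4E; exact: lin.
have E : e2 p + q *: e3 p =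
   al *: ((2 * q) *: e1 p) + ga *: (q *: e2 p - e3 p) - rh *: e1 p.
  have := rel34 Dp; rewrite (A3 e4 d4) (A4 e3 d3).
  rewrite (rel14 Dp) (rel24 Dp) (rel13 Dp) (rel23 Dp) (A3 e1 d1) (A3 e2 d2) (A4 e1 d1) (A4 e2 d2).
  rewrite (rel12 Dp).
  (* The derivatives of e1 and e2 along each other occur equally on both sides, so they are
     generalised and cancel. *)
  move: ('D_(e1 p) e1 p) ('D_(e2 p) e1 p) ('D_(e2 p) e2 p) => X Y Z.
  move: (_ + _ *: e3 p) (_ - e3 p) (e1 p) => W U V h.
  apply: (addrI (la *: (al *: X + ga *: Y) + rh *: (al *: Y + ga *: Z + V))).
  by rewrite -h; apply: triple_eq; rewrite /= /GRing.scale /=; ring.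
have gaE : det2 (e1 p) (e3 p) = ga * det2 (e1 p) (e2 p).
  by rewrite e3E /det2 /= /GRing.scale /=; ring.
have := congr1 (det2 (e1 p)) E.
have -> : det2 (e1 p) (e2 p + q *: e3 p) = (1 + q * ga) * det2 (e1 p) (e2 p).
  rewrite mulrDl mul1r -mulrA -gaE /det2 /= /GRing.scale /=; ring.
have -> : det2 (e1 p) (al *: ((2 * q) *: e1 p) + ga *: (q *: e2 p - e3 p) - rh *: e1 p) =
   (ga * q - ga ^+ 2) * det2 (e1 p) (e2 p).
  rewrite mulrBl expr2 -[ga * ga * _]mulrA -gaE /det2 /= /GRing.scale /=; ring.
move=> /(mulIf dn0) h.
have : 1 + ga ^+ 2 = 0.
  by transitivity ((1 + q * ga) - (ga * q - ga ^+ 2)); [ring | rewrite h subrr].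
by apply/eqP; rewrite gt_eqF // ltr_wpDr // sqr_ge0.
Qed.

End Realization.


(** * Smooth maps and the function [mfun] *)

Section SmoothTools.
Context {R : realType}.
Implicit Types V W X : normedModType R.

Lemma smooth_cst V W (A : set V) (w : W) : smooth A (fun=> w).
Proof. by move=> k; exact: Ck_cst. Qed.

Lemma smooth_id V (A : set V) : smooth A (fun x : V => x).
Proof. by move=> k; exact: Ck_id. Qed.

Lemma smooth_sub V W (A B : set V) (f : V -> W) : B `<=` A -> smooth A f -> smooth B f.
Proof. by move=> BA cf k; exact: Ck_sub (cf k). Qed.

Lemma smooth_derive V W (A : set V) (f : V -> W) v : smooth A f -> smooth A (fun p => 'D_v f p).
Proof. by move=> cf k; exact: Ck_derive. Qed.

Lemma smooth_add V W (A : set V) (f g : V -> W) : open A ->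
  smooth A f -> smooth A g -> smooth A (fun p => f p + g p).
Proof. by move=> oA cf cg k; exact: Ck_add. Qed.

Lemma smooth_scale V W (A : set V) (a : V -> R) (f : V -> W) : open A ->
  smooth A a -> smooth A f -> smooth A (fun p => a p *: f p).
Proof. by move=> oA cf cg k; exact: Ck_scale. Qed.

Lemma smooth_mul V (A : set V) (f g : V -> R) : open A ->
  smooth A f -> smooth A g -> smooth A (fun p => f p * g p).
Proof. by move=> oA cf cg k; exact: Ck_scale. Qed.

Lemma smooth_opp V W (A : set V) (f : V -> W) : open A ->
  smooth A f -> smooth A (fun p => - f p).
Proof.
move=> oA cf; rewrite (_ : (fun p => _) = (fun p => (-1) *: f p)).
  by apply: smooth_scale => //; exact: smooth_cst.
by apply/funext => p; rewrite scaleN1r.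
Qed.

Lemma smooth_exp V (A : set V) (f : V -> R) n : open A ->
  smooth A f -> smooth A (fun p => f p ^+ n).
Proof.
move=> oA cf; elim: n => [|n IH].
  by under eq_fun do rewrite expr0; exact: smooth_cst.
by under eq_fun do rewrite exprS; exact: smooth_mul.
Qed.

Lemma smooth_inv V (A : set V) (f : V -> R) : open A -> (forall p, A p -> f p != 0) ->
  smooth A f -> smooth A (fun p => (f p)^-1).
Proof. by move=> oA f0 cf k; exact: Ck_inv. Qed.

Lemma smooth_pair V W X (A : set V) (f : V -> W) (g : V -> X) : open A ->
  smooth A f -> smooth A g -> smooth A (fun p => (f p, g p)).
Proof. by move=> oA cf cg k; exact: Ck_pair. Qed.

Lemma smooth_fst V W X (A : set V) (f : V -> W * X) : open A ->
  smooth A f -> smooth A (fun p => (f p).1).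
Proof. by move=> oA cf k; exact: Ck_fst. Qed.

Lemma smooth_snd V W X (A : set V) (f : V -> W * X) : open A ->
  smooth A f -> smooth A (fun p => (f p).2).
Proof. by move=> oA cf k; exact: Ck_snd. Qed.

Lemma smooth_coords V W X (Z : normedModType R) (A : set V) (f : V -> W * X * Z) : open A -> smooth A f ->
  [/\ smooth A (fun p => (f p).1.1), smooth A (fun p => (f p).1.2) & smooth A (fun p => (f p).2)].
Proof.
move=> oA sf; have s1 := smooth_fst oA sf.
by split; [exact: smooth_fst | exact: smooth_snd | exact: smooth_snd].
Qed.

Lemma smooth_comp V {fV : findim V} W {fW : findim W} X {fX : findim X}
    (A : set V) (B : set W) (h : V -> W) (f : W -> X) :
  open A -> open B -> (forall p, A p -> B (h p)) ->
  smooth A h -> smooth B f -> smooth A (fun p => f (h p)).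
Proof. by move=> oA oB AB ch cf k; exact: Ck_comp (ch k) (cf k). Qed.

Lemma smooth_differentiable V {fV : findim V} W {fW : findim W} (A : set V) (f : V -> W) p :
  open A -> smooth A f -> A p -> differentiable f p.
Proof. by move=> oA cf Ap; exact: (Ck_differentiable oA (cf 1) Ap). Qed.

Lemma smooth_is_derive V {fV : findim V} W {fW : findim W} (A : set V) (f : V -> W) p v :
  open A -> smooth A f -> A p -> is_derive p v f ('D_v f p).
Proof.
by move=> oA cf Ap; apply: differentiable_is_derive; exact: (smooth_differentiable oA cf Ap).
Qed.

(** Exponential, arctangent and [mfun] have a derivative that is at least as regular as the function
    itself, so regularity bootstraps. *)
Lemma smooth_R1 (A : set R) (f f' : R -> R) : open A ->
  (forall x, A x -> is_derive x (1 : R) f (f' x)) ->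
  (forall k, Ck k A f -> Ck k A f') -> smooth A f.
Proof.
move=> oA df H.
have cf x : A x -> {for x, continuous f}.
  by move=> /df[d _]; apply: differentiable_continuous; exact/derivable1_diffP.
elim=> [|k IH]; first by split.
apply: (@Ck_is_derive _ _ _ _ _ _ (fun v x : R => v * f' x)) => //.
  by move=> v x Ax; rewrite -{1}[v]mulr1; exact: (is_derive_dirZ v (df x Ax)).
by move=> v; apply: Ck_scale => //; [exact: Ck_cst | exact: H].
Qed.

Lemma smooth_expR (A : set R) : open A -> smooth A expR.
Proof. by move=> oA; apply: (smooth_R1 (f' := expR)). Qed.

Lemma smooth_sincos (A : set R) : open A -> smooth A sin /\ smooth A cos.
Proof.
move=> oA; suff H k : Ck k A sin /\ Ck k A cos by split=> k; have [] := H k.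
elim: k => [|k [IHs IHc]].
  split; split=> // x _; [exact: continuous_sin | exact: continuous_cos].
split.
  apply: (@Ck_is_derive _ _ _ _ _ _ (fun v x : R => v * cos x)) => //.
  - by move=> x _; exact: continuous_sin.
  - by move=> v x Ax; rewrite -{1}[v]mulr1; exact: (is_derive_dirZ v (is_derive_sin x)).
  - by move=> v; apply: Ck_scale => //; exact: Ck_cst.
apply: (@Ck_is_derive _ _ _ _ _ _ (fun v x : R => (- v) * sin x)) => //.
- by move=> x _; exact: continuous_cos.
- move=> v x Ax; rewrite mulNr -mulrN -{1}[v]mulr1.
  exact: (is_derive_dirZ v (is_derive_cos x)).
- by move=> v; apply: Ck_scale => //; exact: Ck_cst.
Qed.

Lemma smooth_atan (A : set R) : open A -> smooth A atan.
Proof.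
move=> oA; apply: (smooth_R1 (f' := fun x => (1 + x ^+ 2)^-1)) => // k _.
apply: (smooth_inv oA); last first.
  apply: smooth_add => //; first exact: smooth_cst.
  by apply: smooth_exp => //; exact: smooth_id.
by move=> x _; rewrite gt_eqF // ltr_wpDr // sqr_ge0.
Qed.

Lemma open_preim V W (U : set V) (f : V -> W) (O : set W) : open U -> smooth U f -> open O ->
  open [set y | U y /\ O (f y)].
Proof.
move=> oU cf oO; rewrite openE => y [Uy Oy]; apply: filterI; first exact: open_nbhs_nbhs.
by apply: (Ck_cont (cf 0) Uy); exact: open_nbhs_nbhs.
Qed.

(** Supplies one constant for all points near [p0] and all directions, as Gronwall's lemma requires
    for the transport equations. *)
Lemma derive_bounded V {fV : findim V} W {fW : findim W} (D : set V) (Q : V -> W) p0 :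
  open D -> smooth D Q -> D p0 ->
  exists2 C, 0 <= C & \forall p \near p0, forall v, `|'D_v Q p| <= C * `|v|.
Proof.
move=> oD sQ Dp0.
have H (s : seq (@fI R V fV)) : exists2 C, 0 <= C & \forall p \near p0, forall v,
    `|\sum_(i <- s) fc i v *: 'D_(fb i) Q p| <= C * `|v|.
  elim: s => [|i s [C C0 HC]].
    by exists 0 => //; apply: nearW => p v; rewrite big_nil normr0 mul0r.
  have [k k0 kP] := fc_lip i.
  exists (k * (`|'D_(fb i) Q p0| + 1) + C).
    by rewrite addr_ge0 // mulr_ge0 ?addr_ge0 // ltW.
  have cQ : {for p0, continuous (fun p => 'D_(fb i) Q p)}.
    exact: (Ck_cont (smooth_derive (fb i) sQ 0) Dp0).
  have /cvgrPdist_lt/(_ _ ltr01) := cQ.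
  apply: filterS2 HC => p HC lt1 v.
  rewrite big_cons (le_trans (ler_normD _ _)) // mulrDl lerD // normrZ mulrAC.
  apply: ler_pM => //.
  have := ler_normB ('D_(fb i) Q p0) ('D_(fb i) Q p0 - 'D_(fb i) Q p).
  by rewrite opprB addrC subrK => /le_trans -> //; rewrite lerD // ltW.
have [C C0 HC] := H (index_enum _).
exists C => //; apply: filterS2 HC (nbhs_open oD Dp0) => p HC Dp v.
by rewrite derive_findim //; exact: smooth_differentiable sQ Dp.
Qed.

(** The solution of (1 + t^2) m' = (t - k) m with m(0) = 1, written as a single exponential so that
    positivity is immediate. The case [k = q] gives [uprofile], the case [k = 3 * q] the factor m of
    the invariant equation. *)
Definition mfun (k t : R) : R := expR (ln (1 + t ^+ 2) / 2 - k * atan t).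

Lemma mfun_gt0 k t : 0 < mfun k t.
Proof. exact: expR_gt0. Qed.

Lemma onesqr_gt0 (t : R) : 0 < 1 + t ^+ 2.
Proof. by rewrite ltr_wpDr // sqr_ge0. Qed.

Lemma onesqr_neq0 (t : R) : 1 + t ^+ 2 != 0.
Proof. by rewrite gt_eqF // onesqr_gt0. Qed.

Lemma is_derive_mfun k (t : R) :
  is_derive t (1 : R) (mfun k) ((t - k) / (1 + t ^+ 2) * mfun k t).
Proof.
have Dsq : is_derive t (1 : R) (fun t : R => 1 + t ^+ 2) (2 * t).
  have H := is_deriveM (is_derive_id t (1 : R)) (is_derive_id t (1 : R)).
  rewrite (_ : (fun t : R => 1 + t ^+ 2) = cst 1 + id * id); last first.
    by apply/funext => x; rewrite expr2.
  apply: (is_derive_eq (is_deriveD (is_derive_cst (1 : R) t (1 : R)) H)).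
  by rewrite /GRing.scale /=; ring.
have Dln := @is_derive1_comp R (@ln R) (fun t : R => 1 + t ^+ 2) t _ _
  (is_derive1_ln (onesqr_gt0 t)) Dsq.
have D1 := is_deriveM Dln (is_derive_cst (2^-1 : R) t (1 : R)).
have D2 := is_deriveM (is_derive_cst k t (1 : R)) (is_derive1_atan t).
have D3 := is_deriveB D1 D2.
have D4 := @is_derive1_comp R (@expR R) _ t _ _ (is_derive_expR _) D3.
apply: (is_derive_eq D4); rewrite -[X in X * _]/(mfun k t).
move: (mfun k t) => E; rewrite /GRing.scale /=.
by field; exact: onesqr_neq0.
Qed.

Lemma smooth_mfun k (A : set R) : open A -> smooth A (mfun k).
Proof.
move=> oA; apply: (smooth_R1 oA (fun x _ => is_derive_mfun k x)) => n Hn.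
apply: Ck_scale => //.
have : smooth A (fun x : R => (x - k) / (1 + x ^+ 2)); last exact.
apply: smooth_mul => //.
  by apply: smooth_add => //; [exact: smooth_id | exact: smooth_cst].
apply: smooth_inv => //; first by move=> x _; exact: onesqr_neq0.
apply: smooth_add => //; first exact: smooth_cst.
by apply: smooth_exp => //; exact: smooth_id.
Qed.

End SmoothTools.


Lemma open_neq0 {R : realType} : open [set x : R | x != 0].
Proof.
rewrite openE => x /= x0; apply/nbhs_ballP; exists `|x|; rewrite /= ?normr_gt0 // => y.
by rewrite -ball_normE /=; apply: contraTneq => ->; rewrite subr0 ltxx.
Qed.

Lemma is_derive_sub {R : realType} {V W : normedModType R} (f g : V -> W) p v df dg :
  is_derive p v f df -> is_derive p v g dg ->
  is_derive p v (fun z => f z - g z) (df - dg).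
Proof. exact: is_deriveB. Qed.

Lemma is_derive_add {R : realType} {V W : normedModType R} (f g : V -> W) p v df dg :
  is_derive p v f df -> is_derive p v g dg ->
  is_derive p v (fun z => f z + g z) (df + dg).
Proof. exact: is_deriveD. Qed.

Lemma is_derive_mul {R : realType} {V : normedModType R} (f g : V -> R) p v df dg :
  is_derive p v f df -> is_derive p v g dg ->
  is_derive p v (fun z => f z * g z) (f p * dg + g p * df).
Proof. exact: is_deriveM. Qed.

Lemma is_derive_div {R : realType} (f g : R -> R) (x df dg : R) : g x != 0 ->
  is_derive x (1 : R) f df -> is_derive x (1 : R) g dg ->
  is_derive x (1 : R) (fun y => f y / g y) ((df * g x - f x * dg) / g x ^+ 2).
Proof.
move=> g0 Df Dg; have H := is_derive_mul Df (is_derive_inv g0 Dg).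
by apply: (is_derive_eq H); field.
Qed.

(** First variation along a flow line: by symmetry of second derivatives the [w]-derivative of
    ['D_v F] is ['D_v (Q \o F)], which is linear in ['D_v F]. *)
Lemma flow_variation {R : realType} {V W : normedModType R} {fV : findim V} {fW : findim W}
    (B : set V) (D : set W) (F : V -> W) (Q : W -> W) w : open B -> open D ->
  smooth B F -> smooth D Q -> (forall y, B y -> D (F y)) ->
  (forall y, B y -> 'D_w F y = Q (F y)) ->
  forall y v, B y -> is_derive y w (fun z => 'D_v F z) ('D_('D_v F y) Q (F y)).
Proof.
move=> oB oD sF sQ BD FQ y v By.
have dF : differentiable (fun z => 'D_v F z) y.
  exact: (smooth_differentiable oB (smooth_derive v sF) By).
apply: (is_derive_eq (differentiable_is_derive w dF)).
rewrite (schwarz v w oB (sF 2) By).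
have -> : 'D_v (fun z => 'D_w F z) y = 'D_v (Q \o F) y.
  by apply: near_eq_derive; apply: filterS (nbhs_open oB By) => z /FQ.
have dQ : differentiable Q (F y) by exact: (smooth_differentiable oD sQ (BD y By)).
have dFy : is_derive y v F ('D_v F y) by exact: (smooth_is_derive v oB sF By).
by have [_ ->] := is_derive_comp dFy dQ.
Qed.

(** Uniqueness for a linear differential equation along the line in direction [w]; it carries an
    identity from one slice of a ball to the rest. *)
Lemma linear_transport {R : realType} {V W : normedModType R} {fV : findim V} {fW : findim W}
    (c : V) (r C : R) (F Y : V -> W) (Q : W -> W) w : 0 <= C ->
  (forall y v, ball c r y -> `|'D_v Q (F y)| <= C * `|v|) ->
  (forall y, ball c r y -> is_derive y w Y ('D_(Y y) Q (F y))) ->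
  forall y s, ball c r y -> ball c r (y + s *: w) -> Y y = 0 -> Y (y + s *: w) = 0.
Proof.
move=> C0 bd dY y s By Bsy Yy.
apply: (@gronwall_segment _ _ _ _ _ _ _ (`|s| * C)) => //; first exact: mulr_ge0.
move=> t tI; have Bt : ball c r (y + t *: (s *: w)).
  have := ball_segment Bsy By tI.
  by rewrite [y + s *: w - y]addrC addKr.
exists (s *: 'D_(Y (y + t *: (s *: w))) Q (F (y + t *: (s *: w)))).
  exact: is_derive_dirZ (dY _ Bt).
by rewrite normrZ -mulrA ler_wpM2l // bd.
Qed.

(** * Coordinates built from the flows *)

Section Straightening.
Context {R : realType} (q : R).
Local Notation P := (R * R * R)%type.
Local Notation dirt := ((1, 0, 0) : P).
Local Notation dirx := ((0, 1, 0) : P).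
Local Notation diru := ((0, 0, 1) : P).
Context (D : set P) (e1 e2 e3 e4 : @vfield R).
Context (oD : open D) (pr1 : projectable D e1) (pr2 : projectable D e2)
  (pr3 : projectable D e3) (pr4 : projectable D e4).
Context (rel12 : forall p, D p -> 'D_(e1 p) e2 p = 'D_(e2 p) e1 p).
Context (rel13 : forall p, D p -> 'D_(e1 p) e3 p = 'D_(e3 p) e1 p).
Context (rel23 : forall p, D p -> 'D_(e2 p) e3 p = 'D_(e3 p) e2 p + e1 p).
Context (rel14 : forall p, D p -> 'D_(e1 p) e4 p = 'D_(e4 p) e1 p + (2 * q) *: e1 p).
Context (rel24 : forall p, D p -> 'D_(e2 p) e4 p = 'D_(e4 p) e2 p + (q *: e2 p - e3 p)).
Context (rel34 : forall p, D p -> 'D_(e3 p) e4 p = 'D_(e4 p) e3 p + (e2 p + q *: e3 p)).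

Context (t0 u0 : R) (p0 : P) (Dp0 : D p0) (e3p0 : e3 p0 = u0 *: e1 p0 + t0 *: e2 p0).
Context (d1 d2 d4 : R) (A1 A2 A4 : set P) (f1 f2 f4 : R * P -> P).
Context (fl1 : local_flow D e1 d1 A1 f1) (fl2 : local_flow D e2 d2 A2 f2)
  (fl4 : local_flow D e4 d4 A4 f4) (A1p0 : A1 p0) (A2p0 : A2 p0) (A4p0 : A4 p0).

Lemma ball3E (c y : P) (r : R) : ball c r y <->
  [/\ `|c.1.1 - y.1.1| < r, `|c.1.2 - y.1.2| < r & `|c.2 - y.2| < r].
Proof.
by split => [[[a b] z]|[a b z]]; split.
Qed.

(* Psi (t, x, y) is reached from p0 by the flow of e4 for the time (stime t)
   at which the first coordinate has moved from t0 to t, then by the flow of e2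
   for the time y and that of e1 for the time x. *)
Definition stime (t : R) : R := atan t0 - atan t.
Definition scurve (t : R) : P := f4 (stime t, p0).
(** The coefficient of e1 in e3 along [scurve]: it starts from [u0] and solves (1 + t^2) u' = (t -
    q) u, which is the e1-component of the relation [e3, e4] = e2 + q e3. *)
Definition uprofile (t : R) : R := u0 * (mfun q t / mfun q t0).
Definition Psi (y : P) : P := f1 (y.1.2, f2 (y.2, scurve y.1.1)).
Local Notation y0 := ((t0, 0, 0) : P).

Lemma flow_dom_open (d : R) (A : set P) : open A ->
  open [set y : R * P | `|y.1| < d /\ A y.2].
Proof.
move=> oA; rewrite openE => -[s p] /= [sd Ap].
exists ([set s | `|s| < d], A) => /=; last by move=> [? ?].
split; last exact: open_nbhs_nbhs.
apply/nbhs_ballP; exists (d - `|s|); rewrite /= ?subr_gt0 // => r.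
rewrite -ball_normE /= => sr; have := ler_normD s (r - s); rewrite addrC subrK distrC; lra.
Qed.

(** Each flow is smooth only on its own domain, so the admissible set is cut out by successive
    preimages; [y0] lies in all of them because every flow time vanishes there. *)
Lemma Psi_domain (N : set P) : open N -> N p0 -> exists2 r : R, 0 < r &
  [/\ smooth (ball y0 r) Psi,
      forall y, ball y0 r y -> [/\ `|stime y.1.1| < d4, A2 (scurve y.1.1) & `|y.2| < d2],
      forall y, ball y0 r y -> A1 (f2 (y.2, scurve y.1.1)) /\ `|y.1.2| < d1 &
      forall y, ball y0 r y -> N (Psi y)].
Proof.
move=> oN Np0.
have [d10 oA1 sf1 f10 df1] := fl1; have [d20 oA2 sf2 f20 df2] := fl2.
have [d40 oA4 sf4 f40 df4] := fl4.
have oT : open ([set: P]) by exact: openT.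
have [st sa sb] := smooth_coords oT (@smooth_id _ P setT).
have ss : smooth setT (fun y : P => stime y.1.1).
  apply: smooth_add => //; first exact: smooth_cst.
  apply: smooth_opp => //; apply: (smooth_comp (B := [set: R])) => //; first exact: openT.
  by apply: smooth_atan; exact: openT.
have obd (d : R) : open [set r : R | `|r| < d].
  rewrite (_ : [set r : R | _] = ball 0 d); first exact: ball_open.
  by apply/seteqP; split=> r /=; rewrite -ball_normE /= sub0r normrN.
pose U1 := [set y : P | setT y /\ `|stime y.1.1| < d4].
have oU1 : open U1 by exact: (open_preim oT ss (obd d4)).
have ssc : smooth U1 (fun y => scurve y.1.1).
  apply: (smooth_comp (h := fun y : P => (stime y.1.1, p0)) oU1 (flow_dom_open (d := d4) oA4)) => //.
    by move=> y [_ h].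
  apply: smooth_pair => //; last exact: smooth_cst.
  exact: smooth_sub ss.
pose U2 := [set y : P | [set y | U1 y /\ A2 (scurve y.1.1)] y /\ `|y.2| < d2].
have oU2' : open [set y | U1 y /\ A2 (scurve y.1.1)] by exact: (open_preim oU1 ssc oA2).
have oU2 : open U2.
  by apply: (open_preim oU2' _ (obd d2)); exact: smooth_sub sb.
have schi : smooth U2 (fun y => f2 (y.2, scurve y.1.1)).
  apply: (smooth_comp (h := fun y : P => (y.2, scurve y.1.1)) oU2 (flow_dom_open (d := d2) oA2)) => //.
    by move=> y [[_ h1] h2].
  apply: smooth_pair => //; first exact: smooth_sub sb.
  by apply: smooth_sub ssc => y [[]].
pose U3 := [set y : P | [set y | U2 y /\ A1 (f2 (y.2, scurve y.1.1))] y /\ `|y.1.2| < d1].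
have oU3' : open [set y | U2 y /\ A1 (f2 (y.2, scurve y.1.1))] by exact: (open_preim oU2 schi oA1).
have oU3 : open U3.
  by apply: (open_preim oU3' _ (obd d1)); exact: smooth_sub sa.
have sPsi : smooth U3 Psi.
  apply: (smooth_comp (h := fun y : P => (y.1.2, f2 (y.2, scurve y.1.1))) oU3
    (flow_dom_open (d := d1) oA1)) => //.
    by move=> y [[_ h1] h2].
  apply: smooth_pair => //; first exact: smooth_sub sa.
  by apply: smooth_sub schi => y [[]].
pose U4 := [set y : P | U3 y /\ N (Psi y)].
have oU4 : open U4 by exact: (open_preim oU3 sPsi oN).
have st0 : stime t0 = 0 by rewrite /stime subrr.
have sc0 : scurve t0 = p0 by rewrite /scurve st0 f40.
have U4y0 : U4 y0.
  by rewrite /U4 /U3 /U2 /U1 /Psi /= st0 sc0 !normr0 f20 // f10.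
have /nbhs_ballP[r /= r0 rP] := nbhs_open oU4 U4y0.
exists r => //; split.
- by apply: smooth_sub sPsi => y /rP[].
- by move=> y /rP[[[[[[_ ?] ?] ?] _] _] _].
- by move=> y /rP[[[_ ?] ?] _].
- by move=> y /rP[].
Qed.

Section OnBall.
Local Notation B := (ball y0).
Context (r C : R) (C0 : 0 <= C) (sPsi : smooth (B r) Psi)
  (dom2 : forall y, B r y -> [/\ `|stime y.1.1| < d4, A2 (scurve y.1.1) & `|y.2| < d2])
  (dom1 : forall y, B r y -> A1 (f2 (y.2, scurve y.1.1)) /\ `|y.1.2| < d1)
  (PsiD : forall y, B r y -> D (Psi y))
  (bd1 : forall y v, B r y -> `|'D_v e1 (Psi y)| <= C * `|v|)
  (bd2 : forall y v, B r y -> `|'D_v e2 (Psi y)| <= C * `|v|)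
  (bd4 : forall y v, B r y -> `|'D_v e4 (Psi y)| <= C * `|v|).

Lemma Psi_dx y : B r y -> is_derive y dirx Psi (e1 (Psi y)).
Proof.
move=> By; have [h1 h2] := dom1 By; have [_ _ _ _ df1] := fl1.
have [_ H] := df1 _ _ h1 h2.
apply: (is_derive_line _ H).
apply: (@nearW _ (nbhs (0 : R))) => h.
have -> : h *: dirx + y = (y.1.1, h + y.1.2, y.2).
  by apply: triple_eq; rewrite /= /GRing.scale /= ?mulr0 ?mulr1 ?add0r.
by [].
Qed.

Lemma Psi_slice y : B r y -> y.1.2 = 0 -> Psi y = f2 (y.2, scurve y.1.1).
Proof.
move=> By y0; have [h1 h2] := dom1 By; have [_ _ _ f10 _] := fl1.
by rewrite /Psi y0 f10.
Qed.

Lemma Psi_du_slice y : B r y -> y.1.2 = 0 -> is_derive y diru Psi (e2 (Psi y)).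
Proof.
move=> By y0; rewrite (Psi_slice By y0).
have [h1 h2 h3] := dom2 By; have [_ _ _ _ df2] := fl2.
have [_ H] := df2 _ _ h2 h3.
apply: (is_derive_line _ H).
have nB := near_line diru (nbhs_open (ball_open _ _) By).
apply: filterS nB => h Bh; rewrite (Psi_slice Bh).
  have -> : h *: diru + y = (y.1.1, y.1.2, h + y.2).
    by apply: triple_eq; rewrite /= /GRing.scale /= ?mulr0 ?mulr1 ?add0r.
  by [].
by rewrite /= y0 addr0; exact: mulr0.
Qed.

Lemma Psi_curve t : B r (t, 0, 0) -> Psi (t, 0, 0) = scurve t.
Proof.
move=> By; rewrite Psi_slice //=; have [_ h2 _] := dom2 By; have [_ _ _ f20 _] := fl2.
by rewrite f20.
Qed.

Lemma Psi_dt_curve t : B r (t, 0, 0) ->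
  is_derive ((t, 0, 0) : P) dirt Psi (- (1 + t ^+ 2)^-1 *: e4 (Psi (t, 0, 0))).
Proof.
move=> By; rewrite (Psi_curve By).
have [h1 _ _] := dom2 By; have [_ _ _ _ df4] := fl4.
have [_ H] := df4 _ _ A4p0 h1.
have ds : is_derive t (1 : R) stime (- (1 + t ^+ 2)^-1).
  apply: (is_derive_eq (is_deriveB (is_derive_cst (atan t0) t (1 : R)) (is_derive1_atan t))).
  by rewrite sub0r.
have dsc := is_derive_comp1 ds H.
apply: (is_derive_line _ dsc).
have nB := near_line dirt (nbhs_open (ball_open _ _) By).
apply: filterS nB => h.
have -> : h *: dirt + (t, 0, 0) = (h + t, 0, 0).
  by apply: triple_eq; rewrite /= /GRing.scale /= ?mulr0 ?mulr1 ?addr0.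
by move=> Bh; rewrite Psi_curve.
Qed.

(** Balls of the product norm are boxes, so a point can be reached from the centre along t, then u,
    then x without leaving the ball. *)
Lemma box_slice y : B r y -> [/\ B r (y.1.1, 0, 0), B r (y.1.1, 0, y.2) &
  [/\ y = (y.1.1, 0, y.2) + y.1.2 *: dirx,
   (y.1.1, 0, y.2) = (y.1.1, 0, 0) + y.2 *: diru &
   (y.1.1, 0, 0) = y0 + (y.1.1 - t0) *: dirt]].
Proof.
move=> /ball3E[/= a b c]; have r0 : 0 < r by apply: le_lt_trans a.
split; [apply/ball3E|apply/ball3E|]; try (by rewrite /= ?subrr ?normr0; split).
by split; apply: triple_eq; rewrite /= /GRing.scale /=; ring.
Qed.

(** On the slice x = 0 this is the flow equation of e2. Elsewhere the error solves a linear equation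
    along x, because e1 and e2 commute, and hence stays zero. *)
Lemma Psi_du y : B r y -> is_derive y diru Psi (e2 (Psi y)).
Proof.
move=> By; have oB : open (B r) by exact: ball_open.
pose Y z := 'D_diru Psi z - e2 (Psi z).
have dY z : B r z -> is_derive z dirx Y ('D_(Y z) e1 (Psi z)).
  move=> Bz; have Dz := PsiD Bz.
  have [de1 de2 _ _] := realization_differentiable oD pr1 pr2 pr3 pr4 Dz.
  have H1 : is_derive z dirx (fun z => 'D_diru Psi z)
     ('D_('D_diru Psi z) e1 (Psi z)).
    apply: (flow_variation oB oD sPsi pr1.1 PsiD) => // y' By'.
    by have [_] := Psi_dx By'.
  have H2 := is_derive_comp (Psi_dx Bz) de2.
  have -> : 'D_(Y z) e1 (Psi z) =
      'D_('D_diru Psi z) e1 (Psi z) - 'D_(e1 (Psi z)) e2 (Psi z).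
    by rewrite (rel12 Dz); exact: (derive_dirB _ _ de1).
  exact: is_derive_sub H1 H2.
have [_ B1 [E _ _]] := box_slice By.
suff : Y y = 0.
  move=> /eqP; rewrite subr_eq0 => /eqP <-.
  exact: (smooth_is_derive _ oB sPsi By).
rewrite E; apply: (linear_transport C0 bd1 dY) => //; first by rewrite -E.
by have [_ e] := Psi_du_slice B1 erefl; rewrite /Y e subrr.
Qed.

Lemma is_derive_uprofile t : is_derive t (1 : R) uprofile ((t - q) / (1 + t ^+ 2) * uprofile t).
Proof.
have c (k : R) : is_derive t (1 : R) (fun=> k) 0 by exact: is_derive_cst.
apply: (is_derive_eq (is_derive_mul (c u0) (is_derive_mul (is_derive_mfun q t) (c (mfun q t0)^-1)))).
by rewrite /uprofile; ring.
Qed.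

Lemma is_derive_time (f : R -> R) d (z v : P) : is_derive z.1.1 (1 : R) f d ->
  is_derive z v (fun z : P => f z.1.1) (v.1.1 * d).
Proof. exact: is_derive_comp1 (is_derive_fst (is_derive_fst (is_derive_id z v))). Qed.

(* Both defects vanish at (t0, 0, 0) and satisfy linear equations along the
   coordinate lines, hence vanish identically. *)
Definition defect3 (z : P) : P :=
  (z.2 + uprofile z.1.1) *: e1 (Psi z) + z.1.1 *: e2 (Psi z) - e3 (Psi z).

Lemma is_derive_defect3 z v g : B r z -> is_derive z v Psi g ->
  is_derive z v defect3
   ((v.2 + v.1.1 * ((z.1.1 - q) / (1 + z.1.1 ^+ 2) * uprofile z.1.1)) *: e1 (Psi z)
    + (z.2 + uprofile z.1.1) *: 'D_g e1 (Psi z)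
    + (v.1.1 *: e2 (Psi z) + z.1.1 *: 'D_g e2 (Psi z)) - 'D_g e3 (Psi z)).
Proof.
move=> Bz dPsi.
have [de1 de2 de3 _] := realization_differentiable oD pr1 pr2 pr3 pr4 (PsiD Bz).
have K1 := is_derive_add (is_derive_snd (is_derive_id z v))
  (is_derive_time v (is_derive_uprofile z.1.1)).
have K2 := is_derive_fst (is_derive_fst (is_derive_id z v)).
have H1 := is_derive_scale K1 (is_derive_comp dPsi de1).
have H2 := is_derive_scale K2 (is_derive_comp dPsi de2).
exact: is_derive_sub (is_derive_add H1 H2) (is_derive_comp dPsi de3).
Qed.

Lemma defect3_dir (f : P -> P) z : differentiable f (Psi z) ->
  'D_(defect3 z) f (Psi z) = (z.2 + uprofile z.1.1) *: 'D_(e1 (Psi z)) f (Psi z) +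
     z.1.1 *: 'D_(e2 (Psi z)) f (Psi z) - 'D_(e3 (Psi z)) f (Psi z).
Proof.
move=> df; rewrite /defect3 (derive_dirB _ _ df) (derive_dirD _ _ df).
by rewrite !(derive_dirZ _ _ df).
Qed.

Lemma defect3_dx z : B r z ->
  is_derive z dirx defect3 ('D_(defect3 z) e1 (Psi z)).
Proof.
move=> Bz; have Dz := PsiD Bz.
have [de1 _ _ _] := realization_differentiable oD pr1 pr2 pr3 pr4 Dz.
apply: (is_derive_eq (is_derive_defect3 Bz (Psi_dx Bz))).
rewrite (defect3_dir de1) (rel12 Dz) (rel13 Dz) /=.
move: ('D_(e1 (Psi z)) e1 (Psi z)) ('D_(e2 (Psi z)) e1 (Psi z)) ('D_(e3 (Psi z)) e1 (Psi z)).
move: (e1 (Psi z)) (e2 (Psi z)) => E1 E2 X Y Z.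
by apply: triple_eq; rewrite /= /GRing.scale /=; ring.
Qed.

Lemma defect3_du z : B r z ->
  is_derive z diru defect3 ('D_(defect3 z) e2 (Psi z)).
Proof.
move=> Bz; have Dz := PsiD Bz.
have [_ de2 _ _] := realization_differentiable oD pr1 pr2 pr3 pr4 Dz.
apply: (is_derive_eq (is_derive_defect3 Bz (Psi_du Bz))).
rewrite (defect3_dir de2) (rel12 Dz) (rel23 Dz) /=.
move: ('D_(e1 (Psi z)) e2 (Psi z)) ('D_(e2 (Psi z)) e2 (Psi z)) ('D_(e3 (Psi z)) e2 (Psi z)).
move: (e1 (Psi z)) (e2 (Psi z)) => E1 E2 X Y Z.
by apply: triple_eq; rewrite /= /GRing.scale /=; ring.
Qed.

(** The speed - (1 + t^2) and the equation of [uprofile] enter here: they absorb the remaining terms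
    in e1, e2 and e3 into a multiple of the defect. *)
Lemma defect3_dt t : B r (t, 0, 0) ->
  is_derive ((t, 0, 0) : P) dirt defect3
    (- (1 + t ^+ 2)^-1 *: ('D_(defect3 (t, 0, 0)) e4 (Psi (t, 0, 0))
       - (t + q) *: defect3 (t, 0, 0))).
Proof.
move=> Bz; have Dz := PsiD Bz.
have [de1 de2 de3 de4] := realization_differentiable oD pr1 pr2 pr3 pr4 Dz.
apply: (is_derive_eq (is_derive_defect3 Bz (Psi_dt_curve Bz))).
rewrite (defect3_dir de4) (rel14 Dz) (rel24 Dz) (rel34 Dz) /defect3 /=.
rewrite (derive_dirZ _ _ de1) (derive_dirZ _ _ de2) (derive_dirZ _ _ de3).
set p := Psi (t, 0, 0).
move: ('D_(e4 p) e1 p) ('D_(e4 p) e2 p) ('D_(e4 p) e3 p) => X Y Z.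
move: (e1 p) (e2 p) (e3 p) (uprofile t) => E1 E2 E3 u.
have tn0 := onesqr_neq0 t.
by apply: triple_eq; rewrite /= /GRing.scale /=; field.
Qed.

Lemma defect3_eq0 y : B r y -> defect3 y = 0.
Proof.
move=> By; have [B0 B1 [E2 E1 E0]] := box_slice By.
have r0 : 0 < r by case: By => -[+ _] _; rewrite -ball_normE /=; exact: le_lt_trans.
suff H0 : defect3 (y.1.1, 0, 0) = 0.
  rewrite E2; apply: (linear_transport C0 bd1 defect3_dx) => //; first by rewrite -E2.
  rewrite E1; apply: (linear_transport C0 bd2 defect3_du) => //; first by rewrite -E1.
(* On the ball the absolute value of t + q is bounded by the added sum, and the factor 1 / (1 + t^2)
   is at most 1. *)
pose C' := C + (`|t0| + r + `|q|).
have C'0 : 0 <= C' by rewrite !addr_ge0 // ltW.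
rewrite E0; apply: (@gronwall_segment _ _ _ _ _ _ _ (`|y.1.1 - t0| * C')).
- by rewrite mulr_ge0.
- move=> s sI; have Bs : B r (y0 + s *: ((y.1.1 - t0) *: dirt)).
    have := ball_segment B0 (ballxx _ r0) sI.
    by rewrite E0 [y0 + _ - y0]addrC addKr.
  move: Bs; have -> : y0 + s *: ((y.1.1 - t0) *: dirt) = (t0 + s * (y.1.1 - t0), 0, 0).
    by apply: triple_eq; rewrite /= /GRing.scale /=; ring.
  set t := t0 + _ => Bt; eexists; first exact: (is_derive_dirZ (y.1.1 - t0) (defect3_dt Bt)).
  rewrite normrZ -mulrA ler_wpM2l // normrZ.
  have k1 : `|- (1 + t ^+ 2)^-1| <= 1.
    by rewrite normrN ger0_norm ?invr_ge0 ?(ltW (onesqr_gt0 t)) // invf_le1 ?onesqr_gt0 // lerDl sqr_ge0.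
  rewrite (le_trans (ler_wpM2r (normr_ge0 _) k1)) // mul1r (le_trans (ler_normB _ _)) //.
  rewrite mulrDl lerD //; first exact: bd4.
  rewrite normrZ ler_wpM2r // (le_trans (ler_normD _ _)) // lerD2r.
  case: Bt => -[+ _] _; rewrite -ball_normE /= distrC => tr.
  have := ler_normD (t - t0) t0; rewrite subrK; lra.
have sc0 : scurve t0 = p0.
  by rewrite /scurve /stime subrr; have [_ _ _ -> //] := fl4.
have up0 : uprofile t0 = u0.
  by rewrite /uprofile divff ?mulr1 // gt_eqF // mfun_gt0.
by rewrite /defect3 (Psi_curve (ballxx _ r0)) /= sc0 up0 add0r e3p0 subrr.
Qed.

Lemma Psi_e3 y : B r y ->
  e3 (Psi y) = (y.2 + uprofile y.1.1) *: e1 (Psi y) + y.1.1 *: e2 (Psi y).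
Proof. by move=> /defect3_eq0/eqP; rewrite subr_eq0 => /eqP <-. Qed.

Definition defect4 (z : P) : P :=
  (- (1 + z.1.1 ^+ 2)) *: 'D_dirt Psi z +
  ((2 * q * z.1.2 - z.2 * uprofile z.1.1 - z.2 ^+ 2 / 2) *: e1 (Psi z) +
   ((q - z.1.1) * z.2) *: e2 (Psi z)) - e4 (Psi z).

(** One computation serves x with [Q = e1] and u with [Q = e2]. Since [v] has no time part, the last
    terms are combinations of brackets with [Q], which the relations evaluate. *)
Lemma is_derive_defect4 z (v : P) (Q : P -> P) : B r z -> v.1.1 = 0 -> smooth D Q ->
  (forall y, B r y -> is_derive y v Psi (Q (Psi y))) ->
  is_derive z v defect4
   ('D_(defect4 z) Q (Psi z)
    + (2 * q * v.1.2 - v.2 * uprofile z.1.1 - z.2 * v.2) *: e1 (Psi z)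
    + ((q - z.1.1) * v.2) *: e2 (Psi z)
    + ((2 * q * z.1.2 - z.2 * uprofile z.1.1 - z.2 ^+ 2 / 2) *:
        ('D_(Q (Psi z)) e1 (Psi z) - 'D_(e1 (Psi z)) Q (Psi z))
       + ((q - z.1.1) * z.2) *: ('D_(Q (Psi z)) e2 (Psi z) - 'D_(e2 (Psi z)) Q (Psi z))
       - ('D_(Q (Psi z)) e4 (Psi z) - 'D_(e4 (Psi z)) Q (Psi z)))).
Proof.
move=> Bz v0 sQ dPsi; have Dz := PsiD Bz; have oB : open (B r) by exact: ball_open.
have [de1 de2 _ de4] := realization_differentiable oD pr1 pr2 pr3 pr4 Dz.
have dQ : differentiable Q (Psi z) by exact: (smooth_differentiable oD sQ Dz).
have Dt : is_derive z v (fun z => 'D_dirt Psi z)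
     ('D_('D_dirt Psi z) Q (Psi z)).
  apply: (flow_variation oB oD sPsi sQ PsiD) => // y' By'.
  by have [_] := dPsi y' By'.
have I1 := is_derive_fst (is_derive_fst (is_derive_id z v)).
have I2 := is_derive_snd (is_derive_fst (is_derive_id z v)).
have I3 := is_derive_snd (is_derive_id z v).
have IU := is_derive_time v (is_derive_uprofile z.1.1).
have K0 : is_derive z v (fun z : P => - (1 + z.1.1 ^+ 2)) 0.
  have H := is_deriveN (is_derive_add (is_derive_cst (1 : R) z v) (is_deriveM I1 I1)).
  rewrite (_ : (fun z : P => _) = - (fun z0 => cst 1 z0 + ((fst \o fst) * (fst \o fst)) z0)).
    by apply: (is_derive_eq H); rewrite v0 !scaler0 !addr0 oppr0.
  by apply/funext => y; rewrite expr2.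
have K1 : is_derive z v (fun z : P => 2 * q * z.1.2 - z.2 * uprofile z.1.1 - z.2 ^+ 2 / 2)
    (2 * q * v.1.2 - v.2 * uprofile z.1.1 - z.2 * v.2).
  have H1 := is_deriveM (is_derive_cst (2 * q) z v) I2.
  have H2 := is_deriveM I3 IU.
  have H3 := is_deriveM (is_deriveM I3 I3) (is_derive_cst (2^-1 : R) z v).
  have H := is_derive_sub (is_derive_sub H1 H2) H3.
  apply: (is_derive_eq H); rewrite /= v0 /GRing.scale /=.
  by rewrite !mul0r; field.
have K2 : is_derive z v (fun z : P => (q - z.1.1) * z.2) ((q - z.1.1) * v.2).
  have H := is_deriveM (is_derive_sub (is_derive_cst q z v) I1) I3.
  apply: (is_derive_eq H); rewrite /= v0 /GRing.scale /=; ring.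
have H1 := is_derive_scale K1 (is_derive_comp (dPsi z Bz) de1).
have H2 := is_derive_scale K2 (is_derive_comp (dPsi z Bz) de2).
have H := is_derive_sub (is_derive_add (is_derive_scale K0 Dt) (is_derive_add H1 H2))
   (is_derive_comp (dPsi z Bz) de4).
apply: (is_derive_eq H).
rewrite /defect4 (derive_dirB _ _ dQ) !(derive_dirD _ _ dQ) !(derive_dirZ _ _ dQ) scale0r /=.
set p := Psi z.
move: ('D_('D_dirt Psi z) Q p) ('D_(e1 p) Q p) ('D_(e2 p) Q p) ('D_(e4 p) Q p) => X X1 X2 X4.
move: ('D_(Q p) e1 p) ('D_(Q p) e2 p) ('D_(Q p) e4 p) (e1 p) (e2 p) => Y1 Y2 Y4 E1 E2.
by apply: triple_eq; rewrite /= /GRing.scale /=; ring.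
Qed.

Lemma defect4_eq0 y : B r y -> defect4 y = 0.
Proof.
move=> By; have [B0 B1 [E2 E1 E0]] := box_slice By.
have dx z : B r z -> is_derive z dirx defect4 ('D_(defect4 z) e1 (Psi z)).
  move=> Bz; have Dz := PsiD Bz.
  apply: (is_derive_eq (@is_derive_defect4 z (0, 1, 0) e1 Bz erefl pr1.1 (fun y By => Psi_dx By))).
  rewrite (rel12 Dz) (rel14 Dz) /=.
  move: ('D_(defect4 z) e1 (Psi z)) ('D_(e1 (Psi z)) e1 (Psi z)) ('D_(e2 (Psi z)) e1 (Psi z)).
  move: ('D_(e4 (Psi z)) e1 (Psi z)) (e1 (Psi z)) (e2 (Psi z)) => X4 E1' E2' X0 X1 X2.
  by apply: triple_eq; rewrite /= /GRing.scale /=; ring.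
have du z : B r z -> is_derive z diru defect4 ('D_(defect4 z) e2 (Psi z)).
  move=> Bz; have Dz := PsiD Bz.
  apply: (is_derive_eq (@is_derive_defect4 z (0, 0, 1) e2 Bz erefl pr2.1 (fun y By => Psi_du By))).
  (* The bracket [e2, e4] contains e3, whose expression in e1 and e2 is already known; this is why
     the third field is settled before the fourth. *)
  rewrite -(rel12 Dz) (rel24 Dz) (Psi_e3 Bz) /=.
  move: ('D_(defect4 z) e2 (Psi z)) ('D_(e1 (Psi z)) e2 (Psi z)) ('D_(e2 (Psi z)) e2 (Psi z)).
  move: ('D_(e4 (Psi z)) e2 (Psi z)) (e1 (Psi z)) (e2 (Psi z)) => X4 E1' E2' X0 X1 X2.
  by apply: triple_eq; rewrite /= /GRing.scale /=; ring.
rewrite E2; apply: (linear_transport C0 bd1 dx) => //; first by rewrite -E2.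
rewrite E1; apply: (linear_transport C0 bd2 du) => //; first by rewrite -E1.
(* On the curve x = u = 0 the defect vanishes by construction, since [Psi] follows the flow of e4
   there. *)
have [_ e] := Psi_dt_curve B0; rewrite /defect4 e /=.
have tn0 := onesqr_neq0 y.1.1.
move: (e1 (Psi (y.1.1, 0, 0))) (e2 (Psi (y.1.1, 0, 0))) (e4 (Psi (y.1.1, 0, 0))) => X Y Z.
by apply: triple_eq; rewrite /= /GRing.scale /=; field.
Qed.

Lemma Psi_e4 y : B r y -> e4 (Psi y) =
  (- (1 + y.1.1 ^+ 2)) *: 'D_dirt Psi y +
  ((2 * q * y.1.2 - y.2 * uprofile y.1.1 - y.2 ^+ 2 / 2) *: e1 (Psi y) +
   ((q - y.1.1) * y.2) *: e2 (Psi y)).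
Proof. by move=> /defect4_eq0/eqP; rewrite subr_eq0 => /eqP <-. Qed.

End OnBall.

(** The solution of (1 + t^2) y' = u^2 / 2 - 2 q y with y(t0) = 0, where u is [uprofile]; the
    equation of [uprofile] makes this closed form possible, so no integral appears. *)
Definition xprofile (t : R) : R := (t - t0) * uprofile t ^+ 2 / (2 * (1 + t ^+ 2)).

Lemma smooth_uprofile (A : set R) : open A -> smooth A uprofile.
Proof.
move=> oA; apply: smooth_mul => //; first exact: smooth_cst.
by apply: smooth_mul => //; [exact: smooth_mfun | exact: smooth_cst].
Qed.

Lemma two_onesqr_neq0 (t : R) : 2 * (1 + t ^+ 2) != 0.
Proof. by rewrite mulf_neq0 ?pnatr_eq0 // onesqr_neq0. Qed.

Lemma smooth_xprofile (A : set R) : open A -> smooth A xprofile.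
Proof.
move=> oA; apply: smooth_mul => //.
  apply: smooth_mul => //; first by apply: smooth_add => //; [exact: smooth_id | exact: smooth_cst].
  by apply: smooth_exp => //; exact: smooth_uprofile.
apply: smooth_inv => //; first by move=> t _; exact: two_onesqr_neq0.
apply: smooth_mul => //; first exact: smooth_cst.
apply: smooth_add => //; first exact: smooth_cst.
by apply: smooth_exp => //; exact: smooth_id.
Qed.

Lemma is_derive_xprofile t :
  is_derive t (1 : R) xprofile ((uprofile t ^+ 2 / 2 - 2 * q * xprofile t) / (1 + t ^+ 2)).
Proof.
have c (k : R) : is_derive t (1 : R) (fun=> k) 0 by exact: is_derive_cst.
have I : is_derive t (1 : R) (fun t : R => t) 1 by exact: is_derive_id.
have U := is_derive_uprofile t.
have H1 := is_derive_mul (is_derive_sub I (c t0)) (is_derive_mul U U).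
have H2 := is_derive_mul (c 2) (is_derive_add (c 1) (is_derive_mul I I)).
rewrite (_ : xprofile = fun t => (t - t0) * (uprofile t * uprofile t) / (2 * (1 + t * t))).
  have n0 : 2 * (1 + t * t) != 0 by exact: two_onesqr_neq0.
  apply: (is_derive_eq (@is_derive_div _ _ (fun t => 2 * (1 + t * t)) _ _ _ n0 H1 H2)) => /=.
  by field; exact: onesqr_neq0.
by apply/funext => s; rewrite /xprofile !expr2.
Qed.

(* In the coordinates of Psi, e3 is (u + uprofile) d/dx + t d/du; xprofile then
   removes the function of t that is left in the x-component of e4. *)
Definition chart (y : P) : P := (y.1.1, y.1.2 + xprofile y.1.1, y.2 + uprofile y.1.1).
Definition unchart (n : P) : P := (n.1.1, n.1.2 - xprofile n.1.1, n.2 - uprofile n.1.1).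

Lemma chartK : cancel chart unchart.
Proof. by move=> y; apply: triple_eq; rewrite /= ?addrK. Qed.

Lemma unchartK : cancel unchart chart.
Proof. by move=> y; apply: triple_eq; rewrite /= ?subrK. Qed.

Lemma is_derive_chart (z v : P) : is_derive z v chart
  (v.1.1, v.1.2 + v.1.1 * ((uprofile z.1.1 ^+ 2 / 2 - 2 * q * xprofile z.1.1) / (1 + z.1.1 ^+ 2)),
   v.2 + v.1.1 * ((z.1.1 - q) / (1 + z.1.1 ^+ 2) * uprofile z.1.1)).
Proof.
have I1 := is_derive_fst (is_derive_fst (is_derive_id z v)).
have I2 := is_derive_snd (is_derive_fst (is_derive_id z v)).
have I3 := is_derive_snd (is_derive_id z v).
apply: is_derive_pair; last exact: is_derive_add I3 (is_derive_time v (is_derive_uprofile z.1.1)).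
apply: is_derive_pair => //.
exact: is_derive_add I2 (is_derive_time v (is_derive_xprofile z.1.1)).
Qed.

Lemma smooth_time (g : R -> R) (A : set P) : open A -> (forall B, open B -> smooth B g) ->
  smooth A (fun y : P => g y.1.1).
Proof.
move=> oA sg; apply: (smooth_comp (B := [set: R])) => //; first exact: openT.
  by do 2 apply: smooth_fst => //; exact: smooth_id.
by apply: sg; exact: openT.
Qed.

Lemma smooth_chart (A : set P) : open A -> smooth A chart.
Proof.
move=> oA; have s1 : smooth A (fun y : P => y.1) by apply: smooth_fst => //; exact: smooth_id.
apply: smooth_pair => //; first apply: smooth_pair => //; first exact: smooth_fst.
  apply: smooth_add => //; first exact: smooth_snd.
  by apply: smooth_time => // B; exact: smooth_xprofile.
apply: smooth_add => //; first by apply: smooth_snd => //; exact: smooth_id.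
by apply: smooth_time => // B; exact: smooth_uprofile.
Qed.

Lemma smooth_unchart (A : set P) : open A -> smooth A unchart.
Proof.
move=> oA; have s1 : smooth A (fun y : P => y.1) by apply: smooth_fst => //; exact: smooth_id.
apply: smooth_pair => //; first apply: smooth_pair => //; first exact: smooth_fst.
  apply: smooth_add => //; first exact: smooth_snd.
  by apply: smooth_opp => //; apply: smooth_time => // B; exact: smooth_xprofile.
apply: smooth_add => //; first by apply: smooth_snd => //; exact: smooth_id.
by apply: smooth_opp => //; apply: smooth_time => // B; exact: smooth_uprofile.
Qed.

Lemma smooth_det2 (V : normedModType R) (A : set V) (f g : V -> P) : open A ->
  smooth A f -> smooth A g -> smooth A (fun y => det2 (f y) (g y)).
Proof.
move=> oA sf sg.
have sf1 := smooth_fst oA sf; have sg1 := smooth_fst oA sg.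
apply: smooth_add => //; last apply: smooth_opp => //; apply: smooth_mul => //;
  by [exact: smooth_snd | exact: smooth_snd].
Qed.

Theorem straightening : det2 (e1 p0) (e2 p0) != 0 -> exists A phi,
  [/\ A !=set0, A `<=` D, equivalence_transformation A phi &
   forall p, A p ->
   [/\ 'D_(e1 p) phi p = A49_normal_form q 0 (phi p),
       'D_(e2 p) phi p = A49_normal_form q 1 (phi p),
       'D_(e3 p) phi p = A49_normal_form q 2%:R (phi p) &
       'D_(e4 p) phi p = A49_normal_form q 3%:R (phi p)]].
Proof.
move=> dn0.
have [C1 C10 H1] := derive_bounded oD pr1.1 Dp0.
have [C2 C20 H2] := derive_bounded oD pr2.1 Dp0.
have [C4 C40 H4] := derive_bounded oD pr4.1 Dp0.
have nD := nbhs_open oD Dp0.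
have /nbhs_ballP[rho /= rho0 rhoP] : \forall p \near p0, D p /\
    ((forall v, `|'D_v e1 p| <= C1 * `|v|) /\ ((forall v, `|'D_v e2 p| <= C2 * `|v|) /\
      (forall v, `|'D_v e4 p| <= C4 * `|v|))).
  apply: filterI; first exact: nD.
  by apply: filterI => //; exact: filterI.
have [r r0 [sPsi dom2 dom1 PsiN]] := Psi_domain (ball_open p0 rho) (ballxx p0 rho0).
pose C := C1 + C2 + C4.
have C0 : 0 <= C by rewrite !addr_ge0.
have PsiD y : ball y0 r y -> D (Psi y) by move=> /PsiN/rhoP[].
have bd1 y v : ball y0 r y -> `|'D_v e1 (Psi y)| <= C * `|v|.
  move=> /PsiN/rhoP[_ [h _]]; rewrite (le_trans (h v)) // ler_wpM2r // /C.
  by rewrite -addrA lerDl addr_ge0.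
have bd2 y v : ball y0 r y -> `|'D_v e2 (Psi y)| <= C * `|v|.
  move=> /PsiN/rhoP[_ [_ [h _]]]; rewrite (le_trans (h v)) // ler_wpM2r // /C.
  by rewrite addrAC lerDr addr_ge0.
have bd4 y v : ball y0 r y -> `|'D_v e4 (Psi y)| <= C * `|v|.
  move=> /PsiN/rhoP[_ [_ [_ h]]]; rewrite (le_trans (h v)) // ler_wpM2r // /C.
  by rewrite lerDr addr_ge0.
have oBr : open (ball y0 r) by exact: ball_open.
have By0 : ball y0 r y0 by exact: ballxx.
have dx y : ball y0 r y -> is_derive y dirx Psi (e1 (Psi y)).
  by move=> By; exact: (Psi_dx dom1 By).
have du y : ball y0 r y -> is_derive y diru Psi (e2 (Psi y)).
  by move=> By; exact: (Psi_du C0 sPsi dom2 dom1 PsiD bd1 By).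
have Psi3 := Psi_e3 C0 sPsi dom2 dom1 PsiD bd1 bd2 bd4.
have Psi4 := Psi_e4 C0 sPsi dom2 dom1 PsiD bd1 bd2 bd4.
have Psi0 : Psi y0 = p0.
  rewrite (Psi_curve dom2 dom1 By0) /scurve /stime subrr.
  by have [_ _ _ -> //] := fl4.
pose T y : R := ('D_dirt Psi y).1.1.
pose dt y : R := det2 (e1 (Psi y)) (e2 (Psi y)).
have se1 : smooth (ball y0 r) (fun y => e1 (Psi y)) by exact: (smooth_comp oBr oD PsiD sPsi pr1.1).
have se2 : smooth (ball y0 r) (fun y => e2 (Psi y)) by exact: (smooth_comp oBr oD PsiD sPsi pr2.1).
have sdP : smooth (ball y0 r) (fun y => 'D_dirt Psi y) by exact: smooth_derive.
have sT : smooth (ball y0 r) T by do 2 apply: smooth_fst => //.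
have sdt : smooth (ball y0 r) dt by exact: smooth_det2.
(* The derivative of [Psi] is block triangular, with [T] in the time direction and e1, e2 in the
   vertical ones; it is invertible where [T y * dt y] is nonzero. *)
have oO : open [set y | ball y0 r y /\ T y * dt y != 0].
  have sTd : smooth (ball y0 r) (fun y => T y * dt y) by exact: smooth_mul.
  exact: (open_preim oBr sTd open_neq0).
have O0 : ball y0 r y0 /\ T y0 * dt y0 != 0.
  split => //; rewrite /dt Psi0 mulf_neq0 // /T.
  have [_ ->] := Psi_dt_curve dom2 dom1 By0; rewrite Psi0 /=.
  rewrite mulf_neq0 // ?oppr_eq0 ?invr_eq0 ?onesqr_neq0 //.
  exact: (realization_transversal oD pr1 pr2 pr3 pr4 rel12 rel13 rel23 rel14 rel24 rel34 Dp0 dn0).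
have /nbhs_ballP[r' /= r'0 rP] := nbhs_open oO O0.
pose B' := ball y0 r'.
have oB' : open B' by exact: ball_open.
have B'B y : B' y -> ball y0 r y by move=> /rP[].
have Tn0 y : B' y -> T y != 0 by move=> /rP[_]; rewrite mulf_eq0 => /norP[].
have dtn0 y : B' y -> dt y != 0 by move=> /rP[_]; rewrite mulf_eq0 => /norP[].
have vert y : B' y -> (e1 (Psi y)).1.1 = 0 /\ (e2 (Psi y)).1.1 = 0.
  move=> /B'B/PsiD DPy.
  by have [] := realization_vertical oD pr1 pr2 pr3 pr4 rel12 rel13 rel23 rel14 rel24 rel34 DPy.
have DPsi y (v : P) : B' y -> 'D_v Psi y = v.1.1 *: 'D_dirt Psi y +
    (v.1.2 *: e1 (Psi y) + v.2 *: e2 (Psi y)).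
  move=> /B'B By; have dPs : differentiable Psi y by exact: (smooth_differentiable oBr sPsi By).
  have [_ <-] := dx y By; have [_ <-] := du y By.
  have {1}-> : v = v.1.1 *: dirt + (v.1.2 *: dirx + v.2 *: diru).
    by apply: triple_eq; rewrite /= /GRing.scale /=; ring.
  by rewrite !(derive_dirD _ _ dPs) !(derive_dirZ _ _ dPs).
(* The inverse of the derivative of [Psi]: the time component of [v] fixes the first entry, and the
   vertical remainder [W] is expanded in e1 and e2 by Cramer's rule. *)
pose W (y v : P) : P := v - (v.1.1 / T y) *: 'D_dirt Psi y.
pose S (y v : P) : P := (v.1.1 / T y, det2 (W y v) (e2 (Psi y)) / dt y,
   det2 (e1 (Psi y)) (W y v) / dt y).
have sub' (X : normedModType R) (f : P -> X) : smooth (ball y0 r) f -> smooth B' f.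
  exact: smooth_sub.
have sS v : smooth B' (fun y => S y v).
  have s1 : smooth B' (fun y => v.1.1 / T y).
    apply: smooth_mul => //; first exact: smooth_cst.
    by apply: smooth_inv => //; exact: sub'.
  have sW : smooth B' (fun y => W y v).
    apply: smooth_add => //; first exact: smooth_cst.
    by apply: smooth_opp => //; apply: smooth_scale => //; exact: sub'.
  have sid : smooth B' (fun y => (dt y)^-1) by apply: smooth_inv => //; exact: sub'.
  apply: smooth_pair => //; first apply: smooth_pair => //.
    by apply: smooth_mul => //; apply: smooth_det2 => //; exact: sub'.
  by apply: smooth_mul => //; apply: smooth_det2 => //; exact: sub'.
have DS y v : B' y -> 'D_(S y v) Psi y = v.
  move=> By; rewrite (DPsi _ _ By) /=; have [v1 v2] := vert y By.
  have vW : (W y v).1.1 = 0.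
    by rewrite /W /= -[X in _ - X]/(v.1.1 / T y * T y) divfK ?subrr // Tn0.
  by rewrite -(det2_basis v1 v2 vW (dtn0 y By)) addrC subrK.
have SD y v : B' y -> S y ('D_v Psi y) = v.
  move=> By; have [v1 v2] := vert y By.
  have t1 : ('D_v Psi y).1.1 = v.1.1 * T y.
    rewrite (DPsi _ _ By) /= -[X in X + _]/(v.1.1 * T y).
    rewrite -[X in _ + (X + _)]/(v.1.2 * (e1 (Psi y)).1.1).
    by rewrite -[X in _ + (_ + X)]/(v.2 * (e2 (Psi y)).1.1) v1 v2 !mulr0 !addr0.
  have t2 : W y ('D_v Psi y) = v.1.2 *: e1 (Psi y) + v.2 *: e2 (Psi y).
    by rewrite /W t1 mulfK ?Tn0 // (DPsi _ _ By) addrAC subrr add0r.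
  have dn := dtn0 y By.
  apply: triple_eq; rewrite /S /=; first by rewrite t1 mulfK // Tn0.
    rewrite t2; apply: (mulIf dn); rewrite divfK // /dt.
    move: (e1 (Psi y)) (e2 (Psi y)) => E1 E2.
    by rewrite /det2 /= /GRing.scale /=; ring.
  rewrite t2; apply: (mulIf dn); rewrite divfK // /dt.
  move: (e1 (Psi y)) (e2 (Psi y)) => E1 E2.
  by rewrite /det2 /= /GRing.scale /=; ring.
have [A' [g [oA' A'0 A'B' oim [sg gK]]]] :=
  @inverse_function _ _ _ B' Psi y0 S oB' (sub' _ _ sPsi) (ballxx y0 r'0) sS
   (fun y v By => DS y v By) (fun y v By => SD y v By).
have dPs y : A' y -> differentiable Psi y.
  by move=> /A'B'/B'B By; exact: (smooth_differentiable oBr sPsi By).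
have dg p : (Psi @` A') p -> differentiable g p.
  by move=> Ap; exact: (smooth_differentiable oim sg Ap).
have Dg y w : A' y -> 'D_('D_w Psi y) g (Psi y) = w.
  move=> Ay; have dgy : differentiable g (Psi y) by apply: dg; exists y.
  have [_ <-] := is_derive_comp (differentiable_is_derive w (dPs y Ay)) dgy.
  rewrite -[RHS](derive_id y w); apply: near_eq_derive.
  by apply: filterS (open_nbhs_nbhs (conj oA' Ay)) => z /gK.
pose phi p := chart (g p).
have Dphi y w : A' y -> 'D_('D_w Psi y) phi (Psi y) = 'D_w chart y.
  move=> Ay; have dgy : differentiable g (Psi y) by apply: dg; exists y.
  have dch : differentiable chart (g (Psi y)).
    exact: (smooth_differentiable openT (smooth_chart openT)).
  have [_ e] := is_derive_comp (differentiable_is_derive ('D_w Psi y) dgy) dch.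
  by apply: (etrans e); rewrite (Dg _ _ Ay) gK.
have phi_im : phi @` (Psi @` A') = [set n | setT n /\ A' (unchart n)].
  apply/seteqP; split=> [n [_ [y Ay <-] <-]|n [_ An]] /=.
    by rewrite /phi gK // chartK.
  exists (Psi (unchart n)); first by exists (unchart n).
  by rewrite /phi gK // unchartK.
have oim2 : open (phi @` (Psi @` A')).
  by rewrite phi_im; apply: open_preim => //; [exact: openT | exact: smooth_unchart openT].
exists (Psi @` A'), phi; split.
- by exists (Psi y0); exists y0.
- by move=> _ [y /A'B'/B'B/PsiD ? <-].
- split => //.
  + apply: (smooth_comp (B := setT) oim openT _ sg) => //; exact: smooth_chart openT.
  (* The new time as a function of the old one. It is well defined because the difference of two old
     times is the nonzero value of [T] at an intermediate point times the difference of the new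
     times. *)
  + exists (fun t => xget 0 [set s | exists2 y, A' y & y.1.1 = s /\ (Psi y).1.1 = t]).
    move=> t x u [y Ay e]; rewrite -e /phi gK //=.
    case: xgetP => [s _ [y' Ay' [<- e']]|/(_ y.1.1)]; last by case; exists y; rewrite ?e.
    have {}e' : (Psi y').1.1 = (Psi y).1.1 by rewrite e' e.
    have seg (c : R) : 0 <= c <= 1 -> B' (y + c *: (y' - y)).
      by move=> cI; apply: ball_segment => //; exact: A'B'.
    have dP (z w : P) : B' z -> is_derive z w (fun z => (Psi z).1.1) (w.1.1 * T z).
      move=> Bz; have [v1 v2] := vert z Bz.
      have dz : differentiable Psi z by exact: (smooth_differentiable oBr sPsi (B'B _ Bz)).
      apply: (is_derive_eq (is_derive_fst (is_derive_fst (differentiable_is_derive w dz)))).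
      rewrite (DPsi _ _ Bz) /= -[X in X + _]/(w.1.1 * T z).
      rewrite -[X in _ + (X + _)]/(w.1.2 * (e1 (Psi z)).1.1).
      by rewrite -[X in _ + (_ + X)]/(w.2 * (e2 (Psi z)).1.1) v1 v2 !mulr0 !addr0.
    have [c cI|c c01] := @MVT_dir R _ (fun z => (Psi z).1.1) y (y' - y).
      by have [] := dP _ (y' - y) (seg c cI).
    have cI : 0 <= c <= 1 by case/andP: c01 => *; rewrite !ltW.
    have [_ ->] := dP _ (y' - y) (seg c cI).
    have E : y + (y' - y) = y' by rewrite addrC subrK.
    rewrite E e' subrr => /esym/eqP.
    by rewrite mulf_eq0 (negbTE (Tn0 _ (seg c cI))) orbF subr_eq0 => /eqP.
  + exists (fun n => Psi (unchart n)); split => //.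
      apply: (smooth_comp oim2 oB' _ (smooth_unchart oim2)); last exact: sub'.
      by rewrite phi_im => n [_ /A'B'].
    by move=> _ [y Ay <-]; rewrite /phi gK // chartK.
move=> _ [y Ay <-]; have By := A'B' y Ay; have Bry := B'B y By.
have phiy : phi (Psi y) = (y.1.1, y.1.2 + xprofile y.1.1, y.2 + uprofile y.1.1).
  by rewrite /phi gK.
have tn0 := onesqr_neq0 y.1.1.
rewrite phiy; split.
- have [_ <-] := dx y Bry; rewrite (Dphi _ _ Ay); have [_ ->] := is_derive_chart y dirx.
  by apply: triple_eq; rewrite /=; ring.
- have [_ <-] := du y Bry; rewrite (Dphi _ _ Ay); have [_ ->] := is_derive_chart y diru.
  by apply: triple_eq; rewrite /=; ring.
- have -> : e3 (Psi y) = 'D_((0, y.2 + uprofile y.1.1, y.1.1) : P) Psi y.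
    by rewrite (DPsi _ _ By) scale0r add0r; exact: Psi3.
  rewrite (Dphi _ _ Ay).
  have [_ ->] := is_derive_chart y ((0, y.2 + uprofile y.1.1, y.1.1) : P).
  by apply: triple_eq; rewrite /=; ring.
have -> : e4 (Psi y) = 'D_((- (1 + y.1.1 ^+ 2),
    2 * q * y.1.2 - y.2 * uprofile y.1.1 - y.2 ^+ 2 / 2, (q - y.1.1) * y.2) : P) Psi y.
  by rewrite (DPsi _ _ By); exact: Psi4.
rewrite (Dphi _ _ Ay); have [_ ->] := is_derive_chart y ((- (1 + y.1.1 ^+ 2),
    2 * q * y.1.2 - y.2 * uprofile y.1.1 - y.2 ^+ 2 / 2, (q - y.1.1) * y.2) : P).
by apply: triple_eq; rewrite /=; field.
Qed.

End Straightening.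


Lemma I4_cases (i : 'I_4) : [\/ i = 0, i = 1, i = 2%:R | i = 3%:R].
Proof.
case: i => [[|[|[|[|//]]]] Hi]; [constructor 1|constructor 2|constructor 3|constructor 4];
  exact: val_inj.
Qed.

Section Classification.
Context {R : realType} (q : R).
Local Notation P := (R * R * R)%type.

Lemma A49_classification (D : set P) (e : 'I_4 -> @vfield R) :
  A49_realization q D e -> non_linearizing D e ->
  equivalent D e setT (A49_normal_form q).
Proof.
move=> [oD pr li rel] [E [bE sym _]].
have rel12 p : D p -> 'D_(e 0 p) (e 1) p = 'D_(e 1 p) (e 0) p.
  by move=> /rel[[/eqP + _ _] _]; rewrite subr_eq0 => /eqP.
have rel13 p : D p -> 'D_(e 0 p) (e 2%:R) p = 'D_(e 2%:R p) (e 0) p.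
  by move=> /rel[[_ /eqP + _] _]; rewrite subr_eq0 => /eqP.
have rel23 p : D p -> 'D_(e 1 p) (e 2%:R) p = 'D_(e 2%:R p) (e 1) p + e 0 p.
  by move=> /rel[[_ _ /eqP +] _]; rewrite subr_eq addrC => /eqP.
have rel14 p : D p -> 'D_(e 0 p) (e 3%:R) p = 'D_(e 3%:R p) (e 0) p + (2 * q) *: e 0 p.
  by move=> /rel[_ [/eqP + _ _]]; rewrite subr_eq addrC => /eqP.
have rel24 p : D p -> 'D_(e 1 p) (e 3%:R) p = 'D_(e 3%:R p) (e 1) p + (q *: e 1 p - e 2%:R p).
  by move=> /rel[_ [_ /eqP + _]]; rewrite subr_eq addrC => /eqP.
have rel34 p : D p -> 'D_(e 2%:R p) (e 3%:R) p = 'D_(e 3%:R p) (e 2%:R) p + (e 1 p + q *: e 2%:R p).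
  by move=> /rel[_ [_ _ /eqP +]]; rewrite subr_eq addrC => /eqP.
have ex1 : exists2 p, D p & e 0 p != 0.
  apply: contrapT => H.
  have /li/(_ 0) /eqP : forall p, D p -> \sum_i (if i == 0 then 1 else 0 : R) *: e i p = 0.
    move=> p Dp; rewrite (bigD1 0) //= big1 => [|i /negbTE ->]; last by rewrite scale0r.
    rewrite addr0 scale1r; apply: contrapT => /eqP e0; apply: H; by exists p.
  by rewrite eqxx oner_eq0.
have [p0 Dp0 dn0] := realization_rank2 oD (pr 0) (pr 1) (pr 2%:R) (pr 3%:R)
  rel12 rel13 rel23 rel14 rel24 rel34 ex1.
have [v1 v2 v3] := realization_vertical oD (pr 0) (pr 1) (pr 2%:R) (pr 3%:R)
  rel12 rel13 rel23 rel14 rel24 rel34 Dp0.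
(* Cramer's coefficients of the third field at [p0] serve as [u0] and [t0]. *)
have e3p0 := det2_basis v1 v2 v3 dn0.
have flow i : exists d A f, local_flow D (e i) d A f /\ A p0.
  have bp0 : base_dom E p0 by rewrite bE.
  by have [d [A [f [fl Ap _]]]] := sym i p0 bp0; exists d, A, f; rewrite -bE.
have [d1 [A1 [f1 [fl1 A1p]]]] := flow 0.
have [d2 [A2 [f2 [fl2 A2p]]]] := flow 1.
have [d4 [A4 [f4 [fl4 A4p]]]] := flow 3%:R.
have [A [phi [A0 AD equiv Dphi]]] := straightening oD (pr 0) (pr 1) (pr 2%:R) (pr 3%:R)
  rel12 rel13 rel23 rel14 rel24 rel34 Dp0 e3p0 fl1 fl2 fl4 A1p A2p A4p dn0.
exists A, phi; split => //.
have [oA sphi _ _] := equiv.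
(* Every field goes to its namesake, so the spans correspond with equal coefficients. *)
have lin (k : 'I_4 -> R) p : A p ->
    'D_(\sum_i k i *: e i p) phi p = \sum_i k i *: A49_normal_form q i (phi p).
  move=> Ap; have dphi : differentiable phi p by exact: (smooth_differentiable oA sphi Ap).
  rewrite deriveE // linear_sum; apply: eq_bigr => i _.
  rewrite linearZ -deriveE //; congr (_ *: _).
  have [h0 h1 h2 h3] := Dphi p Ap.
  by case: (I4_cases i) => ->.
by split=> k; exists k => p; exact: lin.
Qed.

End Classification.


(** * An equation admitting the normal form *)

Section Jets.
Context {R : realType}.
Local Notation P2 := (R * R)%type.
Local Notation dirx := ((0, 1) : P2).
Local Notation dirt := ((1, 0) : P2).

Lemma is_derive_on_eq {V W : normedModType R} (U : set V) (a b : V -> W) z v da db :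
  open U -> U z -> (forall z, U z -> a z = b z) ->
  is_derive z v a da -> is_derive z v b db -> da = db.
Proof.
move=> oU Uz ab [_ <-] [_ <-]; apply: near_eq_derive.
by apply: filterS (nbhs_open oU Uz) => y /ab.
Qed.

Lemma smooth_Dx (U : set P2) (f : P2 -> R) : smooth U f -> smooth U (Dx f).
Proof. exact: smooth_derive. Qed.

Lemma smooth_is_derive_x (U : set P2) (f : P2 -> R) z : open U -> smooth U f -> U z ->
  is_derive z dirx f (Dx f z).
Proof. by move=> oU sf Uz; exact: (smooth_is_derive _ oU sf Uz). Qed.

Lemma smooth_is_derive_t (U : set P2) (f : P2 -> R) z : open U -> smooth U f -> U z ->
  is_derive z dirt f (Dt f z).
Proof. by move=> oU sf Uz; exact: (smooth_is_derive _ oU sf Uz). Qed.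

Section ChainJets.
Context (U V : set P2) (F h1 h2 k : P2 -> R).
Context (oU : open U) (oV : open V) (sF : smooth V F) (sh1 : smooth U h1) (sh2 : smooth U h2)
  (sk : smooth U k) (UV : forall z, U z -> V (h1 z, h2 z)) (h1x : forall z, U z -> Dx h1 z = 0).

(** As [h1] does not depend on x, x-derivatives of the composite involve x-derivatives of [f] only,
    so the x-jets transform among themselves. *)
Lemma is_derive_chain_x (f : P2 -> R) z : smooth V f -> U z ->
  is_derive z dirx (fun z => f (h1 z, h2 z)) (Dx f (h1 z, h2 z) * Dx h2 z).
Proof.
move=> sf Uz; have df : differentiable f (h1 z, h2 z).
  exact: (smooth_differentiable oV sf (UV Uz)).
have dh := is_derive_pair (smooth_is_derive_x oU sh1 Uz) (smooth_is_derive_x oU sh2 Uz).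
apply: (is_derive_eq (is_derive_comp dh df)).
have -> : (Dx h1 z, Dx h2 z) = Dx h2 z *: dirx.
  by rewrite h1x //; congr pair; rewrite /= /GRing.scale /= ?mulr0 ?mulr1.
by rewrite (derive_dirZ _ _ df) mulrC.
Qed.

Lemma is_derive_chain_t (f : P2 -> R) z : smooth V f -> U z ->
  is_derive z dirt (fun z => f (h1 z, h2 z))
    (Dt f (h1 z, h2 z) * Dt h1 z + Dx f (h1 z, h2 z) * Dt h2 z).
Proof.
move=> sf Uz; have df : differentiable f (h1 z, h2 z).
  exact: (smooth_differentiable oV sf (UV Uz)).
have dh := is_derive_pair (smooth_is_derive_t oU sh1 Uz) (smooth_is_derive_t oU sh2 Uz).
apply: (is_derive_eq (is_derive_comp dh df)).
have -> : (Dt h1 z, Dt h2 z) = Dt h1 z *: dirt + Dt h2 z *: dirx.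
  by congr pair; rewrite /= /GRing.scale /= ?mulr0 ?mulr1 ?addr0 ?add0r.
by rewrite (derive_dirD _ _ df) !(derive_dirZ _ _ df); congr (_ + _); exact: mulrC.
Qed.

Context (Fk : forall z, U z -> F (h1 z, h2 z) = k z).
Local Notation H z := (h1 z, h2 z).

Lemma chain_jet_t z : U z -> Dt F (H z) * Dt h1 z + Dx F (H z) * Dt h2 z = Dt k z.
Proof.
move=> Uz; apply: (is_derive_on_eq oU Uz Fk (is_derive_chain_t sF Uz)).
exact: (smooth_is_derive_t oU sk Uz).
Qed.

Lemma chain_jet1 z : U z -> Dx F (H z) * Dx h2 z = Dx k z.
Proof.
move=> Uz; apply: (is_derive_on_eq oU Uz Fk (is_derive_chain_x sF Uz)).
exact: (smooth_is_derive_x oU sk Uz).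
Qed.

Let sF1 : smooth V (Dx F) := smooth_Dx sF.
Let sF2 : smooth V (Dx (Dx F)) := smooth_Dx sF1.
Let sh21 : smooth U (Dx h2) := smooth_Dx sh2.
Let sh22 : smooth U (Dx (Dx h2)) := smooth_Dx sh21.

Lemma chain_jet2 z : U z ->
  Dx (Dx F) (H z) * Dx h2 z ^+ 2 + Dx F (H z) * Dx (Dx h2) z = Dx (Dx k) z.
Proof.
move=> Uz.
have d := is_derive_mul (is_derive_chain_x sF1 Uz) (smooth_is_derive_x oU sh21 Uz).
have e := is_derive_on_eq oU Uz chain_jet1 d (smooth_is_derive_x oU (smooth_Dx sk) Uz).
have alg (a b x y : R) : a * x ^+ 2 + b * y = b * y + x * (a * x) by ring.
exact: etrans (alg _ _ _ _) e.
Qed.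

Lemma chain_jet3 z : U z ->
  Dx (Dx (Dx F)) (H z) * Dx h2 z ^+ 3 + 3 * Dx (Dx F) (H z) * Dx h2 z * Dx (Dx h2) z +
  Dx F (H z) * Dx (Dx (Dx h2)) z = Dx (Dx (Dx k)) z.
Proof.
move=> Uz.
have dh := smooth_is_derive_x oU sh21 Uz.
have d1 := is_derive_mul (is_derive_chain_x sF2 Uz) (is_derive_mul dh dh).
have d2 := is_derive_mul (is_derive_chain_x sF1 Uz) (smooth_is_derive_x oU sh22 Uz).
have d := is_derive_add d1 d2.
have E y : U y -> Dx (Dx F) (H y) * (Dx h2 y * Dx h2 y) + Dx F (H y) * Dx (Dx h2) y =
    Dx (Dx k) y by move=> Uy; rewrite -expr2; exact: chain_jet2.
have e := is_derive_on_eq oU Uz E d (smooth_is_derive_x oU (smooth_Dx (smooth_Dx sk)) Uz).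
have alg (a b c x y w : R) : a * x ^+ 3 + 3 * b * x * y + c * w =
    (b * (x * y + x * y) + x * x * (a * x)) + (c * w + y * (b * x)) by ring.
exact: etrans (alg _ _ _ _ _ _) e.
Qed.

End ChainJets.

End Jets.


Section NormalFormEquation.
Context {R : realType} (q : R).
Local Notation P := (R * R * R)%type.
Local Notation P2 := (R * R)%type.
Local Notation J := (R * R * R * R * R)%type.

(** For the inverse function x = v(t, u) one has v_u = 1 / u1 and v_uu = - u2 / u1^3, so [omega] is
    u1^3 (t - (1 + t^2) v_uu). Its quotient by u1^3 is invariant under all four flows. *)
Definition omega (j : J) : R := (1 + j.1.1.1.1 ^+ 2) * j.2 + j.1.1.1.1 * j.1.2 ^+ 3.

Definition nf_dom : set J := [set j | j.1.2 != 0 /\ omega j != 0].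

Definition nfF (j : J) : R := mfun (3 * q) j.1.1.1.1 * omega j / j.1.2 ^+ 6.

(** In the variable v the equation is v_t = m (omega / u1^3) v_uuu - v_u^2 / 2. Substituting v_uuu =
    - u3 / u1^4 + 3 u2^2 / u1^5 produces both terms. *)
Definition nfG (j : J) : R :=
  (2 * j.1.2)^-1 - 3 * mfun (3 * q) j.1.1.1.1 * omega j * j.2 ^+ 2 / j.1.2 ^+ 7.

Lemma smooth_jet_coord (A : set J) : open A ->
  [/\ smooth A (fun j : J => j.1.1.1.1), smooth A (fun j : J => j.1.2) &
      smooth A (fun j : J => j.2)].
Proof.
move=> oA; have s0 : smooth A (fun j : J => j) by exact: smooth_id.
have [s1 s2 s3] := smooth_coords oA s0.
by split=> //; exact: smooth_fst oA (smooth_fst oA s1).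
Qed.

Lemma smooth_omega (A : set J) : open A -> smooth A omega.
Proof.
move=> oA; have [st s1 s2] := smooth_jet_coord oA.
apply: smooth_add => //; apply: smooth_mul => //; last exact: smooth_exp.
by apply: smooth_add => //; [exact: smooth_cst | exact: smooth_exp].
Qed.

Lemma nf_dom_open : open nf_dom.
Proof.
have [st s1 s2] := smooth_jet_coord (@openT J).
have o1 := open_preim openT s1 open_neq0.
have sw : smooth [set j : J | setT j /\ j.1.2 != 0] omega by exact: smooth_omega.
have o2 := open_preim o1 sw open_neq0.
rewrite (_ : nf_dom = [set y | [set j : J | setT j /\ j.1.2 != 0] y /\ omega y != 0]) //.
by apply/seteqP; split=> j /= [] => [a b|[_ a] b].
Qed.

Lemma nf_dom_base (p : P) : exists u1 u2 : R, nf_dom (p, u1, u2).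
Proof.
(* This value of u2 makes [omega] equal to 1. *)
exists 1, ((1 - p.1.1) / (1 + p.1.1 ^+ 2)); split; rewrite /= ?oner_neq0 //.
rewrite /omega /= mulrC divfK ?onesqr_neq0 // expr1n mulr1 subrK oner_neq0.
by [].
Qed.

Lemma nf_dom_neq0 : nf_dom !=set0.
Proof. by have [u1 [u2 H]] := nf_dom_base 0; exists (0, u1, u2). Qed.

Lemma smooth_mfun_jet k (A : set J) : open A -> smooth A (fun j : J => mfun k j.1.1.1.1).
Proof.
move=> oA; have [st _ _] := smooth_jet_coord oA.
apply: (smooth_comp (B := [set: R]) (h := fun j : J => j.1.1.1.1)) => //; first exact: openT.
by apply: smooth_mfun; exact: openT.
Qed.

Lemma nfF_smooth : smooth nf_dom nfF.
Proof.
have oA := nf_dom_open; have [st s1 s2] := smooth_jet_coord oA.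
apply: smooth_mul => //.
  by apply: smooth_mul => //; [exact: smooth_mfun_jet | exact: smooth_omega].
apply: smooth_inv => //; last exact: smooth_exp.
by move=> j [u1 _]; rewrite expf_neq0.
Qed.

Lemma nfG_smooth : smooth nf_dom nfG.
Proof.
have oA := nf_dom_open; have [st s1 s2] := smooth_jet_coord oA.
apply: smooth_add => //.
  apply: smooth_inv => //; first by move=> j [u1 _]; rewrite mulf_neq0 // pnatr_eq0.
  by apply: smooth_mul => //; exact: smooth_cst.
apply: smooth_opp => //; apply: smooth_mul => //.
  apply: smooth_mul => //; last exact: smooth_exp.
  apply: smooth_mul => //; last exact: smooth_omega.
  by apply: smooth_mul => //; [exact: smooth_cst | exact: smooth_mfun_jet].
apply: smooth_inv => //; last exact: smooth_exp.
by move=> j [u1 _]; rewrite expf_neq0.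
Qed.

Lemma nfF_neq0 j : nf_dom j -> nfF j != 0.
Proof.
move=> [u1 w]; rewrite /nfF !mulf_neq0 ?invr_eq0 ?expf_neq0 //.
by rewrite gt_eqF // mfun_gt0.
Qed.

Definition nf_eq : evolution_eq :=
  EvolutionEq nf_dom_open nf_dom_neq0 nfF_smooth nfG_smooth nfF_neq0.

Lemma nf_eq_base : base_dom nf_eq = setT.
Proof. by apply/seteqP; split=> // p _; exact: nf_dom_base. Qed.

(* Here f solves the equation and f (T, K x + C g^2 + S g + E) = A g + B, with
   a = 2 C g + S; numbers denote x-derivatives of f at the old point and of g
   at the new one. *)
Lemma transform_algebra (t T A K C a g1 g2 g3 gt f1 f2 f3 ft m : R) :
  A != 0 -> K != 0 -> f1 != 0 -> (1 + T ^+ 2) * f2 + T * f1 ^+ 3 != 0 ->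
  f1 * (K + a * g1) = A * g1 ->
  f2 * (K + a * g1) ^+ 2 + f1 * (2 * C * g1 ^+ 2 + a * g2) = A * g2 ->
  f3 * (K + a * g1) ^+ 3 + 3 * f2 * (K + a * g1) * (2 * C * g1 ^+ 2 + a * g2) +
    f1 * (6 * C * g1 * g2 + a * g3) = A * g3 ->
  ft * (A ^+ 2 / K) + f1 * (a ^+ 2 / (2 * K) + a * gt) = A * a / K + A * gt ->
  (1 + T ^+ 2) * K = A ^+ 2 * (1 + t ^+ 2) ->
  2 * C * (1 + T ^+ 2) = A ^+ 2 * (T - t) ->
  ft = m * A * K * ((1 + T ^+ 2) * f2 + T * f1 ^+ 3) / f1 ^+ 6 * f3 +
    ((2 * f1)^-1 - 3 * (m * A * K) * ((1 + T ^+ 2) * f2 + T * f1 ^+ 3) * f2 ^+ 2 / f1 ^+ 7) ->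
  [/\ g1 != 0, (1 + t ^+ 2) * g2 + t * g1 ^+ 3 != 0 &
   gt = m * ((1 + t ^+ 2) * g2 + t * g1 ^+ 3) / g1 ^+ 6 * g3 +
    ((2 * g1)^-1 - 3 * m * ((1 + t ^+ 2) * g2 + t * g1 ^+ 3) * g2 ^+ 2 / g1 ^+ 7)].
Proof.
move=> A0 K0 f10 wf0 E1 E2 E3 Et R1 R2 Eq.
have g10 : g1 != 0.
  by apply: contra_neq f10 => g; move: E1; rewrite g !mulr0 addr0 => /eqP;
    rewrite mulf_eq0 (negbTE K0) orbF => /eqP.
set x := K + a * g1 in E1 E2 E3.
have x0 : x != 0.
  by apply: contraTneq g10 => x0; move: E1; rewrite x0 mulr0 => /esym/eqP;
    rewrite mulf_eq0 (negbTE A0) => /= ->.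
have aE : a = (x - K) / g1 by rewrite /x addrC addKr mulfK.
have F1 : f1 = A * g1 / x by rewrite -E1 mulfK.
have F2 : f2 = A * (K * g2 - 2 * C * g1 ^+ 3) / x ^+ 3.
  apply: (mulIf (expf_neq0 2 x0)).
  have -> : f2 * x ^+ 2 = A * g2 - f1 * (2 * C * g1 ^+ 2 + a * g2) by rewrite -E2 addrK.
  by rewrite F1 aE; field; rewrite g10 x0.
have F3 : f3 = A * ((K * g3 - 6 * C * g1 ^+ 2 * g2) * x
     - 3 * (K * g2 - 2 * C * g1 ^+ 3) * (2 * C * g1 ^+ 2 + a * g2)) / x ^+ 5.
  apply: (mulIf (expf_neq0 3 x0)).
  have -> : f3 * x ^+ 3 = A * g3 - f1 * (6 * C * g1 * g2 + a * g3)
      - 3 * f2 * x * (2 * C * g1 ^+ 2 + a * g2) by rewrite -E3; ring.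
  by rewrite F1 F2 aE; field; rewrite g10 x0.
set wf := (1 + T ^+ 2) * f2 + T * f1 ^+ 3 in wf0 Eq.
set wg := (1 + t ^+ 2) * g2 + t * g1 ^+ 3.
(* The relations [R1] and [R2] enter here. As [f1 = A * g1 / x], the identity says that the quotient
   of [omega] by the cube of the first derivative is invariant. *)
have W : wf = A ^+ 3 * wg / x ^+ 3.
  have -> : wf = A * ((1 + T ^+ 2) * K * g2 - (2 * C * (1 + T ^+ 2)) * g1 ^+ 3
      + T * A ^+ 2 * g1 ^+ 3) / x ^+ 3.
    by rewrite /wf F1 F2; field; rewrite x0.
  by rewrite R1 R2 /wg; field; rewrite x0.
have wg0 : wg != 0.
  by apply: contra_neq wf0 => w; rewrite W w mulr0 mul0r.
split => //.
have Ft : ft = (A * a / K + A * gt - f1 * (a ^+ 2 / (2 * K) + a * gt)) * K / A ^+ 2.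
  by rewrite -Et; field; rewrite A0 K0.
apply/eqP; rewrite -subr_eq0; apply/eqP.
(* The factor is the reciprocal of [K ^+ 2 / (A * x)], the coefficient with which [gt] enters
   [ft]. *)
transitivity ((A * x / K ^+ 2) * (ft - (m * A * K * wf / f1 ^+ 6 * f3 +
    ((2 * f1)^-1 - 3 * (m * A * K) * wf * f2 ^+ 2 / f1 ^+ 7)))).
  by rewrite Ft W F3 F2 F1 aE; field; rewrite g10 x0 A0 K0.
by rewrite -Eq subrr mulr0.
Qed.

End NormalFormEquation.


(** * Solutions under quadratic changes of variables *)

Section Transform.
Context {R : realType} (q : R).
Local Notation P2 := (R * R)%type.
Local Notation dirx := ((0, 1) : P2).
Local Notation dirt := ((1, 0) : P2).

(* The change of variables t = T(t'), x = K x' + C u'^2 + S u' + E, u = A u' + B,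
   where A, B, C, S, E are functions of t'. *)
Definition transform_data (I : set R) (K : R) (T A B C S E : R -> R) : Prop :=
  [/\ open I /\ K != 0, [/\ smooth I T, smooth I A & smooth I B],
     [/\ smooth I C, smooth I S & smooth I E],
     forall t, I t -> [/\ is_derive t (1 : R) T (A t ^+ 2 / K),
       is_derive t (1 : R) A (2 * C t * A t / K) & is_derive t (1 : R) B (S t * A t / K)] /\
       [/\ is_derive t (1 : R) C (2 * C t ^+ 2 / K),
       is_derive t (1 : R) S (2 * C t * S t / K) & is_derive t (1 : R) E (S t ^+ 2 / (2 * K))] &
     forall t, I t -> [/\ A t != 0, (1 + T t ^+ 2) * K = A t ^+ 2 * (1 + t ^+ 2),
       2 * C t * (1 + T t ^+ 2) = A t ^+ 2 * (T t - t) &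
       mfun (3 * q) (T t) = mfun (3 * q) t * A t * K]].

Lemma is_derive_time2 (c : R -> R) (w v : P2) dc : is_derive w.1 (1 : R) c dc ->
  is_derive w v (fun w : P2 => c w.1) (v.1 * dc).
Proof. exact: is_derive_comp1 (is_derive_fst (is_derive_id w v)). Qed.

(** Bridges [quadratic_jets] and [transform_algebra]. The terms [2 * 0 * g] occur because the affine
    expression for u is treated as a quadratic one with leading coefficient 0. *)
Lemma transform_point (t T A K C S g g1 g2 g3 gt f1 f2 f3 ft m mT x1 x2 x3 xt k1 k2 k3 kt ht : R) :
  A != 0 -> K != 0 -> f1 != 0 -> (1 + T ^+ 2) * f2 + T * f1 ^+ 3 != 0 ->
  x1 = K + (2 * C * g + S) * g1 -> x2 = 2 * C * g1 ^+ 2 + (2 * C * g + S) * g2 ->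
  x3 = 6 * C * g1 * g2 + (2 * C * g + S) * g3 ->
  xt = 2 * C ^+ 2 / K * g ^+ 2 + 2 * C * S / K * g + S ^+ 2 / (2 * K) + (2 * C * g + S) * gt ->
  k1 = 0 + (2 * 0 * g + A) * g1 -> k2 = 2 * 0 * g1 ^+ 2 + (2 * 0 * g + A) * g2 ->
  k3 = 6 * 0 * g1 * g2 + (2 * 0 * g + A) * g3 ->
  kt = 0 * g ^+ 2 + 2 * C * A / K * g + S * A / K + (2 * 0 * g + A) * gt ->
  ht = A ^+ 2 / K -> f1 * x1 = k1 -> f2 * x1 ^+ 2 + f1 * x2 = k2 ->
  f3 * x1 ^+ 3 + 3 * f2 * x1 * x2 + f1 * x3 = k3 -> ft * ht + f1 * xt = kt ->
  (1 + T ^+ 2) * K = A ^+ 2 * (1 + t ^+ 2) -> 2 * C * (1 + T ^+ 2) = A ^+ 2 * (T - t) ->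
  mT = m * A * K ->
  ft = mT * ((1 + T ^+ 2) * f2 + T * f1 ^+ 3) / f1 ^+ 6 * f3 +
    ((2 * f1)^-1 - 3 * mT * ((1 + T ^+ 2) * f2 + T * f1 ^+ 3) * f2 ^+ 2 / f1 ^+ 7) ->
  [/\ g1 != 0, (1 + t ^+ 2) * g2 + t * g1 ^+ 3 != 0 &
   gt = m * ((1 + t ^+ 2) * g2 + t * g1 ^+ 3) / g1 ^+ 6 * g3 +
    ((2 * g1)^-1 - 3 * m * ((1 + t ^+ 2) * g2 + t * g1 ^+ 3) * g2 ^+ 2 / g1 ^+ 7)].
Proof.
move=> A0 K0 f10 wf0 -> -> -> -> -> -> -> -> -> X1 X2 X3 Xt R1 R2 -> Eq.
apply: (@transform_algebra _ t T A K C (2 * C * g + S) g1 g2 g3 gt f1 f2 f3 ft m) => //.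
- by rewrite X1; ring.
- by rewrite X2; ring.
- by rewrite X3; ring.
have -> : A * (2 * C * g + S) / K + A * gt =
   ft * (A ^+ 2 / K) + f1 * (2 * C ^+ 2 / K * g ^+ 2 + 2 * C * S / K * g + S ^+ 2 / (2 * K)
     + (2 * C * g + S) * gt) by rewrite Xt; ring.
by field.
Qed.

Context (U' : set P2) (I : set R) (oU' : open U') (oI : open I) (UI : forall w, U' w -> I w.1).

Section Quadratic.
Context (g g1 g2 g3 gt : P2 -> R)
  (dg : forall w, U' w -> is_derive w dirx g (g1 w))
  (dg1 : forall w, U' w -> is_derive w dirx g1 (g2 w))
  (dg2 : forall w, U' w -> is_derive w dirx g2 (g3 w))
  (dgt : forall w, U' w -> is_derive w dirt g (gt w)).
Context (K : R) (a b c da db dc : R -> R)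
  (dera : forall t, I t -> is_derive t (1 : R) a (da t))
  (derb : forall t, I t -> is_derive t (1 : R) b (db t))
  (derc : forall t, I t -> is_derive t (1 : R) c (dc t)).

Let h (w : P2) : R := K * w.2 + (a w.1 * (g w * g w) + b w.1 * g w + c w.1).
Let s w := 2 * a w.1 * g w + b w.1.

Lemma quadratic_jets w : U' w ->
  [/\ Dx h w = K + s w * g1 w,
      Dx (Dx h) w = 2 * a w.1 * g1 w ^+ 2 + s w * g2 w,
      Dx (Dx (Dx h)) w = 6 * a w.1 * g1 w * g2 w + s w * g3 w &
      Dt h w = da w.1 * g w ^+ 2 + db w.1 * g w + dc w.1 + s w * gt w].
Proof.
move=> Uw0.
have dh v d w1 : U' w1 -> is_derive w1 v g d -> is_derive w1 v h (K * v.2 +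
    (v.1 * (da w1.1 * g w1 ^+ 2 + db w1.1 * g w1 + dc w1.1) + s w1 * d)).
  move=> Uw dgv; have Iw := UI Uw.
  have H0 := is_derive_mul (is_derive_cst K w1 v) (is_derive_snd (is_derive_id w1 v)).
  have H1 := is_derive_mul (is_derive_time2 v (dera Iw)) (is_derive_mul dgv dgv).
  have H2 := is_derive_mul (is_derive_time2 v (derb Iw)) dgv.
  have H := is_derive_add H0 (is_derive_add (is_derive_add H1 H2) (is_derive_time2 v (derc Iw))).
  by apply: (is_derive_eq H); rewrite /s /=; ring.
have E1 w1 : U' w1 -> Dx h w1 = K + s w1 * g1 w1.
  move=> Uw; have [_ E] := dh dirx _ _ Uw (dg Uw); apply: (etrans E) => /=.
  by ring.
have ds w1 : U' w1 -> is_derive w1 dirx s (2 * a w1.1 * g1 w1).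
  move=> Uw; have Iw := UI Uw.
  have H1 := is_derive_mul (is_derive_mul (is_derive_cst (2 : R) w1 dirx)
    (is_derive_time2 dirx (dera Iw))) (dg Uw).
  have H := is_derive_add H1 (is_derive_time2 dirx (derb Iw)).
  by apply: (is_derive_eq H); rewrite /=; ring.
have D2 w1 : U' w1 -> is_derive w1 dirx (Dx h) (2 * a w1.1 * g1 w1 ^+ 2 + s w1 * g2 w1).
  move=> Uw; have Iw := UI Uw.
  have H := is_derive_add (is_derive_cst K w1 dirx) (is_derive_mul (ds _ Uw) (dg1 Uw)).
  apply: (@near_eq_is_derive _ _ _ (fun w1 => K + s w1 * g1 w1)).
    by apply: filterS (open_nbhs_nbhs (conj oU' Uw)) => y /E1.
  by apply: (is_derive_eq H); ring.
have E2 w1 : U' w1 -> Dx (Dx h) w1 = 2 * a w1.1 * g1 w1 ^+ 2 + s w1 * g2 w1.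
  by move=> /D2[_ e].
have E3 w1 : U' w1 -> Dx (Dx (Dx h)) w1 = 6 * a w1.1 * g1 w1 * g2 w1 + s w1 * g3 w1.
  move=> Uw; have Iw := UI Uw.
  have H1 := is_derive_mul (is_derive_mul (is_derive_cst (2 : R) w1 dirx)
    (is_derive_time2 dirx (dera Iw))) (is_derive_mul (dg1 Uw) (dg1 Uw)).
  have H := is_derive_add H1 (is_derive_mul (ds _ Uw) (dg2 Uw)).
  have H' : is_derive w1 dirx (Dx (Dx h)) (6 * a w1.1 * g1 w1 * g2 w1 + s w1 * g3 w1).
    apply: (@near_eq_is_derive _ _ _ (fun w1 => 2 * a w1.1 * (g1 w1 * g1 w1) + s w1 * g2 w1)).
      by apply: filterS (open_nbhs_nbhs (conj oU' Uw)) => y /E2 ->; rewrite expr2.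
    by apply: (is_derive_eq H); rewrite /=; ring.
  by have [_ e] := H'.
split; [exact: E1 | exact: E2 | exact: E3 |].
have [_ E] := dh dirt _ _ Uw0 (dgt Uw0); apply: (etrans E) => /=.
by ring.
Qed.

End Quadratic.

Lemma smooth_quadratic (K : R) (a b c : R -> R) (g : P2 -> R) : smooth U' g ->
  smooth I a -> smooth I b -> smooth I c ->
  smooth U' (fun w : P2 => K * w.2 + (a w.1 * (g w * g w) + b w.1 * g w + c w.1)).
Proof.
move=> sg sa sb sc.
have st (d : R -> R) : smooth I d -> smooth U' (fun w : P2 => d w.1).
  move=> sd; apply: (smooth_comp oU' oI _ _ sd); first exact: UI.
  by apply: smooth_fst => //; exact: smooth_id.
apply: smooth_add => //.
  apply: smooth_mul => //; first exact: smooth_cst.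
  by apply: smooth_snd => //; exact: smooth_id.
apply: smooth_add => //; last exact: st.
by apply: smooth_add => //; apply: smooth_mul => //; try exact: st; exact: smooth_mul.
Qed.

(** The old variables are functions of the new ones, so [g] is given implicitly by an identity
    [f (h1, h2) = k]; differentiating it relates the two jets without differentiating an inverse
    map. *)
Lemma transform_solution (U : set P2) (f g : P2 -> R) (K : R) (T A B C S E : R -> R) :
  transform_data I K T A B C S E -> solution (nf_eq q) U f -> smooth U' g ->
  (forall w : P2, U' w -> let z := (T w.1, K * w.2 + (C w.1 * (g w * g w) + S w.1 * g w + E w.1)) in
     U z /\ f z = A w.1 * g w + B w.1) ->
  solution (nf_eq q) U' g.
Proof.
move=> [[_ K0] [sT sA sB] [sC sS sE] der rel] [oU sf fE] sg hU; split => // w Uw.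
have Iw := UI Uw.
pose h1 (w : P2) : R := T w.1.
pose h2 (w : P2) : R := K * w.2 + (C w.1 * (g w * g w) + S w.1 * g w + E w.1).
(* The affine expression [A * g + B] is written as a quadratic with vanishing coefficients so that
   [quadratic_jets] covers it too. *)
pose k (w : P2) : R := 0 * w.2 + ((fun=> 0) w.1 * (g w * g w) + A w.1 * g w + B w.1).
have sh1 : smooth U' h1.
  apply: (smooth_comp oU' oI _ _ sT); first exact: UI.
  by apply: smooth_fst => //; exact: smooth_id.
have sh2 : smooth U' h2 by exact: smooth_quadratic.
have s0 : smooth I (fun=> 0 : R) by exact: smooth_cst.
have sk : smooth U' k by exact: (@smooth_quadratic 0 (fun=> 0) A B).
have UV z : U' z -> U (h1 z, h2 z) by move=> /hU[].
have fk z : U' z -> f (h1 z, h2 z) = k z.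
  by move=> /hU[_ ->]; rewrite /k !mul0r !add0r.
have h1x z : U' z -> Dx h1 z = 0.
  move=> /UI Iz; have [[dT _ _] _] := der _ Iz.
  by have [_ e] := is_derive_time2 dirx dT; apply: (etrans e); exact: mul0r.
have h1t : Dt h1 w = A w.1 ^+ 2 / K.
  have [[dT _ _] _] := der _ Iw.
  by have [_ e] := is_derive_time2 dirt dT; apply: (etrans e); exact: mul1r.
have dgx z : U' z -> is_derive z dirx g (Dx g z) by exact: smooth_is_derive_x.
have dgx1 z : U' z -> is_derive z dirx (Dx g) (Dx (Dx g) z).
  by apply: smooth_is_derive_x => //; exact: smooth_Dx.
have dgx2 z : U' z -> is_derive z dirx (Dx (Dx g)) (Dx (Dx (Dx g)) z).
  by apply: smooth_is_derive_x => //; do 2 apply: smooth_Dx.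
have dgt z : U' z -> is_derive z dirt g (Dt g z) by exact: smooth_is_derive_t.
have dC t : I t -> is_derive t (1 : R) C (2 * C t ^+ 2 / K) by move=> /der[_ []].
have dS t : I t -> is_derive t (1 : R) S (2 * C t * S t / K) by move=> /der[_ []].
have dE t : I t -> is_derive t (1 : R) E (S t ^+ 2 / (2 * K)) by move=> /der[_ []].
have dA t : I t -> is_derive t (1 : R) A (2 * C t * A t / K) by move=> /der[[]].
have dB t : I t -> is_derive t (1 : R) B (S t * A t / K) by move=> /der[[]].
have d0 t : I t -> is_derive t (1 : R) (fun=> 0 : R) 0 by move=> _; exact: is_derive_cst.
have [Q1 Q2 Q3 Qt] := quadratic_jets dgx dgx1 dgx2 dgt K dC dS dE Uw.
have [L1 L2 L3 Lt] := quadratic_jets dgx dgx1 dgx2 dgt 0 d0 dA dB Uw.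
have X1 := chain_jet1 oU' oU sf sh1 sh2 sk UV h1x fk Uw.
have X2 := chain_jet2 oU' oU sf sh1 sh2 sk UV h1x fk Uw.
have X3 := chain_jet3 oU' oU sf sh1 sh2 sk UV h1x fk Uw.
have Xt := chain_jet_t oU' oU sf sh1 sh2 sk UV fk Uw.
have [[F10 wf0] Eq] := fE _ (UV _ Uw).
have [A0 R1 R2 R3] := rel _ Iw.
have [g10 wg0 e] := transform_point A0 K0 F10 wf0 Q1 Q2 Q3 Qt L1 L2 L3 Lt h1t X1 X2 X3 Xt R1 R2 R3 Eq.
by split; [split | ].
Qed.

End Transform.


(** * Symmetries of the equation *)

Section Symmetries.
Context {R : realType} (q : R).
Local Notation P := (R * R * R)%type.
Local Notation P2 := (R * R)%type.

(** A general element of the Heisenberg subalgebra, so that one proof covers the first three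
    fields. *)
Definition heis (c1 c2 c3 : R) (p : P) : P := (0, c1 + c3 * p.2, c2 + c3 * p.1.1).

Definition rot (p : P) : P :=
  (- (1 + p.1.1 ^+ 2), 2 * q * p.1.2 - p.2 ^+ 2 / 2, (q - p.1.1) * p.2).

(** The condition describes the point before the flow in terms of the point after it, which is the
    direction in which [transform_solution] works; the flows of [heis] and [rot] both have this
    quadratic form. *)
Lemma symmetry_criterion (Q : @vfield R) :
  (forall p0, exists d A fl, [/\ local_flow setT Q d A fl, A p0 &
    forall s, `|s| < d -> exists I K T A' B C S E, transform_data q I K T A' B C S E /\
      forall p, A p -> I (fl (s, p)).1.1 /\
        let t' := (fl (s, p)).1.1 in let u' := (fl (s, p)).2 in
        p = (T t', K * (fl (s, p)).1.2 + (C t' * (u' * u') + S t' * u' + E t'), A' t' * u' + B t')]) ->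
  symmetry (nf_eq q) Q.
Proof.
move=> H p0 _; have [d [A [fl [lf Ap0 fd]]]] := H p0.
exists d, A, fl; split => //; first by rewrite nf_eq_base.
have [d0 oA _ _ _] := lf.
move=> U f z0 sol Uz0 Az0; have [oU sf _] := sol.
have sgr : smooth U (fun z : P2 => (z, f z)) by apply: smooth_pair => //; exact: smooth_id.
(* The flow is controlled on [A], so only base points whose graph point lies in [A] are kept. *)
exists [set z | U z /\ A (z, f z)]; split => //.
- exact: open_preim oU sgr oA.
- by move=> z [].
have near_s : \forall s \near (0 : R), `|s| < d.
  by apply/nbhs_ballP; exists d => // s; rewrite -ball_normE /= sub0r normrN.
apply: filterS near_s => s sd U' g oU' sg car.
have [I [K [T [A' [B [C [S [E [td inv]]]]]]]]] := fd s sd.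
have [[oI _] _ _ _ _] := td.
have UI w : U' w -> I w.1.
  by move=> /car[z [_ Az] e]; have [] := inv _ Az; rewrite e.
apply: (transform_solution oU' oI UI td sol sg).
move=> w /car[z [Uz Az] e]; have [_] := inv _ Az; rewrite e /= => -[<- ->]; split => //.
Qed.

Lemma is_derive_id1 (t : R) : is_derive t (1 : R) (fun t : R => t) 1.
Proof. exact: is_derive_id. Qed.

Lemma heisenberg_transform (s0 b0 e0 : R) :
  transform_data q setT 1 (fun t => t) (fun=> 1) (fun t => s0 * t + b0)
    (fun=> 0) (fun=> s0) (fun t => s0 ^+ 2 / 2 * t + e0).
Proof.
have oT : open [set: R] by exact: openT.
have affine (k l : R) : smooth setT (fun t : R => k * t + l).
  apply: smooth_add => //; last exact: smooth_cst.
  by apply: smooth_mul => //; [exact: smooth_cst | exact: smooth_id].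
have daff (k l t : R) : is_derive t (1 : R) (fun t : R => k * t + l) k.
  have H := is_derive_add (is_derive_mul (is_derive_cst k t (1 : R)) (is_derive_id1 t))
    (is_derive_cst l t (1 : R)).
  by apply: (is_derive_eq H); rewrite /=; ring.
have dc (k l t : R) : l = 0 -> is_derive t (1 : R) (fun=> k) l.
  by move=> ->; exact: is_derive_cst.
split.
- by split => //; exact: oner_neq0.
- by split; [exact: smooth_id | exact: smooth_cst | exact: affine].
- by split; [exact: smooth_cst | exact: smooth_cst | exact: affine].
- move=> t _; split; split.
  + by apply: (is_derive_eq (is_derive_id1 t)); rewrite expr1n divr1.
  + by apply: dc; rewrite !(mulr0, mul0r).
  + by apply: (is_derive_eq (daff _ _ t)); rewrite mulr1 divr1.
  + by apply: dc; rewrite expr0n /= mulr0 mul0r.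
  + by apply: dc; rewrite !(mulr0, mul0r).
  + by apply: (is_derive_eq (daff _ _ t)); rewrite mulr1.
- move=> t _; split; first exact: oner_neq0.
  + by rewrite expr1n mulr1 mul1r.
  + by rewrite subrr !(mulr0, mul0r).
  + by rewrite !mulr1.
Qed.

Lemma heisenberg_symmetry (c1 c2 c3 : R) :
  symmetry (nf_eq q) (heis c1 c2 c3).
Proof.
apply: symmetry_criterion => p0.
(* Along the flow the u-speed is constant and the x-speed is affine in the time, which gives a
   quadratic polynomial. *)
pose fl (y : R * P) : P := (y.2.1.1,
   y.2.1.2 + (y.1 * (c1 + c3 * y.2.2) + y.1 * y.1 * (c3 / 2 * (c2 + c3 * y.2.1.1))),
   y.2.2 + y.1 * (c2 + c3 * y.2.1.1)).
exists 1, setT, fl; split => //; last first.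
  move=> s _.
  (* These data describe the flow for the time [- s]. *)
  exists setT, 1, (fun t => t), (fun=> 1), (fun t => (- s * c3) * t + (- s * c2)),
    (fun=> 0), (fun=> - s * c3),
    (fun t => (- s * c3) ^+ 2 / 2 * t + (- s * c1 + s ^+ 2 * c3 / 2 * c2)).
  split; first exact: heisenberg_transform.
  by move=> [[t x] u] _; split => //=; congr (_, _, _); field.
pose O := [set y : R * P | `|y.1| < 1 /\ [set: P] y.2].
have oA : open O by exact: flow_dom_open openT.
split => //; first exact: openT.
- have s2 : smooth O (fun y : R * P => y.2).
    by apply: smooth_snd => //; exact: smooth_id.
  have s1 : smooth O (fun y : R * P => y.1).
    by apply: smooth_fst => //; exact: smooth_id.
  have [st sx su] := smooth_coords oA s2.
  have cst k : smooth O (fun=> k : R).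
    exact: smooth_cst.
  by apply: smooth_pair => //; [apply: smooth_pair => //|]; repeat
    (first [exact: cst | assumption | apply: (smooth_add oA) | apply: (smooth_mul oA)]).
- by move=> [[t x] u] _; rewrite /fl /= !mul0r !addr0.
move=> [[t x] u] s _ _; split => //.
have I1 := is_derive_id1 s.
have cst k : is_derive s (1 : R) (fun=> k : R) 0 by exact: is_derive_cst.
apply: is_derive_pair; first apply: is_derive_pair; first exact: cst.
  have H := is_derive_add (cst x) (is_derive_add (is_derive_mul I1 (cst (c1 + c3 * u)))
    (is_derive_mul (is_derive_mul I1 I1) (cst (c3 / 2 * (c2 + c3 * t))))).
  by apply: (is_derive_eq H); rewrite /fl /=; field.
have H := is_derive_add (cst u) (is_derive_mul I1 (cst (c2 + c3 * t))).
by apply: (is_derive_eq H); rewrite /fl /=; ring.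
Qed.

(** The margins [3 / 4] and [1 / 4] keep the denominators [cos s + t * sin s] and
    [cos s - t * sin s] above [1 / 2] when t is bounded by [M]. *)
Lemma small_angle (M : R) : 0 < M ->
  exists2 d : R, 0 < d & forall s, `|s| < d -> 3 / 4 < cos s /\ M * `|sin s| < 1 / 4.
Proof.
move=> M0.
have c1 : \forall s \near (0 : R), 3 / 4 < cos s.
  have := @continuous_cos R 0; rewrite /continuous_at cos0 => /cvgrPdist_lt/(_ (1 / 4)).
  rewrite divr_gt0 // => /(_ isT); apply: filterS => s.
  by rewrite ltr_norml => /andP[_ h]; lra.
have c2 : \forall s \near (0 : R), M * `|sin s| < 1 / 4.
  have e0 : 0 < 1 / 4 / M by rewrite !divr_gt0.
  have := @continuous_sin R 0; rewrite /continuous_at sin0 => /cvgrPdist_lt/(_ _ e0).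
  by apply: filterS => s; rewrite sub0r normrN ltr_pdivlMr // mulrC.
have /nbhs_ballP[d /= d0 dP] : \forall s \near (0 : R), 3 / 4 < cos s /\ M * `|sin s| < 1 / 4.
  exact: filterI.
by exists d => // s sd; apply: dP; rewrite -ball_normE /= sub0r normrN.
Qed.

End Symmetries.


Section RotationSymmetry.
Context {R : realType} (q : R).
Local Notation P := (R * R * R)%type.

Lemma is_derive_expRl (k s : R) :
  is_derive s (1 : R) (fun s : R => expR (k * s)) (k * expR (k * s)).
Proof.
have H := is_derive_mul (is_derive_cst k s (1 : R)) (is_derive_id1 s).
apply: (is_derive_eq (is_derive_comp1 H (is_derive_expR _))) => /=.
by rewrite mulr0 addr0 mulr1.
Qed.

Section SmallTime.
Context (M d : R) (small : forall s, `|s| < d -> 3 / 4 < cos s /\ M * `|sin s| < 1 / 4).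

Lemma small_denominator s t : `|s| < d -> `|t| < M ->
  1 / 2 < cos s + t * sin s /\ 1 / 2 < cos s - t * sin s.
Proof.
move=> sd tM; have [c1 c2] := small sd.
have h : `|t * sin s| < 1 / 4.
  by rewrite normrM (le_lt_trans _ c2) // ler_wpM2r // ltW.
by move: h; rewrite ltr_norml => /andP[h1 h2]; lra.
Qed.

(** The sides are compared by differentiating in the angle: T' = 1 + T^2 and the equation of [mfun]
    make [G] constant. This avoids the addition formula of the arctangent and its branches. *)
Lemma mfun_moebius s t : `|s| < d -> `|t| < M ->
  mfun (3 * q) ((t * cos s + sin s) / (cos s - t * sin s)) =
  mfun (3 * q) t * ((expR (q * s))^-1 / (cos s - t * sin s)) * ((expR (q * s))^-1) ^+ 2.
Proof.
move=> sd tM.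
pose c r := cos r - t * sin r.
pose T r := (t * cos r + sin r) / c r.
pose G r := mfun (3 * q) (T r) * (c r * (expR (q * r) * (expR (q * r) * expR (q * r)))).
have c0 (r : R) : `|r| < d -> c r != 0.
  by move=> rd; have [_ h] := small_denominator rd tM; rewrite gt_eqF // /c; lra.
have dc (r : R) : is_derive r (1 : R) c (- (t * cos r + sin r)).
  have H := is_derive_sub (is_derive_cos r)
    (is_derive_mul (is_derive_cst t r (1 : R)) (is_derive_sin r)).
  by apply: (is_derive_eq H) => /=; ring.
have dn (r : R) : is_derive r (1 : R) (fun r => t * cos r + sin r) (c r).
  have H := is_derive_add (is_derive_mul (is_derive_cst t r (1 : R)) (is_derive_cos r))
    (is_derive_sin r).
  by apply: (is_derive_eq H) => /=; rewrite /c; ring.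
have dT (r : R) : `|r| < d -> is_derive r (1 : R) T (1 + T r ^+ 2).
  move=> rd; apply: (is_derive_eq (is_derive_div (c0 r rd) (dn r) (dc r))).
  by rewrite /T; field; exact: c0.
have dG (r : R) : `|r| < d -> is_derive r (1 : R) G 0.
  move=> rd; have dm := @is_derive1_comp R _ _ r _ _ (is_derive_mfun (3 * q) (T r)) (dT r rd).
  have de := is_derive_expRl q r.
  have H := is_derive_mul dm (is_derive_mul (dc r) (is_derive_mul de (is_derive_mul de de))).
  apply: (is_derive_eq H) => /=.
  have -> : t * cos r + sin r = T r * c r by rewrite /T divfK // c0.
  move: (mfun _ _) (expR _) => m e.
  by field; exact: onesqr_neq0.
have G0 : G 0 = mfun (3 * q) t.
  by rewrite /G /T /c !mulr0 expR0 cos0 sin0 mulr0 subr0 addr0 divr1 !mulr1.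
have Gs : G s = G 0.
  have seg (r : R) : 0 <= r <= 1 -> `|0 + r *: s| < d.
    move=> /andP[r0 r1]; rewrite add0r normrZ (ger0_norm r0) (le_lt_trans _ sd) //.
    by rewrite ler_piMl.
  have dGs (r : R) : 0 <= r <= 1 -> is_derive (0 + r *: s) s G 0.
    move=> rI; have H := is_derive_dirZ s (dG _ (seg r rI)).
    by rewrite [s *: 1]mulr1 scaler0 in H.
  have [r rI|r r01 E] := @MVT_dir R _ G 0 s; first by have [] := dGs r rI.
  have rI : 0 <= r <= 1 by case/andP: r01 => *; rewrite !ltW.
  have [_ e] := dGs r rI; rewrite e add0r in E.
  by apply/eqP; rewrite -subr_eq0 E.
have e0 : expR (q * s) != 0 by rewrite gt_eqF // expR_gt0.
have cs0 := c0 s sd.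
have : G s = mfun (3 * q) t by rewrite Gs.
rewrite /G -/(c s) -/(T s) => <-.
by field; rewrite e0 cs0.
Qed.

End SmallTime.

(** With t = tan a the first component is tan (a - s), a Moebius map of t; the others carry its
    denominator and the powers of [expR (q * s)] that solve the flow equation of [rot]. *)
Definition rotation_flow (y : R * P) : P :=
  let c := cos y.1 + y.2.1.1 * sin y.1 in
  ((y.2.1.1 * cos y.1 - sin y.1) / c,
   expR (q * y.1) ^+ 2 * (y.2.1.2 - y.2.2 ^+ 2 * sin y.1 / (2 * c)),
   y.2.2 * expR (q * y.1) / c).

Lemma rotation_symmetry : symmetry (nf_eq q) (rot q).
Proof.
apply: symmetry_criterion => p0.
pose M := `|p0.1.1| + 1.
(* The flow may leave the bound [M]. Its numerator is at most [M + 1] and its denominator exceeds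
   [1 / 2], so [M'] bounds the image. *)
pose M' := 2 * M + 2.
have M0 : 0 < M by rewrite ltr_wpDl.
have M'0 : 0 < M' by rewrite /M'; lra.
have MM' : M <= M' by rewrite /M'; lra.
have [d d0 small] := small_angle M'0.
pose A := [set p : P | setT p /\ ball 0 M p.1.1].
have oT : open ([set: P]) by exact: openT.
have st0 : smooth setT (fun p : P => p.1.1).
  by do 2 apply: smooth_fst => //; exact: smooth_id.
have oA : open A.
  apply: (open_preim openT st0); exact: ball_open.
have AM p : A p -> `|p.1.1| < M by move=> [_]; rewrite -ball_normE /= sub0r normrN.
have AM' p : A p -> `|p.1.1| < M' by move=> /AM h; exact: lt_le_trans MM'.
have cn0 s p : A p -> `|s| < d -> cos s + p.1.1 * sin s != 0.
  move=> Ap sd; have [h _] := small_denominator small sd (AM' p Ap).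
  by rewrite gt_eqF //; lra.
have oI : open (ball (0 : R) M') by exact: ball_open.
exists d, A, rotation_flow; split; last first.
- move=> s sd.
  pose e := (expR (q * s))^-1.
  have e0 : e != 0 by rewrite invr_eq0 gt_eqF // expR_gt0.
  pose c t := cos s - t * sin s.
  have c0 t : ball 0 M' t -> c t != 0.
    rewrite -ball_normE /= sub0r normrN => tM.
    by have [_ h] := small_denominator small sd tM; rewrite gt_eqF // /c; lra.
  (* These data describe the flow for the time [- s], with [e] the exponential at that time. *)
  exists (ball 0 M'), (e ^+ 2), (fun t => (t * cos s + sin s) / c t), (fun t => e / c t),
    (fun=> 0), (fun t => e ^+ 2 * sin s / (2 * c t)), (fun=> 0), (fun=> 0).
  have sid : smooth (ball 0 M') (fun t : R => t) by exact: smooth_id.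
  have scs k : smooth (ball (0 : R) M') (fun=> k : R) by exact: smooth_cst.
  have sc : smooth (ball 0 M') c.
    by apply: smooth_add => //; apply: smooth_opp => //; exact: smooth_mul.
  have sci : smooth (ball 0 M') (fun t => (c t)^-1) by exact: smooth_inv.
  have c2 t : ball 0 M' t -> 2 * c t != 0 by move=> /c0 h; rewrite mulf_neq0 // pnatr_eq0.
  have dc (t : R) : is_derive t (1 : R) c (- sin s).
    have H := is_derive_sub (is_derive_cst (cos s) t (1 : R))
      (is_derive_mul (is_derive_id1 t) (is_derive_cst (sin s) t (1 : R))).
    by apply: (is_derive_eq H) => /=; ring.
  have dcst (k t : R) : is_derive t (1 : R) (fun=> k) 0 by exact: is_derive_cst.
  split; last first.
    move=> p Ap; have tM := AM p Ap.
    have cp0 := cn0 s p Ap sd.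
    have [ch _] := small_denominator small sd (AM' p Ap).
    have [cs ss] := small s sd.
    split.
      have cp : 0 < cos s + p.1.1 * sin s by lra.
      rewrite -ball_normE /= sub0r normrN normrM normfV (gtr0_norm cp) ltr_pdivrMr //.
      have h1 : `|p.1.1 * cos s - sin s| <= M + 1.
        rewrite (le_trans (ler_normB _ _)) // lerD //; last by rewrite ler_norml sin_geN1 sin_le1.
        rewrite normrM (le_trans (ler_wpM2l _ (_ : `|cos s| <= 1))) //.
          by rewrite ler_norml cos_geN1 cos_le1.
        by rewrite mulr1 ltW.
      by rewrite (le_lt_trans h1) // /M'; nra.
    have E0 : expR (q * s) != 0 by rewrite gt_eqF // expR_gt0.
    (* The denominators of a rotation and of its inverse are reciprocal at corresponding points. *)
    have inv : c ((p.1.1 * cos s - sin s) / (cos s + p.1.1 * sin s)) =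
        (cos s + p.1.1 * sin s)^-1.
      rewrite /c; apply: (mulIf cp0); rewrite mulVf // mulrBl mulrAC divfK //.
      transitivity (cos s ^+ 2 + sin s ^+ 2); [ring | exact: cos2Dsin2].
    rewrite /= inv /e.
    apply: triple_eq => /=.
    + rewrite invrK mulrDl mulrAC divfK //; transitivity (p.1.1 * (cos s ^+ 2 + sin s ^+ 2)).
        by rewrite cos2Dsin2 mulr1.
      by ring.
    + by field; rewrite cp0 E0.
    + by field; rewrite cp0 E0.
  split.
  - by split => //; rewrite expf_neq0.
  - split => //; last by exact: smooth_mul.
    by apply: smooth_mul => //; apply: smooth_add => //; exact: smooth_mul.
  - split => //; apply: smooth_mul => //; apply: smooth_inv => //; exact: smooth_mul.
  - move=> t It; have ct0 := c0 t It; split; split.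
    + have dn : is_derive t (1 : R) (fun t => t * cos s + sin s) (cos s).
        have H := is_derive_add (is_derive_mul (is_derive_id1 t) (dcst (cos s) t)) (dcst (sin s) t).
        by apply: (is_derive_eq H) => /=; ring.
      apply: (is_derive_eq (is_derive_div ct0 dn (dc t))).
      have -> : cos s * c t - (t * cos s + sin s) * - sin s = cos s ^+ 2 + sin s ^+ 2.
        by rewrite /c; ring.
      by rewrite cos2Dsin2; field; rewrite e0 ct0.
    + apply: (is_derive_eq (is_derive_div ct0 (dcst e t) (dc t))).
      by field; rewrite e0 ct0.
    + by apply: (is_derive_eq (dcst 0 t)); rewrite !mul0r.
    + have H := @is_derive_div _ _ (fun t => 2 * c t) t _ _ (c2 t It) (dcst (e ^+ 2 * sin s) t)
        (is_derive_mul (dcst 2 t) (dc t)).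
      by apply: (is_derive_eq H) => /=; field; rewrite e0 ct0.
    + by apply: (is_derive_eq (dcst 0 t)); rewrite mulr0 mul0r.
    + by apply: (is_derive_eq (dcst 0 t)); rewrite expr0n /= mul0r.
  - move=> t It; have ct0 := c0 t It; split.
    + by rewrite mulf_neq0 // invr_eq0.
    + have -> : (1 + ((t * cos s + sin s) / c t) ^+ 2) * e ^+ 2 =
          e ^+ 2 / c t ^+ 2 * (c t ^+ 2 + (t * cos s + sin s) ^+ 2) by field.
      have -> : c t ^+ 2 + (t * cos s + sin s) ^+ 2 = (1 + t ^+ 2) * (cos s ^+ 2 + sin s ^+ 2).
        by rewrite /c; ring.
      by rewrite cos2Dsin2 mulr1 expr_div_n.
    + have -> : 2 * (e ^+ 2 * sin s / (2 * c t)) * (1 + ((t * cos s + sin s) / c t) ^+ 2) =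
          e ^+ 2 * sin s / c t ^+ 3 * (c t ^+ 2 + (t * cos s + sin s) ^+ 2) by field.
      have -> : c t ^+ 2 + (t * cos s + sin s) ^+ 2 = (1 + t ^+ 2) * (cos s ^+ 2 + sin s ^+ 2).
        by rewrite /c; ring.
      have -> : (e / c t) ^+ 2 * ((t * cos s + sin s) / c t - t) =
          e ^+ 2 / c t ^+ 3 * (t * cos s + sin s - t * c t) by field.
      by rewrite cos2Dsin2 /c; field; exact: ct0.
    + rewrite /c /e; apply: (mfun_moebius small sd).
      by move: It; rewrite -ball_normE /= sub0r normrN.
- by split => //; rewrite -ball_normE /= sub0r normrN /M ltrDl.
pose O := [set y : R * P | `|y.1| < d /\ A y.2].
have oS : open O by exact: flow_dom_open.
split => //.
- have s2 : smooth O (fun y : R * P => y.2).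
    by apply: smooth_snd => //; exact: smooth_id.
  have s1 : smooth O (fun y : R * P => y.1).
    by apply: smooth_fst => //; exact: smooth_id.
  have [st sx su] := smooth_coords oS s2.
  have cst k : smooth O (fun=> k : R) by exact: smooth_cst.
  have comp (f : R -> R) (g : R * P -> R) : smooth setT f ->
      smooth O g ->
      smooth O (fun y => f (g y)).
    by move=> sf sg; exact: (smooth_comp oS openT _ sg sf).
  have [sS sC] := smooth_sincos (@openT R).
  have ssin := comp _ _ sS s1; have scos := comp _ _ sC s1.
  have sexp := comp _ _ (smooth_expR openT) (smooth_mul oS (cst q) s1).
  have sc := smooth_add oS scos (smooth_mul oS st ssin).
  have sci := smooth_inv oS (fun y (h : `|y.1| < d /\ A y.2) => cn0 _ _ h.2 h.1) sc.
  have sci2 : smooth O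
      (fun y => (2 * (cos y.1 + y.2.1.1 * sin y.1))^-1).
    apply: smooth_inv => //; last exact: smooth_mul.
    by move=> y [h1 h2]; rewrite mulf_neq0 ?pnatr_eq0 // cn0.
  apply: smooth_pair => //; first apply: smooth_pair => //.
  + apply: smooth_mul => //; apply: smooth_add => //; first exact: smooth_mul.
    exact: smooth_opp.
  + apply: smooth_mul => //; first exact: smooth_exp.
    apply: smooth_add => //; apply: smooth_opp => //; apply: smooth_mul => //.
    by apply: smooth_mul => //; exact: smooth_exp.
  + by apply: smooth_mul => //; exact: smooth_mul.
- move=> p _; rewrite /rotation_flow /= mulr0 cos0 sin0 expR0 !mulr0 addr0 expr1n mul0r.
  by apply: triple_eq; rewrite /= ?subr0 ?mulr1 ?divr1 ?mul1r.
move=> p s Ap sd; split => //.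
have cp0 := cn0 s p Ap sd.
set t := p.1.1 in cp0; set x := p.1.2; set u := p.2.
have dcst (k : R) : is_derive s (1 : R) (fun=> k) 0 by exact: is_derive_cst.
have dc : is_derive s (1 : R) (fun s => cos s + t * sin s) (t * cos s - sin s).
  have H := is_derive_add (is_derive_cos s) (is_derive_mul (dcst t) (is_derive_sin s)).
  by apply: (is_derive_eq H) => /=; ring.
have dn : is_derive s (1 : R) (fun s => t * cos s - sin s) (- (cos s + t * sin s)).
  have H := is_derive_sub (is_derive_mul (dcst t) (is_derive_cos s)) (is_derive_sin s).
  by apply: (is_derive_eq H) => /=; ring.
have de := is_derive_expRl q s.
have cs2 : cos s * (cos s + t * sin s) - sin s * (t * cos s - sin s) = 1.
  by transitivity (cos s ^+ 2 + sin s ^+ 2); [ring | exact: cos2Dsin2].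
have c20 : 2 * (cos s + t * sin s) != 0 by rewrite mulf_neq0 // pnatr_eq0.
have d1 := @is_derive_div _ _ (fun s => 2 * (cos s + t * sin s)) s _ _ c20
  (is_derive_mul (dcst (u ^+ 2)) (is_derive_sin s)) (is_derive_mul (dcst 2) dc).
pose c := cos s + t * sin s; pose n := t * cos s - sin s.
have d2 : is_derive s (1 : R) (fun s => u ^+ 2 * sin s / (2 * (cos s + t * sin s)))
    (u ^+ 2 / (2 * c ^+ 2)).
  apply: (is_derive_eq d1); rewrite /= -/c -/n.
  transitivity (u ^+ 2 * (cos s * c - sin s * n) * 2 / (2 * c) ^+ 2).
    by congr (_ / _); ring.
  by rewrite cs2 mulr1; field; exact: cp0.
have H1 := @is_derive_div _ _ (fun s => cos s + t * sin s) s _ _ cp0 dn dc.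
have H2 := is_derive_mul (is_derive_mul de de) (is_derive_sub (dcst x) d2).
have H3 := @is_derive_div _ _ (fun s => cos s + t * sin s) s _ _ cp0 (is_derive_mul (dcst u) de) dc.
have H := is_derive_pair (is_derive_pair H1 H2) H3.
rewrite (_ : (fun r : R => rotation_flow (r, p)) = (fun r =>
    ((t * cos r - sin r) / (cos r + t * sin r), expR (q * r) * expR (q * r) *
    (x - u ^+ 2 * sin r / (2 * (cos r + t * sin r))), u * expR (q * r) / (cos r + t * sin r)))).
  apply: (is_derive_eq H); rewrite /rot /rotation_flow /= -/t -/x -/u -/c -/n.
  have c0 : c != 0 by exact: cp0.
  move: (expR _) => e; move: c0; clear; move: c n (sin s) => c n si c0.
  by congr (_, _, _); field.
by apply/funext => r; rewrite /rotation_flow /= expr2.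
Qed.

End RotationSymmetry.


(** * Leading coefficients of linearizable equations *)

Section Prolongation.
Context {R : realType}.
Local Notation P := (R * R * R)%type.
Local Notation P2 := (R * R)%type.
Local Notation dirx := ((0, 1) : P2).
Local Notation dirt := ((1, 0) : P2).

Definition part_t (X : P -> R) (p : P) : R := 'D_((1, 0, 0) : P) X p.
Definition part_x (X : P -> R) (p : P) : R := 'D_((0, 1, 0) : P) X p.
Definition part_u (X : P -> R) (p : P) : R := 'D_((0, 0, 1) : P) X p.

(** Total x-derivatives of [X] along a graph. [prol3] leaves out [u3 * part_u X], the only term with
    the third derivative, so that this term stays visible in [graph_Dx3]. *)
Definition prol1 X (p : P) (u1 : R) : R := part_x X p + u1 * part_u X p.
Definition prol2 X (p : P) (u1 u2 : R) : R :=
  prol1 (part_x X) p u1 + (u2 * part_u X p + u1 * prol1 (part_u X) p u1).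
Definition prol3 X (p : P) (u1 u2 : R) : R :=
  prol2 (part_x X) p u1 u2 + (2 * u2 * prol1 (part_u X) p u1 + u1 * prol2 (part_u X) p u1 u2).

Context (A : set P) (U : set P2) (f : P2 -> R) (oA : open A) (oU : open U)
  (sf : smooth U f) (UA : forall z, U z -> A (z, f z)).

Local Notation gr X := (fun z : P2 => X (z, f z)).

Lemma smooth_graph (X : P -> R) : smooth A X -> smooth U (gr X).
Proof.
move=> sX; apply: (smooth_comp oU oA UA _ sX).
by apply: smooth_pair => //; exact: smooth_id.
Qed.

Lemma is_derive_graph (X : P -> R) z (v : P2) : smooth A X -> U z ->
  is_derive z v (gr X) (v.1 * part_t X (z, f z) + (v.2 * part_x X (z, f z)
    + 'D_v f z * part_u X (z, f z))).
Proof.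
move=> sX Uz; have dX : differentiable X (z, f z).
  exact: (smooth_differentiable oA sX (UA Uz)).
have df : is_derive z v f ('D_v f z) by exact: (smooth_is_derive _ oU sf Uz).
apply: (is_derive_eq (is_derive_comp (is_derive_pair (is_derive_id z v) df) dX)).
have {1}-> : (v, 'D_v f z) = v.1 *: ((1, 0, 0) : P) + (v.2 *: ((0, 1, 0) : P) +
    'D_v f z *: ((0, 0, 1) : P)).
  by apply: triple_eq; rewrite /= /GRing.scale /= ?mulr0 ?mulr1 ?addr0 ?add0r.
by rewrite !(derive_dirD _ _ dX) !(derive_dirZ _ _ dX).
Qed.

Lemma graph_dx (X : P -> R) z : smooth A X -> U z ->
  is_derive z dirx (gr X) (prol1 X (z, f z) (Dx f z)).
Proof.
move=> sX Uz; apply: (is_derive_eq (is_derive_graph dirx sX Uz)).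
by rewrite /= mul0r add0r mul1r.
Qed.

Lemma graph_dt (X : P -> R) z : smooth A X -> U z ->
  is_derive z dirt (gr X) (part_t X (z, f z) + Dt f z * part_u X (z, f z)).
Proof.
move=> sX Uz; apply: (is_derive_eq (is_derive_graph dirt sX Uz)).
by rewrite /= mul1r mul0r add0r.
Qed.

Lemma graph_Dx1 (X : P -> R) z : smooth A X -> U z ->
  Dx (gr X) z = prol1 X (z, f z) (Dx f z).
Proof. by move=> sX Uz; have [_] := graph_dx sX Uz. Qed.

Lemma smooth_part_x X : smooth A X -> smooth A (part_x X).
Proof. exact: smooth_derive. Qed.

Lemma smooth_part_u X : smooth A X -> smooth A (part_u X).
Proof. exact: smooth_derive. Qed.

Lemma graph_Dx2 (X : P -> R) z : smooth A X -> U z ->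
  Dx (Dx (gr X)) z = prol2 X (z, f z) (Dx f z) (Dx (Dx f) z).
Proof.
move=> sX Uz.
have d1 := smooth_is_derive_x oU (smooth_Dx sf) Uz.
have H := is_derive_add (graph_dx (smooth_part_x sX) Uz)
  (is_derive_mul d1 (graph_dx (smooth_part_u sX) Uz)).
have E y : U y -> Dx (gr X) y = part_x X (y, f y) + Dx f y * part_u X (y, f y).
  by move=> Uy; rewrite graph_Dx1.
have sgX := smooth_graph sX.
have e := is_derive_on_eq oU Uz E (smooth_is_derive_x oU (smooth_Dx sgX) Uz) H.
apply: (etrans e); rewrite /prol2; congr (_ + _).
by rewrite addrC; congr (_ + _); exact: mulrC.
Qed.

Lemma graph_Dx3 (X : P -> R) z : smooth A X -> U z ->
  Dx (Dx (Dx (gr X))) z = prol3 X (z, f z) (Dx f z) (Dx (Dx f) z)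
    + Dx (Dx (Dx f)) z * part_u X (z, f z).
Proof.
move=> sX Uz; have sx := smooth_part_x sX; have su := smooth_part_u sX.
have d1 := smooth_is_derive_x oU (smooth_Dx sf) Uz.
have d2 := smooth_is_derive_x oU (smooth_Dx (smooth_Dx sf)) Uz.
have dx1 := smooth_is_derive_x oU (smooth_Dx (smooth_graph sx)) Uz.
have du0 := graph_dx su Uz.
have du1 := smooth_is_derive_x oU (smooth_Dx (smooth_graph su)) Uz.
have H := is_derive_add dx1 (is_derive_add (is_derive_mul d2 du0) (is_derive_mul d1 du1)).
have E y : U y -> Dx (Dx (gr X)) y = Dx (gr (part_x X)) y +
    (Dx (Dx f) y * part_u X (y, f y) + Dx f y * Dx (gr (part_u X)) y).
  by move=> Uy; rewrite graph_Dx2 // !graph_Dx1.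
have e := is_derive_on_eq oU Uz E
  (smooth_is_derive_x oU (smooth_Dx (smooth_Dx (smooth_graph sX))) Uz) H.
apply: (etrans e).
have alg (a a' c c' g g' k h m l : R) : a = a' -> c = c' -> g = g' ->
    a + ((k * g' + l * m) + (h * c + g * k)) = a' + (2 * k * g' + h * c') + m * l.
  by move=> -> -> ->; ring.
exact: (alg _ _ _ _ _ _ _ _ _ _ (graph_Dx2 sx Uz) (graph_Dx2 su Uz) (graph_Dx1 su Uz)).
Qed.

End Prolongation.


Section GraphTransform.
Context {R : realType}.
Local Notation P := (R * R * R)%type.
Local Notation P2 := (R * R)%type.
Local Notation dirx := ((0, 1) : P2).
Local Notation dirt := ((1, 0) : P2).

(** The derivative of the pair is triangular because [h1] does not depend on x, so its inverse [S]
    has an explicit formula and [inverse_function] applies. *)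
Lemma triangular_inverse (U : set P2) (h1 h2 : P2 -> R) z0 : open U -> smooth U h1 ->
  smooth U h2 -> (forall z, U z -> Dx h1 z = 0) -> U z0 -> Dt h1 z0 != 0 -> Dx h2 z0 != 0 ->
  exists A g, [/\ open A, A z0, A `<=` U, open ((fun z => (h1 z, h2 z)) @` A) &
    smooth ((fun z => (h1 z, h2 z)) @` A) g /\ forall z, A z -> g (h1 z, h2 z) = z].
Proof.
move=> oU s1 s2 h1x Uz0 t0 x0.
have st1 : smooth U (Dt h1) by exact: smooth_derive.
have sx2 := smooth_Dx s2.
have st2 : smooth U (Dt h2) by exact: smooth_derive.
have s12 : smooth U (fun z => Dt h1 z * Dx h2 z) by exact: smooth_mul.
set O := [set z | U z /\ Dt h1 z * Dx h2 z != 0].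
have oO : open O by exact: (open_preim oU s12 open_neq0).
have OU : O `<=` U by move=> z [].
have Oz0 : O z0 by split => //; exact: mulf_neq0.
have Ot z : O z -> Dt h1 z != 0 by move=> [_ +]; rewrite mulf_eq0 negb_or => /andP[].
have Ox z : O z -> Dx h2 z != 0 by move=> [_ +]; rewrite mulf_eq0 negb_or => /andP[].
pose h z := (h1 z, h2 z).
pose S (z v : P2) : P2 := (v.1 * (Dt h1 z)^-1,
  (v.2 + - (Dt h2 z * (v.1 * (Dt h1 z)^-1))) * (Dx h2 z)^-1).
have sh : smooth O h by apply: (smooth_sub OU); exact: smooth_pair.
have cst (c : R) : smooth O (fun=> c) by exact: smooth_cst.
have it : smooth O (fun z => (Dt h1 z)^-1).
  by apply: smooth_inv => //; exact: (smooth_sub OU st1).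
have ix : smooth O (fun z => (Dx h2 z)^-1).
  by apply: smooth_inv => //; exact: (smooth_sub OU sx2).
have sS v : smooth O (S ^~ v).
  have sa : smooth O (fun z => v.1 * (Dt h1 z)^-1) by exact: smooth_mul.
  apply: smooth_pair => //; apply: smooth_mul => //; apply: smooth_add => //.
  by apply: smooth_opp => //; apply: smooth_mul => //; exact: (smooth_sub OU st2).
have dirE (v : P2) : v = v.1 *: dirt + v.2 *: dirx.
  by case: v => a b; congr pair; rewrite /= /GRing.scale /= ?mulr0 ?mulr1 ?addr0 ?add0r.
have Dh z v : O z -> 'D_v h z = (v.1 * Dt h1 z, v.1 * Dt h2 z + v.2 * Dx h2 z).
  move=> Oz; have Uz := OU _ Oz.
  
  have d1 : differentiable h1 z by exact: (smooth_differentiable oU s1 Uz).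
  have d2 : differentiable h2 z by exact: (smooth_differentiable oU s2 Uz).
  have [_ e] := is_derive_pair (differentiable_is_derive v d1) (differentiable_is_derive v d2).
  apply: (etrans e); rewrite [in LHS](dirE v); congr pair.
    apply: (etrans (derive_dirD _ _ d1)).
    apply: (etrans (congr2 _ (derive_dirZ _ _ d1) (derive_dirZ _ _ d1))).
    have -> : 'D_dirx h1 z = 0 by exact: h1x.
    by rewrite scaler0 addr0.
  apply: (etrans (derive_dirD _ _ d2)).
  exact: (congr2 _ (derive_dirZ _ _ d2) (derive_dirZ _ _ d2)).
have alg1 (a b d x y : R) : a != 0 -> d != 0 ->
    (x * a^-1 * a, x * a^-1 * b + (y + - (b * (x * a^-1))) * d^-1 * d) = (x, y).
  by move=> a0 d0; congr pair; field; rewrite ?a0 ?d0.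
have alg2 (a b d x y : R) : a != 0 -> d != 0 ->
    (x * a * a^-1, (x * b + y * d + - (b * (x * a * a^-1))) * d^-1) = (x, y).
  by move=> a0 d0; congr pair; field; rewrite ?a0 ?d0.
have DS z v : O z -> 'D_(S z v) h z = v.
  move=> Oz; apply: (etrans (Dh z (S z v) Oz)).
  by apply: (etrans (alg1 _ _ _ _ _ (Ot _ Oz) (Ox _ Oz))); case: (v).
have SD z v : O z -> S z ('D_v h z) = v.
  move=> Oz; apply: (etrans (congr1 (S z) (Dh z v Oz))).
  by apply: (etrans (alg2 _ _ _ _ _ (Ot _ Oz) (Ox _ Oz))); case: (v).
have [A [g [oA Az0 AO oim [sg gK]]]] := inverse_function oO sh Oz0 sS DS SD.
by exists A, g; split => // z /AO/OU.
Qed.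

Lemma polynomial_jets (z0 : P2) (u u1 u2 u3 ut : R) : exists f : P2 -> R,
  [/\ smooth setT f, f z0 = u, Dt f z0 = ut & [/\ Dx f z0 = u1, Dx (Dx f) z0 = u2 &
      Dx (Dx (Dx f)) z0 = u3]].
Proof.
pose y (z : P2) := z.2 - z0.2.
have dy z v : is_derive z v y v.2.
  have d := is_derive_add (is_derive_snd (is_derive_id z v)) (is_derive_cst (- z0.2) z v).
  by apply: (is_derive_eq d); rewrite addr0.
have ds z v : is_derive z v (fun z : P2 => z.1 - z0.1) v.1.
  have d := is_derive_add (is_derive_fst (is_derive_id z v)) (is_derive_cst (- z0.1) z v).
  by apply: (is_derive_eq d); rewrite addr0.
pose f2 z := u2 + u3 * y z.
pose f1 z := u1 + y z * (u2 + u3 / 2 * y z).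
pose f (z : P2) := u + ut * (z.1 - z0.1) + y z * (u1 + y z * (u2 / 2 + u3 / 6 * y z)).
have c (k : R) z (v : P2) : is_derive z v (fun=> k) 0 by exact: is_derive_cst.
have d2 z v : is_derive z v f2 (u3 * v.2).
  by apply: (is_derive_eq (is_derive_add (c u2 z v) (is_derive_mul (c u3 z v) (dy z v)))); ring.
have d1 z v : is_derive z v f1 (f2 z * v.2).
  apply: (is_derive_eq (is_derive_add (c u1 z v) (is_derive_mul (dy z v)
    (is_derive_add (c u2 z v) (is_derive_mul (c (u3 / 2) z v) (dy z v)))))).
  by rewrite /f2; field.
have d0 z v : is_derive z v f (ut * v.1 + f1 z * v.2).
  apply: (is_derive_eq (is_derive_add (is_derive_add (c u z v) (is_derive_mul (c ut z v) (ds z v)))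
    (is_derive_mul (dy z v) (is_derive_add (c u1 z v) (is_derive_mul (dy z v)
    (is_derive_add (c (u2 / 2) z v) (is_derive_mul (c (u3 / 6) z v) (dy z v)))))))).
  by rewrite /f1; field.
have e0 : Dx f = f1.
  by apply/funext => z; have [_ e] := d0 z dirx; apply: (etrans e); rewrite /= mulr0 add0r mulr1.
have e1 : Dx f1 = f2.
  by apply/funext => z; have [_ e] := d1 z dirx; apply: (etrans e); rewrite /= mulr1.
have e2 z : Dx f2 z = u3.
  by have [_ e] := d2 z dirx; apply: (etrans e); rewrite /= mulr1.
have oT : open [set: P2] by exact: openT.
have sc (k : R) : smooth [set: P2] (fun=> k) by exact: smooth_cst.
have sy : smooth setT y.
  by apply: smooth_add => //; apply: smooth_snd => //; exact: smooth_id.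
exists f; split.
- by repeat (first [exact: sc | exact: sy | apply: (smooth_add oT) | apply: (smooth_mul oT) |
    apply: (smooth_fst oT) | exact: smooth_id]).
- by rewrite /f /y !subrr mulr0 mul0r !addr0.
- have [_ e] := d0 z0 dirt; apply: (etrans e) => /=; by rewrite mulr1 mulr0 addr0.
- by rewrite e0 e1 e2 /f1 /f2 /y !subrr mul0r mulr0 !addr0.
Qed.

Section Components.
Context (A : set P) (phi : P -> P) (oA : open A) (pphi : projectable A phi).
Local Notation T := (fun p => (phi p).1.1).
Local Notation X := (fun p => (phi p).1.2).
Local Notation Y := (fun p => (phi p).2).

Lemma smooth_components : [/\ smooth A T, smooth A X & smooth A Y].
Proof. by have [sphi _] := pphi; exact: smooth_coords. Qed.

Lemma derive_components p v : A p ->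
  [/\ 'D_v T p = ('D_v phi p).1.1, 'D_v X p = ('D_v phi p).1.2 & 'D_v Y p = ('D_v phi p).2].
Proof.
move=> Ap; have [sphi _] := pphi.
have d : is_derive p v phi ('D_v phi p) by exact: (smooth_is_derive _ oA sphi Ap).
have [_ e1] := is_derive_fst (is_derive_fst d).
have [_ e2] := is_derive_snd (is_derive_fst d).
by have [_ e3] := is_derive_snd d.
Qed.

Lemma part_time p : A p -> part_x T p = 0 /\ part_u T p = 0.
Proof.
move=> Ap; split.
  have [e _ _] := derive_components (0, 1, 0) Ap; apply: (etrans e).
  by apply: (etrans (projectable_derive _ oA pphi Ap)); exact: mul0r.
have [e _ _] := derive_components (0, 0, 1) Ap; apply: (etrans e).
by apply: (etrans (projectable_derive _ oA pphi Ap)); exact: mul0r.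
Qed.

(* No equation is imposed on f, so its jet at p0 (u3 and ut included) is arbitrary. *)
Lemma graph_transform p0 (u1 u2 u3 ut : R) : A p0 -> prol1 X p0 u1 != 0 -> part_t T p0 != 0 ->
  exists U f U' g, [/\ open U, smooth U f, forall z, U z -> A (z, f z) & U p0.1] /\
    [/\ open U', smooth U' g, carries phi U f U' g & U' (phi p0).1] /\
    [/\ jet2 f p0.1 = (p0, u1, u2), Dx (Dx (Dx f)) p0.1 = u3, Dt f p0.1 = ut &
        phi (p0.1, f p0.1) = ((phi p0).1, g (phi p0).1)] /\
    [/\ Dx g (phi p0).1 * prol1 X p0 u1 = prol1 Y p0 u1,
        Dx (Dx g) (phi p0).1 * prol1 X p0 u1 ^+ 2 + Dx g (phi p0).1 * prol2 X p0 u1 u2 =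
          prol2 Y p0 u1 u2,
        Dx (Dx (Dx g)) (phi p0).1 * prol1 X p0 u1 ^+ 3
          + 3 * Dx (Dx g) (phi p0).1 * prol1 X p0 u1 * prol2 X p0 u1 u2
          + Dx g (phi p0).1 * (prol3 X p0 u1 u2 + u3 * part_u X p0) =
          prol3 Y p0 u1 u2 + u3 * part_u Y p0 &
        Dt g (phi p0).1 * part_t T p0
          + Dx g (phi p0).1 * (part_t X p0 + ut * part_u X p0) =
          part_t Y p0 + ut * part_u Y p0].
Proof.
move=> Ap0 xi0 tau0.
have [f [sf f0 ft [fx fxx fxxx]]] := polynomial_jets p0.1 p0.2 u1 u2 u3 ut.
have p0E : (p0.1, f p0.1) = p0 by rewrite f0; case: (p0).
have oT : open [set: P2] by exact: openT.
have sgr : smooth setT (fun z : P2 => (z, f z)) by apply: smooth_pair => //; exact: smooth_id.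
have sTU (W : set P2) : smooth W f by apply: smooth_sub sf.
set U1 := [set z : P2 | setT z /\ A (z, f z)].
have oU1 : open U1 by exact: (open_preim oT sgr oA).
have U1A z : U1 z -> A (z, f z) by case.
have U1z : U1 p0.1 by split => //; rewrite p0E.
have [sT sX sY] := smooth_components.
pose h1 z := T (z, f z); pose h2 z := X (z, f z); pose k z := Y (z, f z).
have sh1 : smooth U1 h1 by exact: (smooth_graph oA oU1 (sTU _) U1A sT).
have sh2 : smooth U1 h2 by exact: (smooth_graph oA oU1 (sTU _) U1A sX).
have sk : smooth U1 k by exact: (smooth_graph oA oU1 (sTU _) U1A sY).
have h1x z : U1 z -> Dx h1 z = 0.
  move=> Uz; have [tx tu] := part_time (U1A _ Uz).
  apply: (etrans (graph_Dx1 oA oU1 (sTU _) U1A sT Uz)).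
  by rewrite /prol1 tx tu mulr0 addr0.
have [tx tu] := part_time Ap0.
have h1t : Dt h1 p0.1 = part_t T p0.
  have [_ e] := graph_dt oA oU1 (sTU _) U1A sT U1z; apply: (etrans e).
  by rewrite p0E tu mulr0 addr0.
have h2x : Dx h2 p0.1 = prol1 X p0 u1.
  by have e := graph_Dx1 oA oU1 (sTU _) U1A sX U1z; rewrite p0E fx in e.
have [||B [eta [oB Bz0 BU oim [seta etaK]]]] :=
  triangular_inverse oU1 sh1 sh2 h1x U1z; rewrite ?h1t ?h2x //.
(* The transform of [f]: [eta] recovers the old base point from the new one, and [k] gives the new
   value of u. *)
pose h z := (h1 z, h2 z); pose g w := k (eta w).
have imB w : (h @` B) w -> B (eta w) by move=> [z Bz <-]; rewrite etaK.
have BA z : B z -> A (z, f z) by move=> /BU /U1A.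
have sg : smooth (h @` B) g.
  by apply: (smooth_comp oim oB imB seta); exact: (smooth_sub BU sk).
have hB z : B z -> (h @` B) (h1 z, h2 z) by move=> Bz; exists z.
have gk z : B z -> g (h1 z, h2 z) = k z by move=> Bz; rewrite /g etaK.
have sub (F : P2 -> R) : smooth U1 F -> smooth B F by exact: smooth_sub.
have h1xB z : B z -> Dx h1 z = 0 by move=> /BU; exact: h1x.
have h0 : (h1 p0.1, h2 p0.1) = (phi p0).1.
  by rewrite /h1 /h2 /= p0E; case: (phi p0) => [[]].
exists B, f, (h @` B), g; split; [by split|split; [split => //|split]].
- move=> w [z Bz <-]; exists z => //.
  apply: (etrans _ (congr1 (pair (h z)) (esym (gk _ Bz)))).
  by rewrite /h /h1 /h2 /k; case: (phi _) => [[]].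
- by rewrite -h0; exact: hB.
- split => //; first by rewrite /jet2 p0E fx fxx.
  rewrite p0E -h0 gk // /k p0E.
  by rewrite h0; case: (phi p0).
have X1 := chain_jet1 oB oim sg (sub _ sh1) (sub _ sh2) (sub _ sk) hB h1xB gk Bz0.
have X2 := chain_jet2 oB oim sg (sub _ sh1) (sub _ sh2) (sub _ sk) hB h1xB gk Bz0.
have X3 := chain_jet3 oB oim sg (sub _ sh1) (sub _ sh2) (sub _ sk) hB h1xB gk Bz0.
have Xt := chain_jet_t oB oim sg (sub _ sh1) (sub _ sh2) (sub _ sk) hB gk Bz0.
have jet (F : P -> R) : smooth A F -> [/\ Dx (fun z => F (z, f z)) p0.1 = prol1 F p0 u1,
    Dx (Dx (fun z => F (z, f z))) p0.1 = prol2 F p0 u1 u2,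
    Dx (Dx (Dx (fun z => F (z, f z)))) p0.1 = prol3 F p0 u1 u2 + u3 * part_u F p0 &
    Dt (fun z => F (z, f z)) p0.1 = part_t F p0 + ut * part_u F p0].
  move=> sF.
  have e1 := graph_Dx1 oA oU1 (sTU _) U1A sF U1z.
  have e2 := graph_Dx2 oA oU1 (sTU _) U1A sF U1z.
  have e3 := graph_Dx3 oA oU1 (sTU _) U1A sF U1z.
  have [_ et] := graph_dt oA oU1 (sTU _) U1A sF U1z.
  have eu := congr1 (part_u F) p0E.
  split; [exact: (etrans e1 (congr2 (prol1 F) p0E fx)) | | |].
  - exact: (etrans e2 (f_equal3 (prol2 F) p0E fx fxx)).
  - exact: (etrans e3 (congr2 +%R (f_equal3 (prol3 F) p0E fx fxx) (congr2 *%R fxxx eu))).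
  - exact: (etrans et (congr2 +%R (congr1 (part_t F) p0E) (congr2 *%R ft eu))).
have [x1 x2 x3 xt] := jet X sX; have [y1 y2 y3 yt] := jet Y sY.
split.
- apply: (etrans _ (etrans X1 y1)); exact: (congr2 (fun w a => Dx g w * a) (esym h0) (esym x1)).
- apply: (etrans _ (etrans X2 y2)).
  exact: (f_equal3 (fun w a b => Dx (Dx g) w * a ^+ 2 + Dx g w * b) (esym h0) (esym x1) (esym x2)).
- apply: (etrans _ (etrans X3 y3)); rewrite -x3 -x2 -x1.
  exact: (congr1 (fun w => Dx (Dx (Dx g)) w * Dx h2 p0.1 ^+ 3
    + 3 * Dx (Dx g) w * Dx h2 p0.1 * Dx (Dx h2) p0.1 + Dx g w * Dx (Dx (Dx h2)) p0.1) (esym h0)).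
- apply: (etrans _ (etrans Xt yt)).
  exact: (f_equal3 (fun w a b => Dt g w * a + Dx g w * b) (esym h0) (esym h1t) (esym xt)).
Qed.

End Components.

End GraphTransform.


Section Linearizable.
Context {R : realType}.
Local Notation P := (R * R * R)%type.
Local Notation P2 := (R * R)%type.
Local Notation dirt := ((1, 0, 0) : P).
Local Notation dirx := ((0, 1, 0) : P).
Local Notation diru := ((0, 0, 1) : P).

Lemma near_shift (V : normedModType R) (A : set V) (p v : V) : open A -> A p ->
  exists2 h : R, h != 0 & A (h *: v + p).
Proof.
move=> oA Ap; have /nbhs_ballP[r /= r0 rP] := near_line v (nbhs_open oA Ap).
exists (r / 2); first by rewrite gt_eqF // divr_gt0.
by apply: rP; rewrite -ball_normE /= sub0r normrN gtr0_norm ?divr_gt0 //; lra.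
Qed.

(** The linear algebra behind the Jacobian of an equivalence transformation, whose derivative sends
    the x- and u-directions to vertical vectors. *)
Lemma independent_triangular (c a b : P) : a.1.1 = 0 -> b.1.1 = 0 ->
  (forall k l m : R, k *: c + (l *: a + m *: b) = 0 -> [/\ k = 0, l = 0 & m = 0]) ->
  det2 a b != 0 /\ c.1.1 != 0.
Proof.
move=> a0 b0 comb.
have d0 : det2 a b != 0.
  apply/eqP => d; have [a1|a1] := eqVneq a 0.
    have [|_ /eqP] := comb 0 1 0; first by rewrite a1 !scale0r scaler0 !addr0.
    by rewrite oner_eq0.
  have [m bE] := det2_parallel a0 b0 a1 d.
  have [|_ _ /eqP] := comb 0 m (-1); first by rewrite bE scaleN1r subrr scale0r addr0.
  by rewrite oppr_eq0 oner_eq0.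
split=> //; apply/eqP => c0.
have cE := det2_basis a0 b0 c0 d0.
have [|/eqP] := comb (-1) (det2 c b / det2 a b) (det2 a c / det2 a b).
  by rewrite -cE scaleN1r addNr.
by rewrite oppr_eq0 oner_eq0.
Qed.

(* [N] below is the coefficient with which the top derivative [u3] enters [g3]. *)
Lemma coeff_algebra (F G xx xu yx yu xt yt u1 x2 y2 x3 y3 tau a3 a2 a1 a0 b
    g0 g1 g2 g3 gt h0 h1 h2 h3 ht : R) :
  xx * yu - yx * xu != 0 -> xx + u1 * xu != 0 ->
  g1 * (xx + u1 * xu) = yx + u1 * yu ->
  g2 * (xx + u1 * xu) ^+ 2 + g1 * x2 = y2 ->
  g3 * (xx + u1 * xu) ^+ 3 + 3 * g2 * (xx + u1 * xu) * x2 + g1 * (x3 + 0 * xu) = y3 + 0 * yu ->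
  gt * tau + g1 * (xt + (F * 0 + G) * xu) = yt + (F * 0 + G) * yu ->
  gt = a3 * g3 + (a2 * g2 + a1 * g1 + a0 * g0 + b) ->
  h1 * (xx + u1 * xu) = yx + u1 * yu ->
  h2 * (xx + u1 * xu) ^+ 2 + h1 * x2 = y2 ->
  h3 * (xx + u1 * xu) ^+ 3 + 3 * h2 * (xx + u1 * xu) * x2 + h1 * (x3 + 1 * xu) = y3 + 1 * yu ->
  ht * tau + h1 * (xt + (F * 1 + G) * xu) = yt + (F * 1 + G) * yu ->
  ht = a3 * h3 + (a2 * h2 + a1 * h1 + a0 * h0 + b) -> g0 = h0 ->
  F * (xx + u1 * xu) ^+ 3 = a3 * tau.
Proof.
move=> d0; have dE : xx * yu - yx * xu = (xx + u1 * xu) * yu - (yx + u1 * yu) * xu by ring.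
move: d0; rewrite {}dE; set xi := xx + _; set eta := yx + _ => d0 xi0.
move=> e1 e2 e3 et gE f1 f2 f3 ft hE e0.
have h1E : h1 = g1 by apply: (mulIf xi0); rewrite f1 e1.
have h2E : h2 = g2.
  by apply: (mulIf (expf_neq0 2 xi0)); apply: (addIr (g1 * x2)); rewrite e2 -h1E f2.
rewrite {}h1E {}h2E -{}e0 in f1 f2 f3 ft hE.
set N := yu - g1 * xu.
have N0 : N != 0.
  apply: contraNneq d0 => N0; apply/eqP; rewrite -e1.
  have -> : xi * yu - g1 * xi * xu = xi * N by rewrite /N; ring.
  by rewrite N0 mulr0.
(* The identities for [u3 = 0] are subtracted from those for [u3 = 1]: the changes of the
   t-derivative and of the third x-derivative contain the same factor [N], which cancels. *)
have T : (ht - gt) * tau = F * N.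
  have -> : (ht - gt) * tau = ht * tau + g1 * (xt + (F * 1 + G) * xu)
    - (gt * tau + g1 * (xt + (F * 0 + G) * xu)) - g1 * F * xu by ring.
  by rewrite ft et /N; ring.
have S : (h3 - g3) * xi ^+ 3 = N.
  have -> : (h3 - g3) * xi ^+ 3 = h3 * xi ^+ 3 + 3 * g2 * xi * x2 + g1 * (x3 + 1 * xu)
    - (g3 * xi ^+ 3 + 3 * g2 * xi * x2 + g1 * (x3 + 0 * xu)) - g1 * xu by ring.
  by rewrite f3 e3 /N; ring.
apply: (mulfI N0); rewrite mulrA [N * F]mulrC -T -{1}S gE hE; ring.
Qed.

Section LinearizingMap.
Context (A : set P) (phi psi : P -> P) (T : R -> R) (oA : open A) (sphi : smooth A phi)
  (phiT : forall t x u, A (t, x, u) -> (phi (t, x, u)).1.1 = T t) (oI : open (phi @` A))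
  (spsi : smooth (phi @` A) psi) (psiK : forall p, A p -> psi (phi p) = p).

Let pphi : projectable A phi := conj sphi (ex_intro _ T phiT).
Local Notation time := (fun p => (phi p).1.1).
Local Notation X := (fun p => (phi p).1.2).
Local Notation Y := (fun p => (phi p).2).

Lemma derive_injective p v : A p -> 'D_v phi p = 0 -> v = 0.
Proof.
move=> Ap dv0; have dphi : differentiable phi p by exact: (smooth_differentiable oA sphi Ap).
have dpsi : differentiable psi (phi p).
  by apply: (smooth_differentiable oI spsi); exists p.
have [_ e] := is_derive_comp (differentiable_is_derive v dphi) dpsi.
have e0 : 'D_('D_v phi p) psi (phi p) = 0.
  by rewrite dv0 deriveE // linear0.
apply: (etrans _ (etrans e e0)); rewrite -[LHS](derive_id p v); apply: near_eq_derive.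
by apply: filterS (nbhs_open oA Ap) => z /psiK.
Qed.

Lemma jacobian_neq0 p : A p ->
  part_x X p * part_u Y p - part_x Y p * part_u X p != 0 /\ part_t time p != 0.
Proof.
move=> Ap; have dphi : differentiable phi p by exact: (smooth_differentiable oA sphi Ap).
have [_ ex ey] := derive_components oA pphi (0, 1, 0) Ap.
have [_ ux uy] := derive_components oA pphi (0, 0, 1) Ap.
have [et _ _] := derive_components oA pphi (1, 0, 0) Ap.
have a0 : ('D_dirx phi p).1.1 = 0.
  by apply: (etrans (projectable_derive _ oA pphi Ap)); exact: mul0r.
have b0 : ('D_diru phi p).1.1 = 0.
  by apply: (etrans (projectable_derive _ oA pphi Ap)); exact: mul0r.
have comb (k l m : R) : k *: 'D_dirt phi p + (l *: 'D_dirx phi p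
    + m *: 'D_diru phi p) = 0 -> [/\ k = 0, l = 0 & m = 0].
  move=> h; have : (k, l, m) = (0 : P).
    apply: (derive_injective Ap).
    have {1}-> : (k, l, m) = k *: dirt + (l *: dirx + m *: diru).
      by apply: triple_eq; rewrite /= /GRing.scale /= ?mulr0 ?mulr1 ?addr0 ?add0r.
    by rewrite !(derive_dirD _ _ dphi) !(derive_dirZ _ _ dphi).
  by case.
have [d0 t0] := independent_triangular a0 b0 comb.
split; last by apply: contraNneq t0 => /(etrans (esym et)) ->.
apply: contraNneq d0 => h; apply/eqP; apply: etrans h.
exact: (congr2 (fun a b => a - b) (congr2 *%R (esym ex) (esym uy)) (congr2 *%R (esym ey) (esym ux))).
Qed.

(** Two functions with the same 2-jet at [p] and third derivatives 0 and 1 are transformed, and the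
    linear equation for their images is compared. The cube stems from the third power of the total
    x-derivative of the new x in the transformed third derivative. *)
Lemma linearized_coeff (J : set (R * R * R * R * R)) (E E' : evolution_eq)
    (a3 a2 a1 a0 b : P2 -> R) p u1 u2 :
  maps_equation A phi J E E' -> J `<=` edom E ->
  (forall z (u u1 u2 : R), edom E' (z, u, u1, u2) -> eF E' (z, u, u1, u2) = a3 z /\
    eG E' (z, u, u1, u2) = a2 z * u2 + a1 z * u1 + a0 z * u + b z) ->
  A p -> J (p, u1, u2) -> prol1 X p u1 != 0 ->
  eF E (p, u1, u2) * prol1 X p u1 ^+ 3 = a3 (phi p).1 * part_t time p.
Proof.
move=> mapE JE lin Ap Jp xi0; have [d0 tau0] := jacobian_neq0 Ap.
set F := eF E (p, u1, u2); set G := eG E (p, u1, u2).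
have key (u3 : R) : exists g0 g1 g2 g3 gt : R, g0 = (phi p).2 /\
   [/\ g1 * prol1 X p u1 = prol1 Y p u1,
     g2 * prol1 X p u1 ^+ 2 + g1 * prol2 X p u1 u2 = prol2 Y p u1 u2,
     g3 * prol1 X p u1 ^+ 3 + 3 * g2 * prol1 X p u1 * prol2 X p u1 u2
          + g1 * (prol3 X p u1 u2 + u3 * part_u X p) = prol3 Y p u1 u2 + u3 * part_u Y p &
     gt * part_t time p + g1 * (part_t X p + (F * u3 + G) * part_u X p) =
       part_t Y p + (F * u3 + G) * part_u Y p] /\
   gt = a3 (phi p).1 * g3 + (a2 (phi p).1 * g2 + a1 (phi p).1 * g1 + a0 (phi p).1 * g0 + b (phi p).1).
  (* The prescribed t-derivative makes [f] satisfy [E] at [p]. *)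
  have [U [f [U' [g [[oU sf UA Uz] [[oU' sg car Uw] [[j f3 ft pf] eqs]]]]]]] :=
    graph_transform oA pphi u2 u3 (F * u3 + G) Ap xi0 tau0.
  have fp : (p.1, f p.1) = p.
    by have := congr1 (fun j : R * R * R * R * R => j.1.1) j.
  have [|dE' sE] := mapE U U' f g oU sf UA oU' sg car p.1 (phi p).1 Uz Uw pf.
    by rewrite j.
  have [eF' eG'] := lin _ _ _ _ dE'.
  do 5 eexists; split; last split; [|exact: eqs|].
    by apply: (etrans (esym (congr1 snd pf))); rewrite /= fp.
  have [h _] := sE; have {}h := h (etrans ft (esym (congr2 +%R
    (congr2 *%R (congr1 (eF E) j) f3) (congr1 (eG E) j)))).
  apply: (etrans h); apply: (congr2 _ (congr1 (fun y => y * _) eF') eG').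
have [g0 [g1 [g2 [g3 [gt [g0E [[e1 e2 e3 et] E0]]]]]]] := key 0.
have [h0 [h1 [h2 [h3 [ht [h0E [[f1 f2 f3 ft] F0]]]]]]] := key 1.
exact: (coeff_algebra d0 xi0 e1 e2 e3 et E0 f1 f2 f3 ft F0 (etrans g0E (esym h0E))).
Qed.

End LinearizingMap.

(** The cubed factor and the right-hand side in [linearized_coeff] do not involve u2, so moving u2
    alone inside [J] leaves the leading coefficient unchanged. *)
Lemma linearizable_coeff (E : @evolution_eq R) : linearizable E ->
  exists p u1 u2 u2', [/\ u2 != u2', edom E (p, u1, u2), edom E (p, u1, u2') &
    eF E (p, u1, u2) = eF E (p, u1, u2')].
Proof.
move=> [J [A [phi [E' [[oJ [[[p u1] u2] Jp] JE JA] [[oA sphi [T phiT] [psi [oI spsi psiK]]] mapE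
  [a3 [a2 [a1 [a0 [b lin]]]]]]]]]]].
have Ap := JA _ _ _ Jp.
have [d0 tau0] := jacobian_neq0 oA sphi phiT oI spsi psiK Ap.
(* The total x-derivative of the new x is affine in u1. If it vanished at two values, both its
   coefficients would, against the Jacobian; so u1 can be moved off a zero. *)
have pencil (xx xu yx yu h w : R) : h != 0 -> xx + w * xu = 0 -> xx + (h + w) * xu = 0 ->
    xx * yu - yx * xu = 0.
  move=> h0 e0 e1; have xu0 : xu = 0.
    by apply: (mulfI h0); rewrite mulr0 -{1}e1 -{1}[h * xu]addr0 -e0; ring.
  by move: e0; rewrite xu0 !mulr0 addr0 => ->; ring.
have [v1 Jv xi0] : exists2 v1, J (p, v1, u2) & prol1 (fun p => (phi p).1.2) p v1 != 0.
  have [xi0|xi0] := eqVneq (prol1 (fun p => (phi p).1.2) p u1) 0; last by exists u1.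
  have [h h0 Jh] := near_shift ((0 : P, 1 : R, 0 : R) : P * R * R) oJ Jp.
  exists (h + u1).
    suff -> : (p, h + u1, u2) = h *: (0 : P, 1 : R, 0 : R) + (p, u1, u2) by [].
    by rewrite -[RHS]/(h *: (0 : P) + p, h * 1 + u1, h * 0 + u2) scaler0 mulr1 mulr0 !add0r.
  apply: contraNneq d0 => xi1; apply/eqP; exact: (pencil (part_x _ p) (part_u _ p) _ _ h u1 h0 xi0 xi1).
have [h h0 Jh] := near_shift ((0 : P, 0 : R, 1 : R) : P * R * R) oJ Jv.
have {}Jh : J (p, v1, h + u2).
  suff -> : (p, v1, h + u2) = h *: (0 : P, 0 : R, 1 : R) + (p, v1, u2) by [].
  by rewrite -[RHS]/(h *: (0 : P) + p, h * 0 + v1, h * 1 + u2) scaler0 mulr1 mulr0 !add0r.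
exists p, v1, u2, (h + u2); split; [|exact: JE|exact: JE|].
  by rewrite -subr_eq0 opprD addrA addrAC subrr add0r oppr_eq0.
apply: (mulIf (expf_neq0 3 xi0)).
have e := linearized_coeff oA sphi phiT oI spsi psiK mapE JE lin Ap.
exact: (etrans (e _ _ Jv xi0) (esym (e _ _ Jh xi0))).
Qed.
End Linearizable.


(** * The normal form *)

Section NormalForm.
Context {R : realType} (q : R).
Local Notation P := (R * R * R)%type.

Lemma nf_eq_not_linearizable : ~ linearizable (nf_eq q).
Proof.
move=> /linearizable_coeff[p [u1 [u2 [u2' [u20 [u10 _] _ e]]]]].
have m0 : mfun (3 * q) p.1.1 != 0 by rewrite gt_eqF // mfun_gt0.
move: e; rewrite /= /nfF /omega /=.
move=> /(mulIf (invr_neq0 (expf_neq0 6 u10)))/(mulfI m0)/addIr/(mulfI (onesqr_neq0 _)) e.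
by rewrite e eqxx in u20.
Qed.

Lemma normal_formE : [/\ A49_normal_form q 0 = heis 1 0 0, A49_normal_form q 1 = heis 0 1 0,
  A49_normal_form q 2%:R = heis 0 0 1 & A49_normal_form q 3%:R = rot q].
Proof.
by split; apply/funext => -[[t x] u]; apply: triple_eq;
  rewrite /= ?mul0r ?mul1r ?addr0 ?add0r.
Qed.

Lemma is_derive_heis (c1 c2 c3 : R) (p v : P) :
  is_derive p v (heis c1 c2 c3) (0, c3 * v.2, c3 * v.1.1).
Proof.
have dt := is_derive_fst (is_derive_fst (is_derive_id p v)).
have du := is_derive_snd (is_derive_id p v).
have c (k : R) : is_derive p v (fun=> k) 0 by exact: is_derive_cst.
have H := is_derive_pair (is_derive_pair (c 0) (is_derive_add (c c1) (is_derive_mul (c c3) du)))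
  (is_derive_add (c c2) (is_derive_mul (c c3) dt)).
by apply: (is_derive_eq H); apply: triple_eq; rewrite /=; ring.
Qed.

Lemma is_derive_rot p v : is_derive p v (rot q)
  (- (2 * p.1.1 * v.1.1), 2 * q * v.1.2 - p.2 * v.2, - v.1.1 * p.2 + (q - p.1.1) * v.2).
Proof.
have dt := is_derive_fst (is_derive_fst (is_derive_id p v)).
have dx := is_derive_snd (is_derive_fst (is_derive_id p v)).
have du := is_derive_snd (is_derive_id p v).
have c (k : R) : is_derive p v (fun=> k) 0 by exact: is_derive_cst.
have H1 := is_derive_sub (c (-1)) (is_derive_mul dt dt).
have H2 := is_derive_sub (is_derive_mul (c (2 * q)) dx) (is_derive_mul (is_derive_mul du du) (c (2^-1))).
have H3 := is_derive_mul (is_derive_sub (c q) dt) du.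
rewrite (_ : rot q = fun y : P => (-1 - y.1.1 * y.1.1, 2 * q * y.1.2 - y.2 * y.2 * 2^-1,
    (q - y.1.1) * y.2)).
  apply: (is_derive_eq (is_derive_pair (is_derive_pair H1 H2) H3)).
  by apply: triple_eq; rewrite /=; field.
by apply/funext => y; apply: triple_eq; rewrite /=; field.
Qed.

Lemma smooth_normal_form_fields (c1 c2 c3 : R) : smooth setT (heis c1 c2 c3) /\ smooth setT (rot q).
Proof.
have oT : open [set: P] by exact: openT.
have s0 : smooth [set: P] (fun p : P => p) by exact: smooth_id.
have [st sx su] := smooth_coords oT s0.
have c (k : R) : smooth [set: P] (fun=> k) by exact: smooth_cst.
split; (apply: smooth_pair => //; [apply: smooth_pair => //|]); repeat
  (first [exact: c | assumption | apply: (smooth_add oT) | apply: (smooth_opp oT) |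
    apply: (smooth_mul oT) | apply: (smooth_exp _ oT)]).
Qed.

Lemma normal_form_realization : A49_realization q setT (A49_normal_form q).
Proof.
have [E0 E1 E2 E3] := normal_formE.
split; first exact: openT.
- move=> i; case: (I4_cases i) => ->; rewrite ?(E0, E1, E2, E3); split;
    first [exact: (smooth_normal_form_fields _ _ _).1 | exact: (smooth_normal_form_fields 0 0 0).2 |
     by exists (fun=> 0) | by exists (fun t => - (1 + t ^+ 2))].
- move=> k H.
  have S p : k 0 *: heis 1 0 0 p + (k 1 *: heis 0 1 0 p + (k 2%:R *: heis 0 0 1 p +
      k 3%:R *: rot q p)) = 0.
    rewrite -E0 -E1 -E2 -E3 -[RHS](H p I) !big_ord_recl big_ord0 addr0.
    have l0 : ord0 = 0 :> 'I_4 by exact: val_inj.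
    have l1 : lift ord0 ord0 = 1 :> 'I_4 by exact: val_inj.
    have l2 : lift ord0 (lift ord0 ord0) = 2%:R :> 'I_4 by exact: val_inj.
    have l3 : lift ord0 (lift ord0 (lift ord0 ord0)) = 3%:R :> 'I_4 by exact: val_inj.
    by rewrite l3 l2 l1 l0.
  have k3 : k 3%:R = 0.
    have := congr1 (fun r : P => r.1.1) (S 0); rewrite /= /GRing.scale /= => e.
    by apply: oppr_inj; rewrite oppr0 -[RHS]e; ring.
  have k0 : k 0 = 0.
    have := congr1 (fun r : P => r.1.2) (S 0); rewrite /= /GRing.scale /= k3 => e.
    by rewrite -[RHS]e; ring.
  have k1 : k 1 = 0.
    have := congr1 snd (S 0); rewrite /= /GRing.scale /= k3 => e.
    by rewrite -[RHS]e; ring.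
  (* The third field vanishes at the origin, so a point with t = 1 is used. *)
  have k2 : k 2%:R = 0.
    have := congr1 snd (S (1, 0, 0)); rewrite /= /GRing.scale /= k3 k1 => e.
    by rewrite -[RHS]e; ring.
  by move=> i; case: (I4_cases i) => ->.
move=> p _; rewrite E0 E1 E2 E3 /bracket.
have dh (c1 c2 c3 : R) v : 'D_v (heis c1 c2 c3) p = (0, c3 * v.2, c3 * v.1.1).
  by have [_] := is_derive_heis c1 c2 c3 p v.
have dr v : 'D_v (rot q) p =
  (- (2 * p.1.1 * v.1.1), 2 * q * v.1.2 - p.2 * v.2, - v.1.1 * p.2 + (q - p.1.1) * v.2).
  by have [_] := is_derive_rot p v.
rewrite !dh !dr; split; split; apply: triple_eq; rewrite /= /GRing.scale /=; ring.
Qed.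

Lemma normal_form_nonlinearizing : non_linearizing setT (A49_normal_form q).
Proof.
have [E0 E1 E2 E3] := normal_formE.
exists (nf_eq q); split; [exact: nf_eq_base | | exact: nf_eq_not_linearizable].
by move=> i; case: (I4_cases i) => ->; rewrite ?(E0, E1, E2, E3);
  [exact: heisenberg_symmetry | exact: heisenberg_symmetry | exact: heisenberg_symmetry |
   exact: rotation_symmetry].
Qed.

End NormalForm.

Theorem mainTheorem17 (R : realType) (q : R) (hq : 0 <= q) :
  (A49_realization q setT (A49_normal_form q) /\
   non_linearizing setT (A49_normal_form q)) /\
  (forall (D : set (R * R * R)) (e : 'I_4 -> vfield),
     A49_realization q D e -> non_linearizing D e ->
     equivalent D e setT (A49_normal_form q)).
Proof.
split; last exact: A49_classification.
by split; [exact: normal_form_realization | exact: normal_form_nonlinearizing].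
Qed.
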